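(* Let $Q$ be a null form on $\mathbb{R}^{3+1}$ and let $\psi_0:(0,1)\times\mathbb{S}^2\to\mathbb{R}$ be a fixed compactly supported smooth function. For $\delta>0$ define, for $\underline{u}\le\delta$ and $\theta\in\mathbb{S}^2$, $$\varphi_{-\infty}(\underline{u},\theta)=\begin{cases}0,&\underline{u}\le 0,\\ \delta^{\frac12}\,\psi_0\big(\tfrac{\underline{u}}{\delta},\theta\big),&0\le\underline{u}\le\delta.\end{cases}$$ If $\delta$ is sufficiently small, then there exists one and only one classical solution $\varphi$ of $$\Box\varphi=Q(\nabla\varphi,\nabla\varphi)$$ on the region $\mathcal{D}^+(\mathcal{I}^-_\delta)\cap\{t\le -1\}=\{\underline{u}\le\delta,\ t\le -1\}$ whose radiation field at past null infinity is $\varphi_{-\infty}$, i.e. such that $$\lim_{u\to-\infty}|u|\,\varphi(u,\underline{u},\theta)=\varphi_{-\infty}(\underline{u},\theta)\qquad\text{for all }\underline{u}\le\delta,\ \theta\in\mathbb{S}^2.$$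
   Context: The unknown $\varphi$ is a real scalar function; $\mathbb{R}^{3+1}$ is Minkowski space with coordinates $(t,x_1,x_2,x_3)$ (also $x_0=t$), metric $g=-dt^2+dx_1^2+dx_2^2+dx_3^2$ and $\Box=-\partial_t^2+\partial_1^2+\partial_2^2+\partial_3^2$. A null form is a real form $Q(\xi,\eta)=Q^{\alpha\beta}\xi_\alpha\eta_\beta$ with constant coefficients such that $Q(\xi,\xi)=0$ for every null vector $\xi$ (i.e. $-\xi_0^2+\xi_1^2+\xi_2^2+\xi_3^2=0$); $Q(\nabla\phi,\nabla\psi)=Q^{\alpha\beta}\partial_\alpha\phi\,\partial_\beta\psi$. With $r=\sqrt{x_1^2+x_2^2+x_3^2}$, the null-polar coordinates are $(u,\underline{u},\theta)$ with $u=\frac12(t-r)$, $\underline{u}=\frac12(t+r)$, $\theta\in\mathbb{S}^2$. Past null infinity $\mathcal{I}^-$ is parameterized by $(\underline{u},\theta)\in\mathbb{R}\times\mathbb{S}^2$ (limits $u\to-\infty$ at fixed $(\underline{u},\theta)$), $\mathcal{I}^-_\delta=\{(\underline{u},\theta)\in\mathcal{I}^-:\underline{u}\le\delta\}$, and its domain of dependence $\mathcal{D}^+(\mathcal{I}^-_\delta)$ is the solid backward light cone $\{\underline{u}\le\delta\}$.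
   Formalization: The limit |u|φ → φ_{-∞} is required locally uniformly in (u̲,θ), for existence and for uniqueness; with only the pointwise limit uniqueness fails, e.g. Q = 0 and φ + x₂h(t+x₁) with h smooth, compactly supported in (-1,0). *)

(* Defs.v *)
From HB Require Import structures.
From mathcomp Require Import all_boot all_order all_algebra.
From mathcomp Require Import all_classical all_reals all_analysis.
Set Implicit Arguments.
Unset Strict Implicit.
Unset Printing Implicit Defensive.
Import Order.TTheory GRing.Theory Num.Theory.
Import numFieldNormedType.Exports.
Local Open Scope classical_set_scope.
Local Open Scope ring_scope.

(* The library norm of 'rV[R]_n is the sup norm. *)
Definition euclidean_norm {R : realType} {n : nat} (x : 'rV[R]_n) : R :=
  Num.sqrt (\sum_(i < n) x 0 i ^+ 2).

Definition sphere2 {R : realType} : set 'rV[R]_3 :=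
  [set w | euclidean_norm w = 1].

Definition partial {R : realType} {n : nat} (i : 'I_n) (f : 'rV[R]_n -> R) :
    'rV[R]_n -> R :=
  fun p => 'D_(delta_mx 0 i) f p.

(* f is of class C^k on the open set U. *)
Fixpoint Ck {R : realType} {n : nat} (k : nat) (U : set 'rV[R]_n)
    (f : 'rV[R]_n -> R) : Prop :=
  (forall p, U p -> {for p, continuous f}) /\
  match k with
  | 0%N => True
  | k'.+1 => forall i : 'I_n,
      (forall p, U p -> derivable f p (delta_mx 0 i)) /\
      Ck k' U (partial i f)
  end.

(* Smoothness on an arbitrary subset X of R^n (such as a submanifold): f is
   locally the restriction to X of a smooth function on an open set.  Only the
   values of f on X matter. *)
Definition smooth_on {R : realType} {n : nat} (X : set 'rV[R]_n)
    (f : 'rV[R]_n -> R) : Prop :=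
  forall p, X p -> exists U : set 'rV[R]_n, exists F : 'rV[R]_n -> R,
    [/\ open U, U p, (forall k, Ck k U F) & forall q, U q -> X q -> f q = F q].

Definition compactly_supported_in {R : realType} {n : nat} (X : set 'rV[R]_n)
    (f : 'rV[R]_n -> R) : Prop :=
  exists K : set 'rV[R]_n,
    [/\ compact K, K `<=` X & forall q, X q -> ~ K q -> f q = 0].

(* A point of R^{3+1} is a row vector (x_0, x_1, x_2, x_3) with x_0 = t. *)
Definition tcoord {R : realType} (p : 'rV[R]_(1 + 3)) : R := p 0 ord0.

Definition xcoord {R : realType} (p : 'rV[R]_(1 + 3)) : 'rV[R]_3 := rsubmx p.

Definition event {R : realType} (t : R) (x : 'rV[R]_3) : 'rV[R]_(1 + 3) :=
  row_mx t%:M x.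

Definition ubar {R : realType} (p : 'rV[R]_(1 + 3)) : R :=
  (tcoord p + euclidean_norm (xcoord p)) / 2.

(* The point with null-polar coordinates (u, ub, w), for u <= ub and w on the
   unit sphere: t = u + ub and r = ub - u. *)
Definition null_polar {R : realType} (u ub : R) (w : 'rV[R]_3) :
    'rV[R]_(1 + 3) :=
  event (u + ub) ((ub - u) *: w).

Definition metric_sign {R : realType} (a : 'I_(1 + 3)) : R :=
  if a == ord0 then -1 else 1.

Definition null_vector {R : realType} (xi : 'rV[R]_(1 + 3)) : Prop :=
  \sum_(a < 1 + 3) metric_sign a * xi 0 a ^+ 2 = 0.

Definition box {R : realType} (f : 'rV[R]_(1 + 3) -> R)
    (p : 'rV[R]_(1 + 3)) : R :=
  \sum_(a < 1 + 3) metric_sign a * partial a (partial a f) p.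

Definition form {R : realType} (Q : 'M[R]_(1 + 3))
    (xi eta : 'rV[R]_(1 + 3)) : R :=
  \sum_(a < 1 + 3) \sum_(b < 1 + 3) Q a b * xi 0 a * eta 0 b.

Definition null_form {R : realType} (Q : 'M[R]_(1 + 3)) : Prop :=
  forall xi : 'rV[R]_(1 + 3), null_vector xi -> form Q xi xi = 0.

Definition gradient {R : realType} (f : 'rV[R]_(1 + 3) -> R)
    (p : 'rV[R]_(1 + 3)) : 'rV[R]_(1 + 3) :=
  \row_(a < 1 + 3) partial a f p.

(* C^2 solutions of the equation on a set X that is the closure of its
   interior, up to the boundary: the derivatives at a boundary point are those
   of a local C^2 extension, and they do not depend on the extension. *)
Definition classical_solution {R : realType} (Q : 'M[R]_(1 + 3))
    (X : set 'rV[R]_(1 + 3)) (phi : 'rV[R]_(1 + 3) -> R) : Prop :=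
  forall p, X p ->
    exists U : set 'rV[R]_(1 + 3), exists F : 'rV[R]_(1 + 3) -> R,
      [/\ open U, U p, Ck 2 U F,
          (forall q, U q -> X q -> phi q = F q) &
          forall q, U q -> X q ->
            box F q = form Q (gradient F q) (gradient F q)].

Definition region {R : realType} (delta : R) : set 'rV[R]_(1 + 3) :=
  [set p | ubar p <= delta /\ tcoord p <= -1].

(* (0,1) x S^2, as a subset of R x R^3 = R^4. *)
Definition cylinder {R : realType} : set 'rV[R]_(1 + 3) :=
  [set p | 0 < tcoord p < 1 /\ sphere2 (xcoord p)].

(* Since psi0 has compact support in (0,1) x S^2, its extension to the
   endpoints 0 and 1 of the first variable is 0. *)
Definition past_data {R : realType} (psi0 : R -> 'rV[R]_3 -> R) (delta ub : R)
    (w : 'rV[R]_3) : R :=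
  if 0 < ub < delta then Num.sqrt delta * psi0 (ub / delta) w else 0.

(* lim_(u -> -oo) |u| phi(u, ub, w) = f ub w for ub <= delta and w in S^2, as a
   limit of functions on past null infinity, i.e. locally uniform in (ub, w) in
   (-oo, delta] x S^2.  Separate convergence at each (ub, w) does not determine
   a solution: if h is smooth with compact support in (-1, 0), then
   phi = x_2 h(t + x_1) solves box phi = 0 (the case Q = 0), and
   |u| phi(u, ub, w) -> 0 for every (ub, w), although phi <> 0. *)
Definition has_radiation_field {R : realType} (delta : R)
    (phi : 'rV[R]_(1 + 3) -> R) (f : R -> 'rV[R]_3 -> R) : Prop :=
  forall a e : R, 0 < e -> \forall u \near -oo, forall (ub : R) (w : 'rV[R]_3),
    a <= ub <= delta -> sphere2 w ->
    `| `|u| * phi (null_polar u ub w) - f ub w | < e.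

(* Main.v *)
(* A null form is a multiple c of the Minkowski form, so the substitution
   w = (1 - exp (- c phi)) / c (w = phi if c = 0), which is tangent to the
   identity at 0, turns the equation into the wave equation for w and preserves
   radiation fields.

   Existence: w is the mean value over the unit sphere of the plane waves
   delta^(-1/2) (d_s psi0) ((t + <om, x>) / (2 delta), om).  The phase lies in
   the support of psi0 only on a set of directions of measure O(delta / r), so w
   is O(delta^(1/2)) on {t <= -1} and the substitution can be inverted there for
   small delta; as u tends to -oo this set shrinks to the direction om = x / r,
   which gives the radiation field.

   Uniqueness: the difference v of two solutions after the substitution solves
   the wave equation and |u| v tends to 0 locally uniformly at past null
   infinity.  Kirchhoff's formula expresses v at a point by means over spheres on
   its backward cone, which recede to past null infinity; hence v = 0 in the
   interior of the region, and on its boundary by continuity. *)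

Require Import Defs.
From HB Require Import structures.
From mathcomp Require Import all_boot all_order all_algebra.
From mathcomp Require Import all_classical all_reals all_analysis.
From mathcomp Require Import ring lra.
Set Implicit Arguments.
Unset Strict Implicit.
Unset Printing Implicit Defensive.
Import Order.TTheory GRing.Theory Num.Theory.
Import numFieldNormedType.Exports.
Local Open Scope classical_set_scope.
Local Open Scope ring_scope.

(** Kirchhoff's formula contains first derivatives of [v], on which a radiation field says nothing.
    The way out: the mean of the Kirchhoff integrand is the derivative of radius times spherical
    mean when time and radius grow together. Integrated over a short segment of vertices, it
    expresses the values of [v] there through spherical means of [v] alone, and these decay. The
    same identity for a plane wave gives Archimedes' hat-box theorem without rotating the sphere:
    the mean of [g'(a + k n . om)] is [(g(a + k) - g(a - k)) / (2 k)]. This is why the plane waves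
    carry [d_s psi0]: at [(u, ub)] the end values are [psi0] at [ub / delta] and at [u / delta], and
    the latter vanishes for [u < 0]. Sets of directions are never measured: a smooth weight with
    primitive [atan] replaces indicator functions, so means of continuous functions suffice. [Ck]
    speaks only of partial derivatives, hence total differentiability and the symmetry of second
    derivatives are proved first. *)

Section Calculus.
Context {R : realType}.

Lemma is_derive_line (V : normedModType R) (f : V -> R) (p v : V) (s df : R) :
  is_derive (s *: v + p) v f df ->
  is_derive s 1 (fun h => f (h *: v + p)) df.
Proof.
move=> [fd <-].
have H : (fun h0 : R => h0^-1 *: (((fun h => f (h *: v + p)) \o shift s) (h0 *: 1) - f (s *: v + p))) =
  (fun h0 => h0^-1 *: ((f \o shift (s *: v + p)) (h0 *: v) - f (s *: v + p))).
  by apply/funext => h /=; rewrite scalerDl -addrA [h *: 1]mulr1.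
by split; rewrite /derivable /derive H.
Qed.

Lemma is_derive_dirP (V : normedModType R) (f : V -> R) (p v : V) (df : R) :
  is_derive p v f df <-> is_derive (0 : R) 1 (fun h : R => f (h *: v + p)) df.
Proof.
split; first by move=> h; apply: is_derive_line; rewrite scale0r add0r.
have H : (fun h0 : R => h0^-1 *: (((fun h => f (h *: v + p)) \o shift 0) (h0 *: 1) - f (0 *: v + p))) =
  (fun h0 => h0^-1 *: ((f \o shift p) (h0 *: v) - f p)).
  by apply/funext => h /=; rewrite addr0 scale0r add0r [h *: 1]mulr1.
by case; rewrite /derivable /derive H => h1 h2; split.
Qed.

(** Only [|s| <= |h|] is recorded about the intermediate point, so that one statement covers both
    signs of [h]; for negative [h] the one-variable theorem is applied on [[h, 0]]. *)
Lemma mvt_dir (V : normedModType R) (f : V -> R) (p v : V) (h : R) :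
  (forall s : R, `|s| <= `|h| -> derivable f (s *: v + p) v) ->
  exists2 s : R, `|s| <= `|h| & f (h *: v + p) - f p = h * 'D_v f (s *: v + p).
Proof.
move=> fd.
have gd (s : R) : `|s| <= `|h| ->
    is_derive s 1 (fun h => f (h *: v + p)) ('D_v f (s *: v + p)).
  by move=> sh; apply: is_derive_line; apply: derivableP; exact: fd.
have gc a b : (forall s, s \in `[a, b] -> `|s| <= `|h|) ->
   {within `[a, b], continuous (fun h => f (h *: v + p))}.
  move=> ab; apply: derivable_within_continuous => s /ab /gd[dd _]; exact: dd.
have [h0|h0] := leP 0 h.
  have [s|s|s] := @MVT_segment R (fun h => f (h *: v + p))
      (fun s => 'D_v f (s *: v + p)) 0 h h0.
  - rewrite in_itv/= => /andP[s0 sh]; apply: gd.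
    by rewrite (ger0_norm h0) (gtr0_norm s0) ltW.
  - apply: gc => r; rewrite in_itv/= => /andP[r0 rh].
    by rewrite (ger0_norm h0) (ger0_norm r0).
  - rewrite in_itv/= => /andP[s0 sh]; rewrite scale0r add0r subr0 => E.
    by exists s; [rewrite (ger0_norm h0) (ger0_norm s0) | rewrite E mulrC].
have [s|s|s] := @MVT_segment R (fun h => f (h *: v + p))
    (fun s => 'D_v f (s *: v + p)) h 0 (ltW h0).
- rewrite in_itv/= => /andP[s0 sh]; apply: gd.
  by rewrite (ltr0_norm h0) (ltr0_norm sh) lerN2 ltW.
- apply: gc => r; rewrite in_itv/= => /andP[r0 rh].
  by rewrite (ltr0_norm h0) (ler0_norm rh) lerN2.
- rewrite in_itv/= => /andP[s0 sh]; rewrite scale0r add0r sub0r => E.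
  exists s; first by rewrite (ltr0_norm h0) (ler0_norm sh) lerN2.
  by rewrite -opprB E mulrN opprK mulrC.
Qed.

End Calculus.

(** Serves to compare [|u| * S phi] with [|u| * phi] at past null infinity: an error small relative
    to [|y|] stays small after multiplication by [|u|]. *)
Lemma derive_near_id (R : realType) (S : R -> R) (e : R) :
  S 0 = 0 -> is_derive (0 : R) 1 S 1 -> 0 < e ->
  exists2 eta : R, 0 < eta & forall y, `|y| < eta -> `|S y - y| <= e * `|y|.
Proof.
move=> S0 [dS vS] e0.
have H : h^-1 *: (S (h *: 1 + 0) - S 0) @[h --> 0^'] --> 'D_1 S 0 by exact: dS.
move: H; rewrite vS => /cvgrPdist_le /(_ _ e0).
rewrite near_withinE => /nbhs_ballP[eta /= eta0 etaP]; exists eta => // y yeta.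
have [->|y0] := eqVneq y 0; first by rewrite S0 subr0 normr0 mulr0.
have := etaP y; rewrite /ball/= sub0r normrN => /(_ yeta y0).
rewrite S0 subr0 addr0 /GRing.scale/= mulr1 => Hy.
have -> : S y - y = - (y * (1 - y^-1 * S y)) by field.
by rewrite normrN normrM mulrC ler_wpM2r.
Qed.

Local Opaque derive.

(** * Coordinates of row vectors and continuity of elementary operations *)

Section RowVectors.
Context {R : realType} {n : nat}.
Implicit Types x y : 'rV[R]_n.

Lemma coord_le_norm x i : `|x 0 i| <= `|x|.
Proof.
rewrite [leRHS]/Num.Def.normr/= mx_normrE.
exact: (le_bigmax _ (fun ij : 'I_1 * 'I_n => `|x ij.1 ij.2|) (0, i)).
Qed.

Lemma norm_le_coord x (c : R) : 0 <= c -> (forall i, `|x 0 i| <= c) -> `|x| <= c.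
Proof.
move=> c0 xc; rewrite [leLHS]/Num.Def.normr/= mx_normrE.
by apply: bigmax_le => //= -[i j] _ /=; rewrite (ord1 i); exact: xc.
Qed.

Lemma cvg_row (T : Type) (F : set_system T) (FF : Filter F) (g : T -> 'rV[R]_n)
    (l : 'rV[R]_n) :
  (forall i, (fun t => g t 0 i) @ F --> l 0 i) -> g @ F --> l.
Proof.
move=> gl; apply/cvgrPdist_le => /= e e0.
have : \forall t \near F, forall i, `|l 0 i - g t 0 i| <= e.
  by apply: filter_forall => i; move/cvgrPdist_le : (gl i); exact.
apply: filterS => t H; apply: norm_le_coord; first exact: ltW.
by move=> i; rewrite !mxE.
Qed.

Lemma continuous_row (T : topologicalType) (g : T -> 'rV[R]_n) (t : T) :
  (forall i, {for t, continuous (fun t => g t 0 i)}) -> {for t, continuous g}.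
Proof. by move=> gc; apply: cvg_row => i; exact: gc. Qed.

End RowVectors.

Lemma continuous_sum (R : realType) (T : topologicalType) (I : Type) (r : seq I)
    (F : I -> T -> R) (t : T) :
  (forall i, {for t, continuous (F i)}) ->
  {for t, continuous (fun x => \sum_(i <- r) F i x)}.
Proof.
move=> Fc; elim: r => [|i r IH].
  have -> : (fun x => \sum_(i <- [::]) F i x) = cst 0.
    by apply/funext => x; rewrite big_nil.
  exact: cst_continuous.
have -> : (fun x => \sum_(j <- i :: r) F j x) = F i \+ (fun x => \sum_(j <- r) F j x).
  by apply/funext => x; rewrite big_cons.
exact: continuousD.
Qed.

Section ContinuousOps.
Context {R : realType} {T : topologicalType}.
Implicit Types (f g : T -> R) (t : T).

Lemma cont_cst (c : R) t : {for t, continuous (fun _ : T => c)}.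
Proof. exact: cst_continuous. Qed.

Lemma contT f : (forall t, {for t, continuous f}) -> continuous f.
Proof. by []. Qed.

Lemma cont_mul f g t : {for t, continuous f} -> {for t, continuous g} ->
  {for t, continuous (fun x => f x * g x)}.
Proof. by move=> fc gc; exact: (@continuousM _ _ f g). Qed.

Lemma cont_add f g t : {for t, continuous f} -> {for t, continuous g} ->
  {for t, continuous (fun x => f x + g x)}.
Proof. by move=> fc gc; exact: (@continuousD _ _ _ f g). Qed.

Lemma cont_opp f t : {for t, continuous f} -> {for t, continuous (fun x => - f x)}.
Proof. by move=> fc; exact: (@continuousN _ _ _ f). Qed.

Lemma cont_sub f g t : {for t, continuous f} -> {for t, continuous g} ->
  {for t, continuous (fun x => f x - g x)}.
Proof. by move=> fc gc; apply: cont_add => //; exact: cont_opp. Qed.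

End ContinuousOps.

Lemma near_eq_continuous (T U : topologicalType) (f g : T -> U) (p : T) :
  (\near p, f p = g p) -> {for p, continuous f} -> {for p, continuous g}.
Proof.
move=> fg fc; rewrite /prop_for /continuous_at -(nbhs_singleton fg).
exact: cvg_trans (near_eq_cvg fg) fc.
Qed.

(** * Functions of class C^k *)

Section Ck.
Context {R : realType} {n : nat}.
Implicit Types (U : set 'rV[R]_n) (f g : 'rV[R]_n -> R).

(** Plays two roles: the differential of a function, with [c] its partial derivatives, and the phase
    of a plane wave, with [c] its covector. *)
Definition lin_form (c : 'I_n -> R) (h : 'rV[R]_n) : R := \sum_(i < n) h 0 i * c i.

Lemma lin_form_is_linear c : linear (lin_form c).
Proof.
move=> a u v; rewrite /lin_form scaler_sumr -big_split/=.
by apply: eq_bigr => i _; rewrite !mxE mulrDl -mulrA.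
Qed.
HB.instance Definition _ c :=
  GRing.isLinear.Build _ _ _ _ (lin_form c) (lin_form_is_linear c).

Lemma lin_form_continuous c : continuous (lin_form c).
Proof.
move=> x; apply: continuous_sum => i.
by apply: continuousM; [exact: coord_continuous|exact: cst_continuous].
Qed.

Lemma Ck_continuous k U f p : Ck k U f -> U p -> {for p, continuous f}.
Proof. by case: k => [|k] [fc _]; exact: fc. Qed.

Lemma Ck_derivable k U f i p : Ck k.+1 U f -> U p -> derivable f p (delta_mx 0 i).
Proof. by case=> _ /(_ i)[+ _]; exact. Qed.

Lemma Ck_is_derive k U f i p : Ck k.+1 U f -> U p ->
  is_derive p (delta_mx 0 i) f (partial i f p).
Proof. by move=> fC Up; apply: derivableP; exact: Ck_derivable fC Up. Qed.

Lemma Ck_partial k U f i : Ck k.+1 U f -> Ck k U (partial i f).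
Proof. by case=> _ /(_ i)[]. Qed.

Lemma CkW k U f : Ck k.+1 U f -> Ck k U f.
Proof.
elim: k f => [|k IH] f fC; first by split => // p; exact: Ck_continuous fC.
split=> [p|i]; first exact: Ck_continuous fC.
by split=> [p Up|]; [exact: Ck_derivable fC Up|exact/IH/Ck_partial].
Qed.

Lemma Ck_subset k U V f : V `<=` U -> Ck k U f -> Ck k V f.
Proof.
move=> VU; elim: k f => [|k IH] f [fc fd]; split => //; try by move=> p /VU /fc.
move=> i; have [fdi fCi] := fd i; split; last exact: IH.
by move=> p /VU; exact: fdi.
Qed.

Lemma open_near_eq U f g p : open U -> (forall q, U q -> f q = g q) -> U p ->
  \near p, f p = g p.
Proof. by move=> oU fg Up; near=> q; apply: fg; near: q; exact: open_nbhs_nbhs. Unshelve. all: by end_near. Qed.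

Lemma eq_partial U f g i p : open U -> (forall q, U q -> f q = g q) -> U p ->
  partial i f p = partial i g p.
Proof. by move=> oU fg Up; apply/near_eq_derive/(open_near_eq oU fg Up). Qed.

Lemma eq_Ck k U f g : open U -> (forall q, U q -> f q = g q) ->
  Ck k U f -> Ck k U g.
Proof.
move=> oU; elim: k f g => [|k IH] f g fg [fc fd].
  by split=> // p Up; apply: near_eq_continuous (open_near_eq oU fg Up) (fc p Up).
split=> [p Up|i].
  by apply: near_eq_continuous (open_near_eq oU fg Up) (fc p Up).
split=> [p Up|].
  by apply: near_eq_derivable (open_near_eq oU fg Up) _; exact: (fd i).1.
by apply: IH (fd i).2 => q Uq; exact: eq_partial oU fg Uq.
Qed.

(* Telescoping along the coordinate directions and applying the mean value
   theorem to each step. *)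
Lemma C1_expansion U f p (e : R) : open U -> Ck 1 U f -> U p -> 0 < e ->
  \forall h \near (0 : 'rV[R]_n),
    `|f (h + p) - f p - lin_form (fun i => partial i f p) h| <= e * `|h|.
Proof.
move=> oU fC Up e0.
(* Each of the [n] coordinate steps contributes one error; [n.+1] also covers [n = 0]. *)
have e1 : 0 < e / n.+1%:R by rewrite divr_gt0.
have : \forall q \near p, U q /\ forall i, `|partial i f p - partial i f q| <= e / n.+1%:R.
  apply: filterI; first exact: open_nbhs_nbhs.
  apply: (@filter_forall _ _
    (fun i q => `|partial i f p - partial i f q| <= e / n.+1%:R) (nbhs p)) => i.
  have := Ck_continuous (Ck_partial i fC) Up.
  by move/cvgrPdist_le => /(_ _ e1).
move=> /nbhs_ballP[d /= d0 dP].
have dQ h : `|h| < d -> U (h + p) /\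
    forall i, `|partial i f p - partial i f (h + p)| <= e / n.+1%:R.
  move=> hd; apply: dP; rewrite -ball_normE /ball_/=.
  by rewrite opprD addrCA subrr addr0 normrN.
apply/nbhs_ballP; exists d => // h; rewrite -ball_normE /ball_/= sub0r normrN => hd.
(* [hk k] keeps the first [k] coordinates of [h], so [hk 0 = 0] and [hk n = h], and every point met
   on the way stays in the sup-norm ball of radius [|h|]. *)
pose hk k : 'rV[R]_n := \row_j (if (j < k)%N then h 0 j else 0).
have hkS (k : 'I_n) : hk k.+1 = h 0 k *: delta_mx 0 k + hk k.
  apply/rowP => j; rewrite !mxE eqxx/= ltnS leq_eqVlt val_eqE.
  have [->|jk]/= := eqVneq j k; first by rewrite ltnn mulr1 addr0.
  by rewrite mulr0 add0r.
have hksmall (k : 'I_n) s : `|s| <= `|h 0 k| -> `|s *: delta_mx 0 k + hk k| <= `|h|.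
  move=> sh; apply: norm_le_coord => // j; rewrite !mxE eqxx/=.
  have [->|jk]/= := eqVneq j k.
    by rewrite ltnn mulr1 addr0 (le_trans sh)// coord_le_norm.
  by rewrite mulr0 add0r; case: ifP => _; rewrite ?normr0// coord_le_norm.
have -> : f (h + p) - f p = \sum_(k < n) (f (hk k.+1 + p) - f (hk k + p)).
  rewrite -(big_mkord xpredT (fun k => f (hk k.+1 + p) - f (hk k + p))).
  rewrite telescope_sumr//; congr (f _ - f _).
    by congr (_ + _); apply/rowP => j; rewrite mxE ltn_ord.
  by rewrite -[LHS]add0r; congr (_ + _); apply/rowP => j; rewrite !mxE.
rewrite /lin_form -sumrB.
apply: (@le_trans _ _ (\sum_(k < n) (e / n.+1%:R * `|h|))); last first.
  rewrite sumr_const card_ord -mulrnAl ler_wpM2r// -[leRHS](@mulfVK _ n.+1%:R)//.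
  by rewrite -mulr_natr ler_wpM2l ?ler_nat// ltW.
apply: le_trans (ler_norm_sum _ _ _) _; apply: ler_sum => k _.
have [s sh E] : exists2 s, `|s| <= `|h 0 k| & f (h 0 k *: delta_mx 0 k + (hk k + p)) - f (hk k + p) =
    h 0 k * 'D_(delta_mx 0 k) f (s *: delta_mx 0 k + (hk k + p)).
  apply: mvt_dir => s sh; rewrite addrA.
  have H := @Ck_derivable 0 U f k (s *: delta_mx 0 k + hk k + p) fC.
  apply: H.
  by apply: (dQ _ _).1; exact: le_lt_trans (hksmall _ _ sh) hd.
rewrite hkS -[_ *: _ + _ + p]addrA E -mulrBr normrM mulrC ler_pM// ?coord_le_norm//.
rewrite distrC addrA; apply: (dQ _ _).2.
exact: le_lt_trans (hksmall _ _ sh) hd.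
Qed.

(** Upgrades the axis-wise derivatives of [Ck] to a total differential, on which the chain rule
    along curves rests. The expansion first identifies ['d f p] by uniqueness and then shows that it
    is a differential. *)
Lemma C1_diff U f p : open U -> Ck 1 U f -> U p ->
  differentiable f p /\ 'd f p = lin_form (fun i => partial i f p) :> (_ -> _).
Proof.
move=> oU fC Up.
have D := @diff_unique R 'rV[R]_n R f (lin_form (fun i => partial i f p)) p
  (@lin_form_continuous _).
have E (e : R) : 0 < e -> \forall h \near (0 : 'rV[R]_n),
    `|f (h + p) - (f p + lin_form (fun i => partial i f p) h)| <= e * `|h|.
  move=> e0; apply: filterS (C1_expansion oU fC Up e0) => h.
  by rewrite opprD addrA.
have {}D : 'd f p = lin_form (fun i => partial i f p) :> (_ -> _).
  by apply: D; apply: (proj2 (eqaddoP _ _ _ _)) => e /E.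
split=> //; apply/diff_locallyP; rewrite D; split => //.
  exact: lin_form_continuous.
by apply: (proj2 (eqaddoP _ _ _ _)) => e /E.
Qed.

Lemma C1_chain U f (g : R -> 'rV[R]_n) (dg : 'I_n -> R) (s : R) :
  open U -> Ck 1 U f -> U (g s) ->
  (forall i, is_derive s 1 (fun t => g t 0 i) (dg i)) ->
  is_derive s 1 (fun t => f (g t)) (\sum_(i < n) dg i * partial i f (g s)).
Proof.
move=> oU fC Ugs gd.
have [fd fD] := C1_diff oU fC Ugs.
have dg1 : derivable g s 1.
  by apply/derivable_mxP => i j; rewrite (ord1 i); exact: ex_derive.
have dg2 : differentiable g s by exact/derivable1_diffP.
have dfg : differentiable (f \o g) s by exact: differentiable_comp.
split; first exact/derivable1_diffP.
have -> : 'D_1 (f \o g) s = 'd (f \o g) s 1 by rewrite deriveE.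
rewrite diff_comp//= fD -(deriveE _ dg2) /lin_form; apply: eq_bigr => i _.
by rewrite derive_mx// mxE; congr (_ * _); exact: derive_val.
Qed.

(** The mean value theorem is used twice: in direction [i] for [F], the increment of [f] along
    direction [j], then in direction [j] for [partial i f]. The intermediate point has norm at most
    [h + h], the worst case being [i = j]. *)
Lemma second_difference U f p i j (d h : R) : 0 < h -> h + h < d ->
  (forall q, `|q| < d -> U (q + p)) -> Ck 2 U f ->
  exists2 q, `|q| < d & f (h *: delta_mx 0 i + (h *: delta_mx 0 j + p))
    - f (h *: delta_mx 0 i + p) - f (h *: delta_mx 0 j + p) + f p
    = h * h * partial j (partial i f) (q + p).
Proof.
move=> h0 hd dU fC.
have nd (k : 'I_n) (s : R) : `|s *: delta_mx 0 k : 'rV[R]_n| <= `|s|.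
  apply: norm_le_coord => // l; rewrite !mxE eqxx/=.
  by case: eqP => _; rewrite ?mulr1// mulr0 normr0.
have sd (s r : R) : `|s| <= `|h| -> `|r| <= `|h| ->
    `|s *: delta_mx 0 i + r *: delta_mx 0 j : 'rV[R]_n| < d.
  rewrite !(gtr0_norm h0) => sh rh; apply: le_lt_trans hd.
  by rewrite (le_trans (ler_normD _ _))// lerD// (le_trans (nd _ _)).
pose F q := f (h *: delta_mx 0 j + q) - f q.
have FD s : `|s| <= `|h| -> is_derive (s *: delta_mx 0 i + p) (delta_mx 0 i) F
    (partial i f (h *: delta_mx 0 j + (s *: delta_mx 0 i + p)) - partial i f (s *: delta_mx 0 i + p)).
  move=> sh; apply: is_deriveB.
    have Us : U (h *: delta_mx 0 j + (s *: delta_mx 0 i + p)).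
      by rewrite addrCA addrA; apply: dU; exact: sd.
    have /is_derive_dirP H := Ck_is_derive i fC Us.
    apply/is_derive_dirP; move: H; congr (is_derive _ _ _ _).
    by apply/funext => t; congr f; rewrite addrCA.
  apply: (Ck_is_derive _ fC); apply: dU.
  have := sd s 0 sh; rewrite scale0r addr0; apply.
  by rewrite normr0.
have [s sh E1] := @mvt_dir R _ F p (delta_mx 0 i) h (fun s sh => @ex_derive _ _ _ _ _ _ _ (FD s sh)).
have [r rh E2] : exists2 r, `|r| <= `|h| & partial i f (h *: delta_mx 0 j + (s *: delta_mx 0 i + p)) -
   partial i f (s *: delta_mx 0 i + p) = h * 'D_(delta_mx 0 j) (partial i f) (r *: delta_mx 0 j + (s *: delta_mx 0 i + p)).
  have fiC : Ck 1 U (partial i f) := Ck_partial i fC.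
  apply: (@mvt_dir R _ (partial i f) (s *: delta_mx 0 i + p) (delta_mx 0 j) h).
    move=> r rh; have H := @Ck_derivable 0 U (partial i f) j (r *: delta_mx 0 j + (s *: delta_mx 0 i + p)) fiC.
    apply: H.
  by rewrite addrCA addrA; apply: dU; exact: sd.
exists (s *: delta_mx 0 i + r *: delta_mx 0 j); first exact: sd.
move: E1; rewrite (@derive_val _ _ _ _ _ _ _ (FD s sh)) E2 /F mulrA => E1.
rewrite [h *: delta_mx 0 i + (_ + _)]addrCA.
rewrite [s *: _ + _]addrC -[_ + _ + p]addrA.
by apply: etrans E1; rewrite opprB [RHS]addrA [RHS]addrAC.
Qed.

(** The common value may be taken at two different points, as happens when mean value theorems in
    the two orders of differentiation are compared. *)
Lemma continuous_eq_near f g p :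
  {for p, continuous f} -> {for p, continuous g} ->
  (forall d : R, 0 < d -> exists q q' : 'rV[R]_n,
     [/\ `|q| < d, `|q'| < d & f (q + p) = g (q' + p)]) ->
  f p = g p.
Proof.
move=> fc gc fg; apply/eqP; rewrite -subr_eq0 -normr_le0.
apply/ler_addgt0Pl => e e0; rewrite addr0.
have e2 : 0 < e / 2 by rewrite divr_gt0.
have : \forall q \near p, `|f p - f q| <= e / 2 /\ `|g p - g q| <= e / 2.
  by apply: filterI; [move/cvgrPdist_le : fc|move/cvgrPdist_le : gc]; exact.
move=> /nbhs_ballP[d /= d0 dP].
have dQ (h : 'rV[R]_n) : `|h| < d ->
    `|f p - f (h + p)| <= e / 2 /\ `|g p - g (h + p)| <= e / 2.
  move=> hd; apply: dP; rewrite -ball_normE /ball_/=.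
  by rewrite opprD addrCA subrr addr0 normrN.
have [q [q' [qd qd' E]]] := fg _ d0.
have [+ _] := dQ _ qd; have [_] := dQ _ qd'; rewrite E.
move=> A B; apply: le_trans (ler_distD (g (q' + p)) _ _) _.
by rewrite (splitr e) lerD// distrC.
Qed.

(** The second difference is symmetric in [i] and [j], so both mixed derivatives take the same value
    at points arbitrarily close to [p]. *)
Lemma Schwarz U f p i j : open U -> Ck 2 U f -> U p ->
  partial i (partial j f) p = partial j (partial i f) p.
Proof.
move=> oU fC Up; apply: continuous_eq_near.
- exact: Ck_continuous (Ck_partial i (Ck_partial j fC)) Up.
- exact: Ck_continuous (Ck_partial j (Ck_partial i fC)) Up.
move=> d d0.
have /nbhs_ballP[r /= r0 rP] : nbhs p U by exact: open_nbhs_nbhs.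
pose d' := Num.min d r.
have d'0 : 0 < d' by rewrite lt_min d0.
have dU (q : 'rV[R]_n) : `|q| < d' -> U (q + p).
  move=> qd; apply: rP; rewrite -ball_normE /ball_/=.
  rewrite opprD addrCA subrr addr0 normrN (lt_le_trans qd)//.
  by rewrite ge_min lexx orbT.
have h0 : 0 < d' / 4 by rewrite divr_gt0.
have hd : d' / 4 + d' / 4 < d' by move: (d') d'0 => ? ?; lra.
have [q qd E] := second_difference j i h0 hd dU fC.
have [q' qd' E'] := second_difference i j h0 hd dU fC.
exists q, q'; split.
- by rewrite (lt_le_trans qd)// ge_min lexx.
- by rewrite (lt_le_trans qd')// ge_min lexx.
apply: (@mulfI _ (d' / 4 * (d' / 4))); first by rewrite mulf_neq0// gt_eqF.
apply: etrans (esym E) _; apply: etrans E'.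
by rewrite [X in f X]addrCA; congr (_ + _); exact: addrAC.
Qed.

End Ck.

(** * Averages over the sphere *)

Section PositiveFunctional.
Context {R : realType} {Y : topologicalType}.

(** Common abstraction of the integral over a segment and of the spherical mean, so that continuity
    in a parameter and differentiation under the integral sign are proved once. The laws concern
    continuous integrands, and inequalities are tested on [K] only, so [L] sees only values on
    [K]. *)
Definition positive_functional (K : set Y) (L : (Y -> R) -> R) : Prop :=
  [/\ compact K,
      forall (a : R) f g, continuous f -> continuous g ->
        L (fun y => a * f y + g y) = a * L f + L g &
      forall f g, continuous f -> continuous g ->
        (forall y, K y -> f y <= g y) -> L f <= L g].

Variables (K : set Y) (L : (Y -> R) -> R).
Hypothesis Lpos : positive_functional K L.
Implicit Types f g : Y -> R.

Let one_continuous : continuous (fun _ : Y => 1 : R).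
Proof. by move=> y; exact: cst_continuous. Qed.

Lemma pos_fun_lin (a : R) f g : continuous f -> continuous g ->
  L (fun y => a * f y + g y) = a * L f + L g.
Proof. by case: Lpos => _ + _; apply. Qed.

Lemma pos_fun_le f g : continuous f -> continuous g ->
  (forall y, K y -> f y <= g y) -> L f <= L g.
Proof. by case: Lpos => _ _; apply. Qed.

Lemma pos_fun0 : L (fun=> 0) = 0.
Proof.
have c0 : continuous (fun _ : Y => 0 : R) by move=> y; exact: cst_continuous.
have := pos_fun_lin 1 c0 c0; under eq_fun do rewrite mulr0 addr0.
by rewrite mul1r => /eqP; rewrite -subr_eq0 opprD addNKr oppr_eq0 => /eqP.
Qed.

Lemma pos_funZ (a : R) f : continuous f -> L (fun y => a * f y) = a * L f.
Proof.
move=> fc.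
have c0 : continuous (fun _ : Y => 0 : R) by move=> y; exact: cst_continuous.
have := pos_fun_lin a fc c0; under eq_fun do rewrite addr0.
by rewrite pos_fun0 addr0.
Qed.

Lemma pos_funD f g : continuous f -> continuous g ->
  L (fun y => f y + g y) = L f + L g.
Proof.
move=> fc gc; have := pos_fun_lin 1 fc gc.
by under eq_fun do rewrite mul1r; rewrite mul1r.
Qed.

Lemma pos_funB f g : continuous f -> continuous g ->
  L (fun y => f y - g y) = L f - L g.
Proof.
move=> fc gc; have := pos_fun_lin (- 1) gc fc.
under eq_fun do rewrite mulN1r addrC.
by rewrite mulN1r addrC.
Qed.

Lemma pos_fun_cst (c : R) : L (fun=> c) = c * L (fun=> 1).
Proof. by rewrite -pos_funZ//; congr L; apply/funext => y; rewrite mulr1. Qed.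

Lemma pos_fun1_ge0 : 0 <= L (fun=> 1).
Proof.
rewrite -pos_fun0; apply: pos_fun_le => // y; exact: cst_continuous.
Qed.

Lemma pos_fun_norm f g : continuous f -> continuous g ->
  (forall y, K y -> `|f y| <= g y) -> `|L f| <= L g.
Proof.
move=> fc gc fg.
have gNc : continuous (fun y => -1 * g y).
  by apply: contT => y; apply: cont_mul; [exact: cont_cst|exact: gc].
rewrite ler_norml -mulN1r -pos_funZ// !pos_fun_le// => y /fg.
  by rewrite ler_norml => /andP[].
by rewrite mulN1r ler_norml => /andP[].
Qed.

(** A tube lemma: compactness of [K] makes the neighbourhood of [t] independent of [y]. *)
Lemma near_uniform (T : topologicalType) (F : T -> Y -> R) (t : T) (e : R) :
  (forall y, K y -> {for (t, y), continuous (fun z : T * Y => F z.1 z.2)}) ->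
  0 < e -> \forall s \near t, forall y, K y -> `|F t y - F s y| <= e.
Proof.
move=> Fc e0.
have Kc : compact K by case: Lpos.
have e2 : 0 < e / 2 by rewrite divr_gt0.
have := (compact_near_coveringP K).1 Kc T (nbhs t)
  (fun s y => `|F t y - F s y| <= e) _; apply => y Ky.
have /cvgrPdist_le/(_ _ e2) := Fc y Ky.
move=> [[/= A B] [At By] AB].
exists (B, A) => //= -[y' s] /= [By' As].
have H1 := AB (s, y') (conj As By').
have H2 := AB (t, y') (conj (nbhs_singleton At) By').
rewrite /= in H1 H2.
apply: le_trans (ler_distD (F t y) _ _) _.
by rewrite (splitr e) lerD// distrC.
Qed.

Lemma pos_fun_continuous (T : topologicalType) (F : T -> Y -> R) (t : T) :
  (\forall s \near t, continuous (F s)) ->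
  (forall y, K y -> {for (t, y), continuous (fun z : T * Y => F z.1 z.2)}) ->
  {for t, continuous (fun s => L (F s))}.
Proof.
move=> Fc Fcc; apply/cvgrPdist_le => e e0.
have m0 := pos_fun1_ge0.
(* The total mass [L 1] may be 0, hence the shift by 1 before dividing. *)
have m1 : 0 < L (fun=> 1) + 1 by rewrite ltr_wpDl.
have e1 : 0 < e / (L (fun=> 1) + 1) by rewrite divr_gt0.
have Ftc := nbhs_singleton Fc.
apply: filterS2 Fc (near_uniform Fcc e1) => s Fsc H.
rewrite -pos_funB//.
have cc : continuous (fun _ : Y => e / (L (fun=> 1) + 1)).
  by move=> y; exact: cst_continuous.
apply: le_trans (pos_fun_norm _ cc H) _.
  by apply: contT => y; apply: cont_sub; [exact: Ftc|exact: Fsc].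
rewrite pos_fun_cst mulrAC ler_pdivrMr// ler_wpM2l// ?ltW//.
by rewrite ltrDl.
Qed.

Lemma cvg_is_derive (V : normedModType R) (f : V -> R) (p v : V) (l : R) :
  (fun h : R => h^-1 *: (f (h *: v + p) - f p)) @ 0^' --> l -> is_derive p v f l.
Proof. by move=> fl; split; [exact: cvgP fl|exact: cvg_lim fl]. Qed.

(** For each [y] the mean value theorem turns the difference quotient into [F'] at a parameter that
    depends on [y] but lies within [|h|] of [s]; closeness of [F'] uniform in [y] then lets the
    limit pass through [L]. *)
Lemma pos_fun_is_derive (F F' : R -> Y -> R) (s : R) :
  (\forall r \near s, continuous (F r)) ->
  (\forall r \near s, forall y, K y -> is_derive (r : R) 1 (F^~ y) (F' r y)) ->
  continuous (F' s) ->
  (forall y, K y -> {for (s, y), continuous (fun z : R * Y => F' z.1 z.2)}) ->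
  is_derive s 1 (fun r => L (F r)) (L (F' s)).
Proof.
move=> Fc Fd F'c F'cc; apply: cvg_is_derive; apply/cvgrPdist_le => e e0.
have m0 := pos_fun1_ge0.
have m1 : 0 < L (fun=> 1) + 1 by rewrite ltr_wpDl.
have e1 : 0 < e / (L (fun=> 1) + 1) by rewrite divr_gt0.
have Fsc := nbhs_singleton Fc.
have : \forall r \near s, [/\ continuous (F r), (forall y, K y -> is_derive (r : R) 1 (F^~ y) (F' r y)) &
   forall y, K y -> `|F' s y - F' r y| <= e / (L (fun=> 1) + 1)].
  by apply: filterS3 Fc Fd (near_uniform F'cc e1) => r.
move=> /nbhs_ballP[d /= d0 dP].
have {}dP (h : R) : `|h| < d -> [/\ continuous (F (h *: 1 + s)),
     (forall y, K y -> is_derive (h *: 1 + s) 1 (F^~ y) (F' (h *: 1 + s) y)) &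
   forall y, K y -> `|F' s y - F' (h *: 1 + s) y| <= e / (L (fun=> 1) + 1)].
  move=> hd; apply: dP; rewrite -ball_normE /ball_/=.
  by rewrite opprD addrCA subrr addr0 normrN [_ *: _]mulr1.
near=> h.
have h0 : h != 0 by near: h; exact: nbhs_dnbhs_neq.
have hd : `|h| < d by near: h; apply: dnbhs0_lt.
have [Fhc _ _] := dP _ hd.
have Fec : continuous (fun y => -h^-1 * (F (h *: 1 + s) y - F s y)).
  apply: contT => y; apply: cont_mul; first exact: cont_cst.
  by apply: cont_sub; [exact: Fhc|exact: Fsc].
have -> : L (F' s) - h^-1 *: (L (F (h *: 1 + s)) - L (F s)) =
    L (fun y => -h^-1 * (F (h *: 1 + s) y - F s y) + F' s y).
  rewrite pos_funD// pos_funZ ?pos_funB//; first by rewrite mulNr addrC.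
  by apply: contT => y; apply: cont_sub; [exact: Fhc|exact: Fsc].
have cc : continuous (fun _ : Y => e / (L (fun=> 1) + 1)).
  by move=> y; exact: cst_continuous.
apply: le_trans (pos_fun_norm (g := fun=> e / (L (fun=> 1) + 1)) _ cc _) _.
- by apply: contT => y; apply: cont_add; [exact: Fec|exact: F'c].
- move=> y Ky.
  have [r rh E] : exists2 r : R, `|r| <= `|h| & F (h *: 1 + s) y - F s y = h * F' (r *: 1 + s) y.
    have := @mvt_dir R R (F^~ y) s 1 h.
    case.
      by move=> r rh; have [_ /(_ _ Ky)[]] := dP _ (le_lt_trans rh hd).
    move=> r rh ->; exists r => //; congr (_ * _).
    by have [_ /(_ _ Ky)[_ ->]] := dP _ (le_lt_trans rh hd).
  rewrite E mulNr mulKf// addrC.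
  by have [_ _] := dP _ (le_lt_trans rh hd); exact.
rewrite pos_fun_cst mulrAC ler_pdivrMr// ler_wpM2l// ?ltW//.
by rewrite ltrDl.
Unshelve. all: by end_near. Qed.

End PositiveFunctional.

Section Interval.
Context {R : realType}.
Variables (a b : R).
Hypothesis ab : a < b.

Definition seg_int (f : R -> R) : R := \int[lebesgue_measure]_(x in `[a, b]) f x.

Lemma continuous_seg_integrable (f : R -> R) : continuous f ->
  (@lebesgue_measure R).-integrable `[a, b] (EFin \o f).
Proof.
move=> fc; apply: continuous_compact_integrable; first exact: segment_compact.
exact: continuous_subspaceT.
Qed.

Lemma seg_int_positive : positive_functional `[a, b] seg_int.
Proof.
split; first exact: segment_compact.
- move=> c f g fc gc; rewrite /seg_int RintegralD//; last 2 first.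
  + apply: continuous_seg_integrable; apply: contT => x; apply: cont_mul; last exact: fc.
    exact: cont_cst.
  + exact: continuous_seg_integrable.
  by rewrite RintegralZl//; exact: continuous_seg_integrable.
- move=> f g fc gc fg; apply: le_Rintegral => //;
  exact: continuous_seg_integrable.
Qed.

Lemma seg_int_FTC (f F : R -> R) : continuous f ->
  (forall x : R, is_derive x 1 F (f x)) -> seg_int f = F b - F a.
Proof.
move=> fc Fd.
have Fc x : {for x, continuous F}.
  by apply: differentiable_continuous; apply/derivable1_diffP; exact: ex_derive.
rewrite /seg_int /Rintegral (@continuous_FTC2 _ f F)//.
- exact: continuous_subspaceT.
- split=> [x _|  |].
  + exact: ex_derive.
  + by apply: cvg_at_right_filter; exact: Fc.
  + by apply: cvg_at_left_filter; exact: Fc.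
- by move=> x _; rewrite derive1E; exact: derive_val.
Qed.

End Interval.

Section SphericalAverage.
Context {R : realType}.
Local Notation pi := (@pi R).

Lemma pairl_continuous (S T : topologicalType) (a : S) :
  continuous (fun b : T => (a, b)).
Proof. by move=> b; apply: cvg_pair; [exact: cvg_cst|exact: cvg_id]. Qed.

Lemma cont_pair_eta (S T : topologicalType) (F : S * T -> R) (z : S * T) :
  {for z, continuous F} -> {for z, continuous (fun z => F (z.1, z.2))}.
Proof.
by move=> Fc; have <- : F = (fun z => F (z.1, z.2)) by apply/funext => -[].
Qed.

Lemma sin_ge0_0pi (x : R) : x \in `[0, pi] -> 0 <= sin x.
Proof.
by rewrite in_itv/=; exact: sin_ge0_pi.
Qed.

(* F is a function of the colatitude and the longitude. *)
Definition sph_avg (F : R * R -> R) : R :=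
  (4 * pi)^-1 *
  seg_int 0 pi (fun a => sin a * seg_int 0 (2 * pi) (fun b => F (a, b))).

Let pi2_gt0 : 0 < 2 * pi. Proof. by rewrite mulr_gt0// pi_gt0. Qed.

Let circle := @seg_int_positive R 0 (2 * pi).
Let meridian := @seg_int_positive R 0 pi.

Lemma circle_int_continuous (F : R * R -> R) : continuous F ->
  continuous (fun a => seg_int 0 (2 * pi) (fun b => F (a, b))).
Proof.
move=> Fc a; apply: (pos_fun_continuous circle (F := fun a b => F (a, b))).
  by apply: (@filterE _ (nbhs a)) => s b; apply: continuous_comp (Fc _); exact: pairl_continuous.
by move=> b _; apply: cont_pair_eta; exact: Fc.
Qed.

Lemma sin_circle_int_continuous (F : R * R -> R) : continuous F ->
  continuous (fun a => sin a * seg_int 0 (2 * pi) (fun b => F (a, b))).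
Proof.
move=> Fc; apply: contT => a; apply: cont_mul; first exact: continuous_sin.
exact: circle_int_continuous.
Qed.

Let slice_continuous (F : R * R -> R) (a : R) : continuous F ->
  continuous (fun b => F (a, b)).
Proof.
by move=> Fc b; apply: continuous_comp (Fc _); exact: pairl_continuous.
Qed.

Lemma sph_avg_positive : positive_functional (`[0, pi] `*` `[0, 2 * pi]) sph_avg.
Proof.
have pi4 : 0 <= (4 * pi)^-1 by rewrite invr_ge0 mulr_ge0// pi_ge0.
split; first by apply: compact_setX; exact: segment_compact.
- move=> c f g fc gc; rewrite /sph_avg mulrCA -mulrDr; congr (_ * _).
  rewrite -(pos_fun_lin meridian); try exact: sin_circle_int_continuous.
  congr seg_int; apply/funext => a.
  rewrite (pos_fun_lin circle c (slice_continuous (a := a) fc) (slice_continuous (a := a) gc)).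
  by rewrite mulrDr mulrCA.
- move=> f g fc gc fg; rewrite /sph_avg ler_wpM2l//.
  apply: (pos_fun_le meridian); try exact: sin_circle_int_continuous.
  move=> a /= aK; rewrite ler_wpM2l ?sin_ge0_0pi//.
  apply: (pos_fun_le circle); try exact: slice_continuous.
  by move=> b bK; apply: fg.
Qed.

Lemma sph_avg1 : sph_avg (fun=> 1) = 1.
Proof.
rewrite /sph_avg.
have -> : seg_int 0 (2 * pi) (fun=> 1) = 2 * pi.
  have H (x : R) : is_derive x 1 id (1 : R) by exact: is_derive_id.
  rewrite (seg_int_FTC pi2_gt0 _ H) ?subr0//.
  by move=> x; exact: cst_continuous.
have -> : (fun a => sin a * (2 * pi)) = (fun a => 2 * pi * sin a).
  by apply/funext => a; rewrite mulrC.
rewrite (pos_funZ meridian); last exact: continuous_sin.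
have H (x : R) : is_derive x 1 (fun x => - cos x) (sin x).
  by rewrite -[sin x]opprK; apply: is_deriveN.
rewrite (seg_int_FTC (@pi_gt0 R) (@continuous_sin R) H).
rewrite cospi cos0 !opprK; have := @pi_gt0 R; move: (pi) => q q0.
by rewrite -[in RHS](mulVf (x := 4 * q)) ?mulf_neq0 ?gt_eqF//; congr (_ * _); ring.
Qed.

(** The divergence theorem on the sphere in coordinates. The longitude integral of [B'] vanishes by
    periodicity; the longitude integral of [A'] is the colatitude derivative of that of [A], so its
    own integral is a difference of values at the poles, where [A] vanishes. *)
Lemma sph_avg_divergence (F A A' B B' : R * R -> R) :
  continuous F -> continuous A -> continuous A' -> continuous B' ->
  (forall a b : R, is_derive a 1 (fun a => A (a, b)) (A' (a, b))) ->
  (forall a b : R, is_derive b 1 (fun b => B (a, b)) (B' (a, b))) ->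
  (forall a b, sin a * F (a, b) = A' (a, b) + B' (a, b)) ->
  (forall b, A (0, b) = 0) -> (forall b, A (pi, b) = 0) ->
  (forall a, B (a, 0) = B (a, 2 * pi)) ->
  sph_avg F = 0.
Proof.
move=> Fc Ac A'c B'c Ad Bd FE A0 Api Bper; rewrite /sph_avg.
have -> : (fun a => sin a * seg_int 0 (2 * pi) (fun b => F (a, b))) =
    (fun a => seg_int 0 (2 * pi) (fun b => A' (a, b))).
  apply/funext => a; rewrite -(pos_funZ circle); last exact: slice_continuous.
  under eq_fun do rewrite FE.
  rewrite (pos_funD circle); try exact: slice_continuous.
  rewrite [X in _ + X](seg_int_FTC pi2_gt0 _ (Bd a)); last exact: slice_continuous.
  by rewrite Bper subrr addr0.
have H (a : R) : is_derive a 1 (fun a => seg_int 0 (2 * pi) (fun b => A (a, b)))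
    (seg_int 0 (2 * pi) (fun b => A' (a, b))).
  apply: (pos_fun_is_derive circle (F := fun a b => A (a, b))
    (F' := fun a b => A' (a, b))).
  - by apply: (@filterE _ (nbhs a)) => r; exact: slice_continuous.
  - by apply: (@filterE _ (nbhs a)) => r b _; exact: Ad.
  - exact: slice_continuous.
  - by move=> b _; apply: cont_pair_eta; exact: A'c.
rewrite (seg_int_FTC (@pi_gt0 R) _ H); last exact: circle_int_continuous.
under eq_fun do rewrite Api.
by under [X in _ - seg_int _ _ X]eq_fun do rewrite A0; rewrite subrr mulr0.
Qed.

End SphericalAverage.
Local Opaque partial.

Section Derivatives1.
Context {R : realType}.
Implicit Types (f g : R -> R) (x a b c : R).

Lemma der_cst c x : is_derive x 1 (fun=> c) 0.
Proof. exact: is_derive_cst. Qed.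

Lemma der_id x : is_derive x 1 (fun t : R => t) 1.
Proof. exact: is_derive_id. Qed.

Lemma der_add f g x a b : is_derive x 1 f a -> is_derive x 1 g b ->
  is_derive x 1 (fun t => f t + g t) (a + b).
Proof. by move=> fa gb; exact: is_deriveD. Qed.

Lemma der_opp f x a : is_derive x 1 f a -> is_derive x 1 (fun t => - f t) (- a).
Proof. by move=> fa; exact: is_deriveN. Qed.

Lemma der_mul f g x a b : is_derive x 1 f a -> is_derive x 1 g b ->
  is_derive x 1 (fun t => f t * g t) (a * g x + f x * b).
Proof.
by move=> fa gb; rewrite addrC mulrC [a * _]mulrC -[b * _]mulrC; exact: is_deriveM.
Qed.

Lemma der_comp f g x a b : is_derive (g x) 1 f a -> is_derive x 1 g b ->
  is_derive x 1 (fun t => f (g t)) (a * b).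
Proof. by move=> fa gb; exact: is_derive1_comp. Qed.

Lemma der_sin f x a : is_derive x 1 f a ->
  is_derive x 1 (fun t => sin (f t)) (cos (f x) * a).
Proof. by move=> fa; apply: der_comp => //; exact: is_derive_sin. Qed.

Lemma der_cos f x a : is_derive x 1 f a ->
  is_derive x 1 (fun t => cos (f t)) (- sin (f x) * a).
Proof. by move=> fa; apply: der_comp => //; exact: is_derive_cos. Qed.

Lemma der_eq f x b : (exists2 a, is_derive x 1 f a & a = b) -> is_derive x 1 f b.
Proof. by move=> [a fa <-]. Qed.

Lemma der_continuous f x a : is_derive x 1 f a -> {for x, continuous f}.
Proof.
by move=> fa; apply: differentiable_continuous; apply/derivable1_diffP; exact: ex_derive.
Qed.

Lemma der_near_cst f c x y : (forall r : R, c < r -> is_derive r 1 f 0) ->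
  c < x -> x <= y -> f y = f x.
Proof.
move=> fd cx xy; apply/eqP; rewrite -subr_eq0; apply/eqP.
have fd' r : x <= r -> is_derive r 1 f 0 by move=> xr; apply: fd; exact: lt_le_trans xr.
have [r|r|r rxy ->] := @MVT_segment R f (fun=> 0) x y xy; last by rewrite mul0r.
- by rewrite in_itv/= => /andP[/ltW xr _]; exact: fd'.
- apply: derivable_within_continuous => s; rewrite in_itv/= => /andP[xs _].
  by have [] := fd' _ xs.
Qed.

End Derivatives1.

Ltac der_step :=
  lazymatch goal with
  | |- is_derive _ _ (fun _ => ?c) _ => notypeclasses refine (der_cst _ _)
  | |- is_derive _ _ (fun x => x) _ => notypeclasses refine (der_id _)
  | |- is_derive _ _ (fun x => @?a x + @?b x) _ => notypeclasses refine (der_add _ _)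
  | |- is_derive _ _ (fun x => - @?a x) _ => notypeclasses refine (der_opp _)
  | |- is_derive _ _ (fun x => @?a x * @?b x) _ => notypeclasses refine (der_mul _ _)
  | |- is_derive _ _ (+%R ?c) _ => notypeclasses refine (der_add (der_cst c _) (der_id _))
  | |- is_derive _ _ (@GRing.mul _ ?c) _ => notypeclasses refine (der_mul (der_cst c _) (der_id _))
  | |- is_derive _ _ (@sin _) _ => exact: is_derive_sin
  | |- is_derive _ _ (@cos _) _ => exact: is_derive_cos
  | |- is_derive _ _ (fun x => sin (@?a x)) _ => notypeclasses refine (der_sin _)
  | |- is_derive _ _ (fun x => cos (@?a x)) _ => notypeclasses refine (der_cos _)
  end.

(* [apply:] would solve the premises by type class inference, hence
   [notypeclasses refine]. *)
Ltac der := notypeclasses refine (der_eq (ex_intro2 _ _ _ _ _)); [repeat der_step|lazy beta].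

Section ContinuousOps2.
Context {R : realType} {T : topologicalType}.

Lemma cont_comp (U V : topologicalType) (g : U -> V) (f : T -> U) (t : T) :
  {for t, continuous f} -> {for f t, continuous g} ->
  {for t, continuous (fun x => g (f x))}.
Proof. by move=> fc gc; exact: continuous_comp fc gc. Qed.

Lemma eq_cont (U : topologicalType) (f g : T -> U) (t : T) :
  (forall x, f x = g x) -> {for t, continuous f} -> {for t, continuous g}.
Proof. by move=> /funext ->. Qed.

Lemma cont_id (t : T) : {for t, continuous (fun x : T => x)}.
Proof. exact: cvg_id. Qed.

Lemma cont_fst (U V : topologicalType) (f : T -> U * V) (t : T) :
  {for t, continuous f} -> {for t, continuous (fun x => (f x).1)}.
Proof. by move=> fc; apply: cont_comp fc _; exact: cvg_fst. Qed.

Lemma cont_snd (U V : topologicalType) (f : T -> U * V) (t : T) :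
  {for t, continuous f} -> {for t, continuous (fun x => (f x).2)}.
Proof. by move=> fc; apply: cont_comp fc _; exact: cvg_snd. Qed.

Lemma cont_sin (f : T -> R) (t : T) :
  {for t, continuous f} -> {for t, continuous (fun x => sin (f x))}.
Proof. by move=> fc; apply: cont_comp fc _; exact: continuous_sin. Qed.

Lemma cont_cos (f : T -> R) (t : T) :
  {for t, continuous f} -> {for t, continuous (fun x => cos (f x))}.
Proof. by move=> fc; apply: cont_comp fc _; exact: continuous_cos. Qed.

End ContinuousOps2.

(** * Kirchhoff's formula *)

Section Spacetime.
Context {R : realType}.

Definition ix1 : 'I_(1 + 3) := @Ordinal (1 + 3) 1 isT.
Definition ix2 : 'I_(1 + 3) := @Ordinal (1 + 3) 2 isT.
Definition ix3 : 'I_(1 + 3) := @Ordinal (1 + 3) 3 isT.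

Lemma sum4 (F : 'I_(1 + 3) -> R) :
  \sum_(a < 1 + 3) F a = F ord0 + F ix1 + F ix2 + F ix3.
Proof.
rewrite !big_ord_recl big_ord0 addr0 !addrA.
by congr (_ + F _ + F _ + F _); exact/val_inj.
Qed.

Lemma forall4 (P : 'I_(1 + 3) -> Prop) :
  P ord0 -> P ix1 -> P ix2 -> P ix3 -> forall a, P a.
Proof.
move=> p0 p1 p2 p3 [[|[|[|[|//]]]] i].
- by have -> : Ordinal i = ord0 by exact/val_inj.
- by have -> : Ordinal i = ix1 by exact/val_inj.
- by have -> : Ordinal i = ix2 by exact/val_inj.
- by have -> : Ordinal i = ix3 by exact/val_inj.
Qed.

Definition ev (t x y z : R) : 'rV[R]_(1 + 3) := \row_i [:: t; x; y; z]`_i.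

Lemma ev0 t x y z : ev t x y z 0 ord0 = t. Proof. by rewrite mxE. Qed.
Lemma ev1 t x y z : ev t x y z 0 ix1 = x. Proof. by rewrite mxE. Qed.
Lemma ev2 t x y z : ev t x y z 0 ix2 = y. Proof. by rewrite mxE. Qed.
Lemma ev3 t x y z : ev t x y z 0 ix3 = z. Proof. by rewrite mxE. Qed.
Definition evE := (ev0, ev1, ev2, ev3).

Lemma ev_eta (p : 'rV[R]_(1 + 3)) : p = ev (p 0 ord0) (p 0 ix1) (p 0 ix2) (p 0 ix3).
Proof. by apply/rowP; apply: forall4; rewrite evE. Qed.

Lemma cont_ev (T : topologicalType) (t x y z : T -> R) (s : T) :
  {for s, continuous t} -> {for s, continuous x} -> {for s, continuous y} ->
  {for s, continuous z} -> {for s, continuous (fun s => ev (t s) (x s) (y s) (z s))}.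
Proof.
move=> tc xc yc zc; apply: continuous_row; apply: forall4.
- by apply: eq_cont tc => r; rewrite ev0.
- by apply: eq_cont xc => r; rewrite ev1.
- by apply: eq_cont yc => r; rewrite ev2.
- by apply: eq_cont zc => r; rewrite ev3.
Qed.

Lemma ev_chain (U : set 'rV[R]_(1 + 3)) f (t x y z : R -> R) (t' x' y' z' s : R) :
  open U -> Ck 1 U f -> U (ev (t s) (x s) (y s) (z s)) ->
  is_derive s 1 t t' -> is_derive s 1 x x' -> is_derive s 1 y y' ->
  is_derive s 1 z z' ->
  is_derive s 1 (fun s => f (ev (t s) (x s) (y s) (z s)))
    (t' * partial ord0 f (ev (t s) (x s) (y s) (z s))
     + x' * partial ix1 f (ev (t s) (x s) (y s) (z s))
     + y' * partial ix2 f (ev (t s) (x s) (y s) (z s))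
     + z' * partial ix3 f (ev (t s) (x s) (y s) (z s))).
Proof.
move=> oU fC Us td xd yd zd.
have := @C1_chain R _ U f (fun s => ev (t s) (x s) (y s) (z s))
  (fun a => ev t' x' y' z' 0 a) s oU fC Us.
rewrite sum4 !evE; apply; apply: forall4; rewrite evE.
- by under eq_fun do rewrite ev0.
- by under eq_fun do rewrite ev1.
- by under eq_fun do rewrite ev2.
- by under eq_fun do rewrite ev3.
Qed.

Lemma sum_metric (F : 'I_(1 + 3) -> R) :
  \sum_(a < 1 + 3) metric_sign a * F a = - F ord0 + F ix1 + F ix2 + F ix3.
Proof. by rewrite sum4 /metric_sign eqxx/= !mul1r mulN1r. Qed.

Lemma boxE f (p : 'rV[R]_(1 + 3)) : box f p =
  - partial ord0 (partial ord0 f) p + partial ix1 (partial ix1 f) p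
  + partial ix2 (partial ix2 f) p + partial ix3 (partial ix3 f) p.
Proof.  exact: sum_metric. Qed.

End Spacetime.

Ltac cont_step :=
  lazymatch goal with
  | |- @prop_for _ _ (fun y => @continuous_at _ _ y ?F) _ =>
    lazymatch F with
    | (fun _ => ?c) => apply: cont_cst
    | (fun x => x) => apply: cont_id
    | (fun x => @?a x + @?b x) => apply: cont_add
    | (fun x => - @?a x) => apply: cont_opp
    | (fun x => @?a x * @?b x) => apply: cont_mul
    | @sin _ => exact: continuous_sin
    | @cos _ => exact: continuous_cos
    | (fun x => sin (@?a x)) => apply: cont_sin
    | (fun x => cos (@?a x)) => apply: cont_cos
    | (fun x => ev (@?a x) (@?b x) (@?c x) (@?d x)) => apply: cont_ev
    | @fst _ _ => exact: cvg_fst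
    | @snd _ _ => exact: cvg_snd
    | (fun x => (@?a x).1) => apply: cont_fst
    | (fun x => (@?a x).2) => apply: cont_snd
    end
  end.

Section SphericalMeans.
Context {R : realType}.
Local Notation pi := (@pi R).

Definition om1 (w : R * R) : R := sin w.1 * cos w.2.
Definition om2 (w : R * R) : R := sin w.1 * sin w.2.
Definition om3 (w : R * R) : R := cos w.1.

Lemma om_norm w : om1 w ^+ 2 + om2 w ^+ 2 + om3 w ^+ 2 = 1.
Proof.
rewrite /om1 /om2 /om3; move: (cos2Dsin2 w.1) (cos2Dsin2 w.2).
move: (sin w.1) (cos w.1) (sin w.2) (cos w.2) => sa ca sb cb A B.
have {}A : ca ^+ 2 = 1 - sa ^+ 2 by lra.
have {}B : cb ^+ 2 = 1 - sb ^+ 2 by lra.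
ring: A B.
Qed.

Definition sph_pt (x y z T r : R) (w : R * R) : 'rV[R]_(1 + 3) :=
  ev T (x + r * om1 w) (y + r * om2 w) (z + r * om3 w).

Lemma cont_sph_pt (S : topologicalType) (x y z : R) (T r : S -> R) (w : S -> R * R) (s : S) :
  {for s, continuous T} -> {for s, continuous r} -> {for s, continuous w} ->
  {for s, continuous (fun s => sph_pt x y z (T s) (r s) (w s))}.
Proof. move=> Tc rc wc; rewrite /sph_pt /om1 /om2 /om3.
repeat cont_step.
by [].
all: by []. Qed.

Lemma sph_pt_colat (x y z T r b : R) (U : set 'rV[R]_(1 + 3)) f (a0 : R) :
  open U -> Ck 1 U f -> U (sph_pt x y z T r (a0, b)) ->
  is_derive a0 1 (fun a => f (sph_pt x y z T r (a, b)))
   (r * (cos a0 * cos b * partial ix1 f (sph_pt x y z T r (a0, b))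
    + cos a0 * sin b * partial ix2 f (sph_pt x y z T r (a0, b))
    - sin a0 * partial ix3 f (sph_pt x y z T r (a0, b)))).
Proof.
move=> oU fC Up.
have H (c : R) g g' : is_derive a0 1 g g' -> is_derive a0 1 (fun a => c + r * g a) (r * g').
  move=> gd; der; first exact: gd.
  by rewrite mul0r !add0r.
have Hc (g : R -> R) g' k : is_derive a0 1 g g' -> is_derive a0 1 (fun a => g a * k) (g' * k).
  move=> gd; der; first exact: gd.
  by rewrite mulr0 addr0.
have := @ev_chain _ U f (fun _ => T) (fun a => x + r * om1 (a, b))
  (fun a => y + r * om2 (a, b)) (fun a => z + r * om3 (a, b)) 0
  (r * (cos a0 * cos b)) (r * (cos a0 * sin b)) (r * (- sin a0)) a0 oU fC Up
  (der_cst _ _) (H x _ _ (Hc sin _ (cos b) (is_derive_sin _)))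
  (H y _ _ (Hc sin _ (sin b) (is_derive_sin _))) (H z _ _ (is_derive_cos _)).
congr (is_derive _ _ _ _); rewrite -/(sph_pt x y z T r (a0, b)).
move: (partial ord0 _ _) (partial ix1 _ _) (partial ix2 _ _) (partial ix3 _ _) => ? ? ? ?.
ring.
Qed.

Lemma sph_pt_long (x y z T r a : R) (U : set 'rV[R]_(1 + 3)) f (b0 : R) :
  open U -> Ck 1 U f -> U (sph_pt x y z T r (a, b0)) ->
  is_derive b0 1 (fun b => f (sph_pt x y z T r (a, b)))
   (r * sin a * (- sin b0 * partial ix1 f (sph_pt x y z T r (a, b0))
    + cos b0 * partial ix2 f (sph_pt x y z T r (a, b0)))).
Proof.
move=> oU fC Up.
have H (c k : R) g g' : is_derive b0 1 g g' -> is_derive b0 1 (fun b => c + r * (k * g b)) (r * (k * g')).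
  move=> gd; der; first exact: gd.
  by rewrite !mul0r !add0r.
have := @ev_chain _ U f (fun _ => T) (fun b => x + r * om1 (a, b))
  (fun b => y + r * om2 (a, b)) (fun b => z + r * om3 (a, b)) 0
  (r * (sin a * - sin b0)) (r * (sin a * cos b0)) 0 b0 oU fC Up
  (der_cst _ _) (H x (sin a) cos _ (is_derive_cos _))
  (H y (sin a) sin _ (is_derive_sin _)) (der_cst (z + r * cos a) _).
congr (is_derive _ _ _ _); rewrite -/(sph_pt x y z T r (a, b0)).
move: (partial ord0 _ _) (partial ix1 _ _) (partial ix2 _ _) (partial ix3 _ _) => ? ? ? ?.
ring.
Qed.

(** Divergence form of the spherical Laplacian: the left-hand side is [sin a * sph_lap], and the
    right-hand side differentiates [sin a] times the colatitude component of the gradient in [a] and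
    its longitude component in [b]. The [fi] and [fij] stand for partial derivatives of [f]. *)
Lemma om_algebra (sa ca sb cb r f1 f2 f3 f11 f12 f13 f21 f22 f23 f31 f32 f33 : R) :
  ca ^+ 2 + sa ^+ 2 = 1 -> cb ^+ 2 + sb ^+ 2 = 1 ->
  sa * (r * (f11 + f22 + f33
      - (sa * cb * (sa * cb * f11 + sa * sb * f21 + ca * f31)
         + sa * sb * (sa * cb * f12 + sa * sb * f22 + ca * f32)
         + ca * (sa * cb * f13 + sa * sb * f23 + ca * f33)))
    - (2 * (sa * cb * f1 + sa * sb * f2 + ca * f3))) =
  (ca * (ca * cb * f1 + ca * sb * f2 - sa * f3)
   + sa * (- sa * cb * f1 - sa * sb * f2 - ca * f3
     + ca * cb * (r * (ca * cb * f11 + ca * sb * f21 - sa * f31))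
     + ca * sb * (r * (ca * cb * f12 + ca * sb * f22 - sa * f32))
     - sa * (r * (ca * cb * f13 + ca * sb * f23 - sa * f33))))
  + (- cb * f1 - sb * f2
     - sb * (r * sa * (- sb * f11 + cb * f21))
     + cb * (r * sa * (- sb * f12 + cb * f22))).
Proof.
move=> A B.
have {}A : ca ^+ 2 = 1 - sa ^+ 2 by lra.
have {}B : cb ^+ 2 = 1 - sb ^+ 2 by lra.
ring: A B.
Qed.

Lemma cont_field (S : topologicalType) (U : set 'rV[R]_(1 + 3)) f k (P : S -> 'rV[R]_(1 + 3)) (s : S) :
  Ck k U f -> U (P s) -> {for s, continuous P} ->
  {for s, continuous (fun s => f (P s))}.
Proof. by move=> fC Us Pc; apply: cont_comp Pc _; exact: Ck_continuous fC Us. Qed.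

Definition radial1 f (p : 'rV[R]_(1 + 3)) (w : R * R) : R :=
  om1 w * partial ix1 f p + om2 w * partial ix2 f p + om3 w * partial ix3 f p.

Definition radial2 f (p : 'rV[R]_(1 + 3)) (w : R * R) : R :=
  om1 w * radial1 (partial ix1 f) p w + om2 w * radial1 (partial ix2 f) p w
  + om3 w * radial1 (partial ix3 f) p w.

Definition laplacian f (p : 'rV[R]_(1 + 3)) : R :=
  partial ix1 (partial ix1 f) p + partial ix2 (partial ix2 f) p
  + partial ix3 (partial ix3 f) p.

(* r times the Laplacian of the sphere of radius r, written without dividing by
   r so that the vertex r = 0 of a cone is allowed. *)
Definition sph_lap f (r : R) (p : 'rV[R]_(1 + 3)) (w : R * R) : R :=
  r * (laplacian f p - radial2 f p w) - 2 * radial1 f p w.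

Lemma cont_om1 (S : topologicalType) (w : S -> R * R) s :
  {for s, continuous w} -> {for s, continuous (fun s => om1 (w s))}.
Proof. by move=> wc; rewrite /om1; repeat cont_step. Qed.

Lemma cont_om2 (S : topologicalType) (w : S -> R * R) s :
  {for s, continuous w} -> {for s, continuous (fun s => om2 (w s))}.
Proof. by move=> wc; rewrite /om2; repeat cont_step. Qed.

Lemma cont_om3 (S : topologicalType) (w : S -> R * R) s :
  {for s, continuous w} -> {for s, continuous (fun s => om3 (w s))}.
Proof. by move=> wc; rewrite /om3; repeat cont_step. Qed.

Lemma cont_radial1 (S : topologicalType) (U : set 'rV[R]_(1 + 3)) f P (w : S -> R * R) s :
  Ck 1 U f -> U (P s) -> {for s, continuous P} -> {for s, continuous w} ->
  {for s, continuous (fun s => radial1 f (P s) (w s))}.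
Proof.
move=> fC Us Pc wc; rewrite /radial1.
have H j := cont_field (Ck_partial j fC) Us Pc.
repeat cont_step; try exact: H.
- exact: cont_om1.
- exact: cont_om2.
- exact: cont_om3.
Qed.

Lemma cont_sph_lap (S : topologicalType) (U : set 'rV[R]_(1 + 3)) f (r : S -> R) P (w : S -> R * R) s :
  Ck 2 U f -> U (P s) -> {for s, continuous r} -> {for s, continuous P} ->
  {for s, continuous w} -> {for s, continuous (fun s => sph_lap f (r s) (P s) (w s))}.
Proof.
move=> fC Us rc Pc wc; rewrite /sph_lap /laplacian /radial2.
have H i j := cont_field (Ck_partial i (Ck_partial j fC)) Us Pc.
have H1 := cont_radial1 (CkW fC) Us Pc wc.
have H2 j := cont_radial1 (Ck_partial j fC) Us Pc wc.
have o1 := cont_om1 wc; have o2 := cont_om2 wc; have o3 := cont_om3 wc.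
by repeat cont_step; [by []|exact: H|exact: H|exact: H|exact: o1|exact: H2
  |exact: o2|exact: H2|exact: o3|exact: H2|exact: H1].
Qed.

(** The Laplacian of a closed surface is a divergence. Below, [B] is the gradient component along
    parallels and [A] the one along meridians times [sin w.1]; this factor makes the coordinate
    singularity at the poles harmless. *)
Lemma sph_avg_lap (U : set 'rV[R]_(1 + 3)) f (x y z T r : R) :
  open U -> Ck 2 U f -> (forall w, U (sph_pt x y z T r w)) ->
  sph_avg (fun w => sph_lap f r (sph_pt x y z T r w) w) = 0.
Proof.
move=> oU fC Us; have fC1 := CkW fC.
have Pc w : {for w, continuous (fun w => sph_pt x y z T r w)}.
  by apply: cont_sph_pt; [exact: cont_cst|exact: cont_cst|exact: cont_id].
pose P w := sph_pt x y z T r w.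
pose D i w := partial i f (P w).
pose DD i j w := partial i (partial j f) (P w).
have c1 j w : {for w, continuous (D j)} :=
  cont_field (Ck_partial j fC) (Us w) (Pc w).
have c2 i j w : {for w, continuous (DD i j)} :=
  cont_field (Ck_partial i (Ck_partial j fC)) (Us w) (Pc w).
pose Da j w := r * (cos w.1 * cos w.2 * DD ix1 j w + cos w.1 * sin w.2 * DD ix2 j w - sin w.1 * DD ix3 j w).
pose Db j w := r * sin w.1 * (- sin w.2 * DD ix1 j w + cos w.2 * DD ix2 j w).
have cDa j w : {for w, continuous (Da j)}.
  by rewrite /Da; repeat cont_step; exact: c2.
have cDb j w : {for w, continuous (Db j)}.
  by rewrite /Db; repeat cont_step; exact: c2.
pose A w := sin w.1 * (cos w.1 * cos w.2 * D ix1 w + cos w.1 * sin w.2 * D ix2 w - sin w.1 * D ix3 w).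
pose A' w := cos w.1 * (cos w.1 * cos w.2 * D ix1 w + cos w.1 * sin w.2 * D ix2 w - sin w.1 * D ix3 w)
  + sin w.1 * (- sin w.1 * cos w.2 * D ix1 w - sin w.1 * sin w.2 * D ix2 w - cos w.1 * D ix3 w
    + cos w.1 * cos w.2 * Da ix1 w + cos w.1 * sin w.2 * Da ix2 w - sin w.1 * Da ix3 w).
pose B w := - sin w.2 * D ix1 w + cos w.2 * D ix2 w.
pose B' w := - cos w.2 * D ix1 w - sin w.2 * D ix2 w - sin w.2 * Db ix1 w + cos w.2 * Db ix2 w.
apply: (@sph_avg_divergence R _ A A' B B').
- by apply: contT => w; apply: (cont_sph_lap fC (Us w)); [exact: cont_cst|exact: Pc|exact: cont_id].
- by apply: contT => w; rewrite /A; repeat cont_step; exact: c1.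
- by apply: contT => w; rewrite /A'; repeat cont_step; first [exact: c1|exact: cDa].
- by apply: contT => w; rewrite /B'; repeat cont_step; first [exact: c1|exact: cDb].
- move=> a b.
  have dD j : is_derive a 1 (fun a => D j (a, b)) (Da j (a, b)).
    exact: sph_pt_colat oU (Ck_partial j fC) (Us _).
  have dD1 := dD ix1; have dD2 := dD ix2; have dD3 := dD ix3.
  rewrite /A' /A /=; move: dD1 dD2 dD3.
  move: (Da ix1 _) (Da ix2 _) (Da ix3 _) => d1 d2 d3 dD1 dD2 dD3.
  der; [exact: dD1|exact: dD2|exact: dD3|].
  move: (D ix1 _) (D ix2 _) (D ix3 _) => e1 e2 e3; ring.
- move=> a b.
  have dD j : is_derive b 1 (fun b => D j (a, b)) (Db j (a, b)).
    exact: sph_pt_long oU (Ck_partial j fC) (Us _).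
  have dD1 := dD ix1; have dD2 := dD ix2.
  rewrite /B' /B /=; move: dD1 dD2.
  move: (Db ix1 _) (Db ix2 _) => d1 d2 dD1 dD2.
  der; [exact: dD1|exact: dD2|].
  move: (D ix1 _) (D ix2 _) => e1 e2; ring.
- move=> a b; exact: om_algebra (cos2Dsin2 a) (cos2Dsin2 b).
- by move=> b; rewrite /A /= sin0 mul0r.
- by move=> b; rewrite /A /= sinpi mul0r.
- move=> a; have s2 : sin (2 * pi) = sin 0 :> R by rewrite mulr_natl sin2pi sin0.
  have c2' : cos (2 * pi) = cos 0 :> R by rewrite mulr_natl cos2pi cos0.
  have E : P (a, 2 * pi) = P (a, 0) by rewrite /P /sph_pt /om1 /om2 /om3 /= s2 c2'.
  by rewrite /B /D E /= s2 c2'.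
Qed.

Lemma sph_pt_radial (U : set 'rV[R]_(1 + 3)) f (x y z s T' r' : R) (T r : R -> R)
    (w : R * R) :
  open U -> Ck 1 U f -> U (sph_pt x y z (T s) (r s) w) ->
  is_derive s 1 T T' -> is_derive s 1 r r' ->
  is_derive s 1 (fun s => f (sph_pt x y z (T s) (r s) w))
   (T' * partial ord0 f (sph_pt x y z (T s) (r s) w)
    + r' * radial1 f (sph_pt x y z (T s) (r s) w) w).
Proof.
move=> oU fC Up Td rd.
have H (c k : R) : is_derive s 1 (fun s => c + r s * k) (r' * k).
  der; first exact: rd.
  by rewrite mulr0 addr0 add0r.
have := @ev_chain _ U f T (fun s => x + r s * om1 w) (fun s => y + r s * om2 w)
  (fun s => z + r s * om3 w) T' (r' * om1 w) (r' * om2 w) (r' * om3 w) s oU fC Up Td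
  (H _ _) (H _ _) (H _ _).
congr (is_derive _ _ _ _); rewrite /radial1 -/(sph_pt x y z (T s) (r s) w).
move: (partial _ _ _) (partial _ _ _) (partial _ _ _) (partial _ _ _) => *.
by rewrite !mulrDr !mulrA !addrA.
Qed.

(** Kirchhoff's solution formula at a vertex of time [T], for the data [f] and [partial ord0 f] on
    the sphere of radius [r] in the slice of time [T - r]. *)
Definition kirchhoff_integrand f (r : R) (p : 'rV[R]_(1 + 3)) (w : R * R) : R :=
  f p + r * (partial ord0 f p + radial1 f p w).

Lemma cont_kirchhoff (S : topologicalType) (U : set 'rV[R]_(1 + 3)) f (r : S -> R) P (w : S -> R * R) s :
  Ck 1 U f -> U (P s) -> {for s, continuous r} -> {for s, continuous P} ->
  {for s, continuous w} -> {for s, continuous (fun s => kirchhoff_integrand f (r s) (P s) (w s))}.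
Proof.
move=> fC Us rc Pc wc; rewrite /kirchhoff_integrand.
have H0 := cont_field fC Us Pc.
have H := cont_field (Ck_partial ord0 fC) Us Pc.
have H1 := cont_radial1 fC Us Pc wc.
by repeat cont_step; [exact: H0|exact: rc|exact: H|exact: H1].
Qed.

(** Along the backward cone one differentiates by [- d_t + d_om], and [(- d_t + d_om) (d_t + d_om) =
    d_om^2 - d_t^2] once mixed derivatives commute. The two first-order terms add up to [2 d_om],
    and the wave equation replaces [d_t^2] by the Laplacian. The left-hand side has the shape
    produced by the differentiation rules. *)
Lemma kirchhoff_algebra (r o1 o2 o3 v0 v1 v2 v3 v00 v01 v02 v03 v11 v12 v13 v21 v22 v23 v31 v32 v33 : R) :
  - v00 + v11 + v22 + v33 = 0 ->
  -1 * v0 + 1 * (o1 * v1 + o2 * v2 + o3 * v3)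
  + (1 * (v0 + (o1 * v1 + o2 * v2 + o3 * v3))
    + r * (-1 * v00 + 1 * (o1 * v01 + o2 * v02 + o3 * v03)
     + (0 * v1 + o1 * (-1 * v01 + 1 * (o1 * v11 + o2 * v21 + o3 * v31))
     + (0 * v2 + o2 * (-1 * v02 + 1 * (o1 * v12 + o2 * v22 + o3 * v32)))
     + (0 * v3 + o3 * (-1 * v03 + 1 * (o1 * v13 + o2 * v23 + o3 * v33))))))
  = -1 * (r * (v11 + v22 + v33 - (o1 * (o1 * v11 + o2 * v21 + o3 * v31)
       + o2 * (o1 * v12 + o2 * v22 + o3 * v32)
       + o3 * (o1 * v13 + o2 * v23 + o3 * v33))) - 2 * (o1 * v1 + o2 * v2 + o3 * v3)).
Proof.
move=> H; have -> : v00 = v11 + v22 + v33 by lra.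
ring.
Qed.

Lemma kirchhoff_derive (U : set 'rV[R]_(1 + 3)) f (x y z T r : R) (w : R * R) :
  open U -> Ck 2 U f -> (forall p, U p -> box f p = 0) ->
  U (sph_pt x y z (T - r) r w) ->
  is_derive r 1 (fun r => kirchhoff_integrand f r (sph_pt x y z (T - r) r w) w)
    (-1 * sph_lap f r (sph_pt x y z (T - r) r w) w).
Proof.
move=> oU fC fbox Us; have fC1 := CkW fC.
have Td : is_derive r 1 (fun r => T - r) (-1).
  by have := der_add (der_cst T r) (der_opp (der_id r)); rewrite add0r.
have D0 := sph_pt_radial (f := f) (T := fun r => T - r) (r := fun r => r) oU fC1 Us Td (der_id r).
have D1 j := sph_pt_radial (f := partial j f) (T := fun r => T - r) (r := fun r => r) oU (Ck_partial j fC) Us Td (der_id r).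
have := fbox _ Us; rewrite boxE.
rewrite /kirchhoff_integrand {1}/radial1.
have E j : partial ord0 (partial j f) (sph_pt x y z (T - r) r w) =
   partial j (partial ord0 f) (sph_pt x y z (T - r) r w).
  exact: Schwarz oU fC Us.
have D11 := D1 ix1; have D12 := D1 ix2; have D13 := D1 ix3.
move: D11; rewrite (E ix1) => D11; move: D12; rewrite (E ix2) => D12.
move: D13; rewrite (E ix3) => D13 bx.
der; [exact: D0|exact: (D1 ord0)|exact: D11|exact: D12|exact: D13|].
exact: (kirchhoff_algebra r (om1 w) (om2 w) (om3 w) _ _ _ _ _ _ _ _ _ _ _ _ _ bx).
Qed.

(* Along the backward cone the integrand has derivative [- sph_lap], whose mean
   value vanishes; at r = 0 it is the value of f at the vertex. *)
Lemma kirchhoff (U : set 'rV[R]_(1 + 3)) f (x y z T c : R) :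
  open U -> Ck 2 U f -> (forall p, U p -> box f p = 0) -> c < 0 ->
  (forall r w, c < r -> U (sph_pt x y z (T - r) r w)) ->
  forall r1, 0 <= r1 ->
  sph_avg (fun w => kirchhoff_integrand f r1 (sph_pt x y z (T - r1) r1 w) w)
    = f (ev T x y z).
Proof.
move=> oU fC fbox c0 Us r1 r10; have fC1 := CkW fC.
have Pc (z0 : R * (R * R)) : {for z0, continuous (fun z0 : R * (R * R) => sph_pt x y z (T - z0.1) z0.1 z0.2)}.
  by apply: cont_sph_pt; [repeat cont_step|exact: cvg_fst|exact: cvg_snd].
have Pc1 (r : R) w : {for w, continuous (fun w => sph_pt x y z (T - r) r w)}.
  by apply: cont_sph_pt; [exact: cont_cst|exact: cont_cst|exact: cont_id].
have near_c (s : R) : c < s -> \forall r \near s, c < r.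
  by move=> cs; apply: (open_nbhs_nbhs (A := [set r | c < r])); split => //; exact: open_gt.
have kd (s : R) : c < s -> is_derive s 1
    (fun r => sph_avg (fun w => kirchhoff_integrand f r (sph_pt x y z (T - r) r w) w)) 0.
  move=> cs.
  have cl (r : R) : c < r -> continuous (fun w => sph_lap f r (sph_pt x y z (T - r) r w) w).
    move=> cr; apply: contT => w; apply: (cont_sph_lap fC (Us _ _ cr));
      [exact: cont_cst|exact: Pc1|exact: cont_id].
  have := @pos_fun_is_derive R _ _ _ (@sph_avg_positive R)
    (fun r w => kirchhoff_integrand f r (sph_pt x y z (T - r) r w) w)
    (fun r w => -1 * sph_lap f r (sph_pt x y z (T - r) r w) w) s.
  rewrite (pos_funZ sph_avg_positive _ (cl _ cs)).
  rewrite (sph_avg_lap oU fC); last by move=> w; exact: Us.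
  rewrite mulr0; apply.
  - apply: filterS (near_c _ cs) => r cr; apply: contT => w.
    by apply: (cont_kirchhoff fC1 (Us _ _ cr)); [exact: cont_cst|exact: Pc1|exact: cont_id].
  - apply: filterS (near_c _ cs) => r cr w _.
    by apply: (kirchhoff_derive oU fC fbox); exact: Us.
  - by apply: contT => w; apply: cont_mul; [exact: cont_cst|exact: cl].
  - move=> w _; apply: cont_mul; first exact: cont_cst.
    apply: (cont_sph_lap (P := fun z0 : R * (R * R) => sph_pt x y z (T - z0.1) z0.1 z0.2) fC).
    + exact: Us.
    + exact: cvg_fst.
    + exact: Pc.
    + exact: cvg_snd.
(* Since [c < 0], two-sided derivatives exist down to the vertex [r = 0], so the mean at [r1] equals
   the mean at 0. *)
rewrite (der_near_cst kd c0 r10).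
have -> : (fun w => kirchhoff_integrand f 0 (sph_pt x y z (T - 0) 0 w) w) = (fun=> f (ev T x y z)).
  apply/funext => w; rewrite /kirchhoff_integrand mul0r addr0.
  by rewrite /sph_pt !mul0r !addr0 subr0.
by rewrite (pos_fun_cst sph_avg_positive) sph_avg1 mulr1.
Qed.

(** By the product rule the derivative is the mean of the Kirchhoff integrand at time [a + s] and
    radius [b + s]; the vertex of that cone has time [(a + s) + (b + s)]. Derivatives of [f] thereby
    disappear from the formula. *)
Lemma spherical_mean_derive (U : set 'rV[R]_(1 + 3)) f (x y z c Tm a b s : R) :
  open U -> Ck 2 U f -> (forall p, U p -> box f p = 0) -> c < 0 ->
  (forall T r w, T < Tm -> c < r -> U (sph_pt x y z (T - r) r w)) ->
  0 <= b + s -> (a + s) + (b + s) < Tm ->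
  is_derive s 1 (fun s => (b + s) * sph_avg (fun w => f (sph_pt x y z (a + s) (b + s) w)))
    (f (ev ((a + s) + (b + s)) x y z)).
Proof.
move=> oU fC fbox c0 Us bs0 sT; have fC1 := CkW fC.
have good (r : R) w : c < b + r -> (a + r) + (b + r) < Tm ->
    U (sph_pt x y z (a + r) (b + r) w).
  by move=> cr rT; have := Us _ _ w rT cr; rewrite addrK.
have nearg : \forall r \near s, c < b + r /\ (a + r) + (b + r) < Tm.
  apply: filterI.
    apply: (open_nbhs_nbhs (A := [set r | c < b + r])); split => /=; last by lra.
    rewrite (_ : [set r | _] = [set r | c - b < r]); first exact: open_gt.
    by apply/seteqP; split => r /=; lra.
  apply: (open_nbhs_nbhs (A := [set r | (a + r) + (b + r) < Tm])); split => //=.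
  rewrite (_ : [set r | _] = [set r | r < (Tm - a - b) / 2]); first exact: open_lt.
  by apply/seteqP; split => r /=; lra.
have [cs _] := nbhs_singleton nearg.
have gs w := good s w cs sT.
have Pc1 (r : R) w : {for w, continuous (fun w => sph_pt x y z (a + r) (b + r) w)}.
  by apply: cont_sph_pt; [exact: cont_cst|exact: cont_cst|exact: cont_id].
have Pc (z0 : R * (R * R)) : {for z0, continuous (fun z0 : R * (R * R) => sph_pt x y z (a + z0.1) (b + z0.1) z0.2)}.
  by apply: cont_sph_pt; [repeat cont_step|repeat cont_step|exact: cvg_snd].
have cf (r : R) : c < b + r -> (a + r) + (b + r) < Tm -> continuous (fun w => f (sph_pt x y z (a + r) (b + r) w)).
  by move=> cr rT; apply: contT => w; apply: (cont_field fC); [exact: good|exact: Pc1].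
have cd w : {for w, continuous (fun w =>
    partial ord0 f (sph_pt x y z (a + s) (b + s) w) + radial1 f (sph_pt x y z (a + s) (b + s) w) w)}.
  apply: cont_add; first by apply: (cont_field (Ck_partial ord0 fC)); [exact: gs|exact: Pc1].
  by apply: (cont_radial1 fC1); [exact: gs|exact: Pc1|exact: cont_id].
have D : is_derive s 1 (fun s => sph_avg (fun w => f (sph_pt x y z (a + s) (b + s) w)))
    (sph_avg (fun w => partial ord0 f (sph_pt x y z (a + s) (b + s) w) + radial1 f (sph_pt x y z (a + s) (b + s) w) w)).
  apply: (@pos_fun_is_derive R _ _ _ (@sph_avg_positive R)
    (fun s w => f (sph_pt x y z (a + s) (b + s) w))
    (fun s w => partial ord0 f (sph_pt x y z (a + s) (b + s) w) + radial1 f (sph_pt x y z (a + s) (b + s) w) w) s).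
  - by apply: filterS nearg => r [cr rT]; exact: cf.
  - apply: filterS nearg => r [cr rT] w _.
    have ad k : is_derive r 1 (fun r => k + r) 1.
      by have := der_add (der_cst k r) (der_id r); rewrite add0r.
    have := sph_pt_radial (f := f) (T := fun r => a + r) (r := fun r => b + r) oU fC1 (good r w cr rT) (ad a) (ad b).
    by rewrite !mul1r.
  - exact: contT.
  - move=> w _; apply: cont_add.
      apply: (cont_field (P := fun z0 : R * (R * R) => sph_pt x y z (a + z0.1) (b + z0.1) z0.2) (Ck_partial ord0 fC)); first exact: gs.
      exact: Pc.
    apply: (cont_radial1 (P := fun z0 : R * (R * R) => sph_pt x y z (a + z0.1) (b + z0.1) z0.2) fC1); first exact: gs.
      exact: Pc.
    exact: cvg_snd.
der; first exact: D.
rewrite add0r mul1r -(pos_funZ sph_avg_positive); last exact: contT.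
rewrite -(pos_funD sph_avg_positive); last 2 first.
- exact: cf.
- by apply: contT => w; apply: cont_mul; [exact: cont_cst|exact: cd].
have := kirchhoff (T := (a + s) + (b + s)) oU fC fbox c0 (fun r w => Us _ r w sT) bs0.
by rewrite addrK.
Qed.

(** The end values bound [|F|] by [|V| / 4], whereas closeness to [V] forces [|F| >= |V| / 2]; this
    is the origin of the constant 8. *)
Lemma mvt_contradiction (V F Nh N0 h : R) : 0 < h -> 0 < `|V| ->
  `|Nh| <= h * `|V| / 8 -> `|N0| <= h * `|V| / 8 -> Nh - N0 = F * (h - 0) ->
  `|V - F| <= `|V| / 2 -> False.
Proof.
move=> h0 V0 Nh8 N08; rewrite subr0 => E VF.
have H : `|F| * h <= h * `|V| / 8 + h * `|V| / 8.
  by rewrite -[X in _ * X <= _](gtr0_norm h0) -normrM -E (le_trans (ler_normB _ _))// lerD.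
have {}H : `|F| <= `|V| / 4 by rewrite -(ler_pM2r h0); clear -H; lra.
have := ler_distD F V 0; rewrite !subr0; clear -H V0 VF; lra.
Qed.

Lemma dist_along_cone (t b s h d : R) : 0 <= s -> s <= h -> 0 < h -> h <= d / 4 ->
  `|t - ((t - 2 * h - b) + s + (b + s))| < d.
Proof. by move=> s0 sh h0 hd; rewrite ger0_norm; lra. Qed.

(* The derivative of (b + s) times the spherical mean of f is the value of f at
   a vertex near (t0, x, y, z), while both end values of this function tend to 0
   as b tends to infinity. *)
Lemma decay_vanish (U : set 'rV[R]_(1 + 3)) f (x y z c Tm t0 : R) :
  open U -> Ck 2 U f -> (forall p, U p -> box f p = 0) -> c < 0 -> t0 < Tm ->
  (forall T r w, T < Tm -> c < r -> U (sph_pt x y z (T - r) r w)) ->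
  (forall e : R, 0 < e -> exists M : R, forall b T : R, M <= b -> t0 - 1 <= T -> T <= t0 ->
     `|b * sph_avg (fun w => f (sph_pt x y z (T - b) b w))| <= e) ->
  f (ev t0 x y z) = 0.
Proof.
move=> oU fC fbox c0 t0m Us decay; apply/eqP/negPn/negP => V0.
set V := f (ev t0 x y z) in V0.
have e0 : 0 < `|V| by rewrite normr_gt0.
have Ut0 : U (ev t0 x y z).
  have := Us t0 0 (0, 0) t0m c0.
  by rewrite /sph_pt !mul0r !addr0 subr0.
have fc : {for t0, continuous (fun t => f (ev t x y z))}.
  apply: (cont_field (P := fun t => ev t x y z) fC Ut0).
  by apply: cont_ev; [exact: cont_id|exact: cont_cst|exact: cont_cst|exact: cont_cst].
have e2 : 0 < `|V| / 2 by rewrite divr_gt0.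
have [d /= d0 dP] : exists2 d : R, 0 < d & forall t : R, `|t0 - t| < d -> `|V - f (ev t x y z)| <= `|V| / 2.
  move/cvgrPdist_le : fc => /(_ _ e2) /nbhs_ballP[d /= d0 dP]; by exists d.
(* With [a] chosen below, the vertex time [(a + s) + (b + s)] is [t0 - 2 h + 2 s] and runs from
   [t0 - 2 h] to [t0]. The bound [d / 4] keeps [f] close to [V] there, and [1 / 4] keeps these times
   above [t0 - 1], where the decay hypothesis applies. *)
pose h := Num.min (d / 4) (1 / 4).
have h0 : 0 < h by rewrite lt_min !divr_gt0.
have hd : h <= d / 4 by rewrite ge_min lexx.
have h1 : h <= 1 / 4 by rewrite ge_min lexx orbT.
have e8 : 0 < h * `|V| / 8 by rewrite divr_gt0// mulr_gt0.
have [M MP] := decay _ e8.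
pose b := Num.max M 0.
have Mb : M <= b by rewrite le_max lexx.
have b0 : 0 <= b by rewrite le_max lexx orbT.
pose a := t0 - 2 * h - b.
pose N (s : R) := (b + s) * sph_avg (fun w => f (sph_pt x y z (a + s) (b + s) w)).
have Nd (s : R) : 0 <= s -> s <= h -> is_derive s 1 N (f (ev ((a + s) + (b + s)) x y z)).
  move=> s0 sh; apply: (spherical_mean_derive oU fC fbox c0 Us).
    exact: addr_ge0.
  by rewrite /a; lra.
have Nh : `|N h| <= h * `|V| / 8.
  have := MP (b + h) t0; rewrite /N (_ : a + h = t0 - (b + h)); last by rewrite /a; lra.
  by apply; lra.
have N0 : `|N 0| <= h * `|V| / 8.
  have := MP (b + 0) (t0 - 2 * h); rewrite /N (_ : a + 0 = t0 - 2 * h - (b + 0)); last by rewrite /a; lra.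
  by apply; lra.
have [s|s|s] := @MVT_segment R N (fun s => f (ev ((a + s) + (b + s)) x y z)) 0 h (ltW h0).
- by rewrite in_itv/= => /andP[/ltW s0 /ltW sh]; exact: Nd.
- apply: derivable_within_continuous => r; rewrite in_itv/= => /andP[r0 rh].
  by have [] := Nd _ r0 rh.
rewrite in_itv/= => /andP[s0 sh] E.
apply: (mvt_contradiction h0 e0 Nh N0 E).
by apply: dP; exact: dist_along_cone.
Qed.

End SphericalMeans.

(** * Superpositions of plane waves *)

Section PlaneWaves.
Context {R : realType} {n : nat}.

(** Lets the derivatives be exhibited in closed form [g i], which need agree with [partial i f] on
    [U] only. *)
Lemma Ck_S (k : nat) (U : set 'rV[R]_n) (f : 'rV[R]_n -> R) (g : 'I_n -> 'rV[R]_n -> R) :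
  open U -> (forall p, U p -> {for p, continuous f}) ->
  (forall i p, U p -> is_derive p (delta_mx 0 i) f (g i p)) ->
  (forall i, Ck k U (g i)) -> Ck k.+1 U f.
Proof.
move=> oU fc fd gC; split=> // i; split; first by move=> p /(fd i)[].
apply: eq_Ck (gC i) => // p /(fd i)[_ <-]; exact: erefl.
Qed.

Lemma lin_form_delta (c : 'I_n -> R) i : lin_form c (delta_mx 0 i) = c i.
Proof.
rewrite /lin_form (bigD1 i)//= big1 ?addr0 ?mxE ?eqxx ?mul1r// => j ji.
by rewrite mxE (negPf ji) mul0r.
Qed.

Lemma plane_is_derive (c : 'I_n -> R) (g : R -> R) (g' : R) p i :
  is_derive (lin_form c p) 1 g g' ->
  is_derive p (delta_mx 0 i) (fun p => g (lin_form c p)) (c i * g').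
Proof.
move=> gd; apply/is_derive_dirP.
have -> : (fun h : R => g (lin_form c (h *: delta_mx 0 i + p))) =
    (fun h => g (h * c i + lin_form c p)).
  by apply/funext => h; rewrite linearP/= lin_form_delta.
rewrite mulrC; apply: der_comp; first by rewrite mul0r add0r; exact: gd.
have := der_add (der_mul (der_id (0 : R)) (der_cst (c i) 0)) (der_cst (lin_form c p) 0).
by rewrite mul1r mulr0 !addr0.
Qed.

Lemma plane_continuous (c : 'I_n -> R) (g : R -> R) p :
  {for lin_form c p, continuous g} -> {for p, continuous (fun p => g (lin_form c p))}.
Proof. by move=> gc; apply: cont_comp _ gc; exact: lin_form_continuous. Qed.

Lemma plane_Ck2 (c : 'I_n -> R) (g g1 g2 : R -> R) :
  (forall s : R, is_derive s 1 g (g1 s)) -> (forall s : R, is_derive s 1 g1 (g2 s)) ->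
  continuous g2 -> Ck 2 setT (fun p => g (lin_form c p)).
Proof.
move=> gd g1d g2c.
apply: (@Ck_S 1 _ _ (fun i p => c i * g1 (lin_form c p))).
- exact: openT.
- by move=> p _; apply: plane_continuous; exact: der_continuous (gd _).
- by move=> i p _; exact: plane_is_derive.
move=> i; apply: (@Ck_S 0 _ _ (fun j p => c i * (c j * g2 (lin_form c p)))).
- exact: openT.
- move=> p _; apply: cont_mul; first exact: cont_cst.
  by apply: plane_continuous; exact: der_continuous (g1d _).
- move=> j p _; apply/is_derive_dirP.
  have /is_derive_dirP H := plane_is_derive (c := c) (p := p) j (g1d _).
  by have := der_mul (der_cst (c i) 0) H; rewrite mul0r add0r.
- move=> j; split=> // p _; do 2 (apply: cont_mul; first exact: cont_cst).
  by apply: plane_continuous; exact: g2c.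
Qed.

End PlaneWaves.

(** * Plane waves on space-time and the hat-box theorem *)

Section Poisson.
Context {R : realType}.

Definition plane_vec (n1 n2 n3 : R) : 'I_(1 + 3) -> R := fun a => ev 1 n1 n2 n3 0 a.

Lemma plane_phase n1 n2 n3 (t x y z : R) :
  lin_form (plane_vec n1 n2 n3) (ev t x y z) = t + x * n1 + y * n2 + z * n3.
Proof. by rewrite /lin_form sum4 /plane_vec !evE mulr1. Qed.

Lemma plane_box n1 n2 n3 (g g1 g2 : R -> R) p :
  n1 ^+ 2 + n2 ^+ 2 + n3 ^+ 2 = 1 ->
  (forall s : R, is_derive s 1 g (g1 s)) -> (forall s : R, is_derive s 1 g1 (g2 s)) ->
  box (fun p => g (lin_form (plane_vec n1 n2 n3) p)) p = 0.
Proof.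
move=> n123 gd g1d; set c := plane_vec n1 n2 n3.
have d2 a : partial a (partial a (fun p => g (lin_form c p))) p =
    c a * (c a * g2 (lin_form c p)).
  have E : partial a (fun p => g (lin_form c p)) = fun p => c a * g1 (lin_form c p).
    apply/funext => q; have H := plane_is_derive (c := c) (p := q) a (gd _).
    exact: (@derive_val _ _ _ _ _ _ _ H).
  rewrite E.
  have /is_derive_dirP H := plane_is_derive (c := c) (p := p) a (g1d _).
  have H2 : is_derive p (delta_mx 0 a) (fun p => c a * g1 (lin_form c p))
      (c a * (c a * g2 (lin_form c p))).
    have H3 := der_mul (der_cst (c a) (0 : R)) H; rewrite mul0r add0r in H3.
    by apply/is_derive_dirP; exact: H3.
  exact: (@derive_val _ _ _ _ _ _ _ H2).
rewrite boxE !d2 /c /plane_vec !evE; move: (g2 _) => k.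
rewrite (_ : 1 * _ = (n1 ^+ 2 + n2 ^+ 2 + n3 ^+ 2) * k); last by rewrite n123; ring.
ring.
Qed.

(** Kirchhoff's identity for the plane wave [X1(t + n . x)] replaces a rotation of [n] to the pole.
    For the sphere of radius [s] about the origin at time [-1 + s], the derivative of [N] is the
    value [X1(-1 + 2 s)] at the vertex; at [s = 1] the time is 0 and the phase is exactly [n . om].
    Integration over [[0, 1]] gives half the increment of [X]. *)
Lemma sph_avg_plane (X X1 X2 X3 : R -> R) (n1 n2 n3 : R) :
  n1 ^+ 2 + n2 ^+ 2 + n3 ^+ 2 = 1 ->
  (forall s : R, is_derive s 1 X (X1 s)) -> (forall s : R, is_derive s 1 X1 (X2 s)) ->
  (forall s : R, is_derive s 1 X2 (X3 s)) -> continuous X3 ->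
  sph_avg (fun w => X1 (om1 w * n1 + om2 w * n2 + om3 w * n3)) = (X 1 - X (-1)) / 2.
Proof.
move=> n123 Xd X1d X2d X3c; set c := plane_vec n1 n2 n3.
have fC := plane_Ck2 c X1d X2d X3c.
have fbox (p : 'rV[R]_(1 + 3)) : setT p -> _ := fun _ => plane_box p n123 X1d X2d.
pose N (s : R) := (0 + s) * sph_avg (fun w => X1 (lin_form c (sph_pt 0 0 0 (-1 + s) (0 + s) w))).
have Nd (s : R) : 0 <= s -> is_derive s 1 N (X1 (-1 + 2 * s)).
  move=> s0.
  have := @spherical_mean_derive R setT (fun p => X1 (lin_form c p)) 0 0 0 (-1)
    ((-1 + s) + (0 + s) + 1) (-1) 0 s openT fC fbox _ _ _ _.
  have E : -1 + 2 * s = -1 + s + (0 + s) by ring.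
  by rewrite E plane_phase !mul0r !addr0; apply; rewrite // ?add0r// ltrDl.
pose D (s : R) := N s - X (-1 + 2 * s) / 2.
have Dd (s : R) : 0 <= s -> is_derive s 1 D 0.
  move=> s0; have Ns := Nd s s0.
  have ld : is_derive s 1 (fun s => -1 + 2 * s) 2.
    have := der_add (der_cst (-1) s) (der_mul (der_cst 2 s) (der_id s)).
    by rewrite mul0r !add0r mulr1.
  have Xl := der_comp (f := X) (Xd _) ld.
  rewrite /D; der; [exact: Ns|exact: Xl|].
  by rewrite mulr0 addr0 mulfK// subrr.
have [s|s|s _ ] := @MVT_segment R D (fun=> 0) 0 1 ler01.
- by rewrite in_itv/= => /andP[/ltW s0 _]; exact: Dd.
- apply: derivable_within_continuous => r; rewrite in_itv/= => /andP[r0 _].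
  by have [] := Dd _ r0.
rewrite mul0r /D /N add0r mul1r addr0 mul0r sub0r opprK mulr0 addr0 mulr1 addNr.
rewrite (_ : -1 + 2 = 1); last by lra.
have -> : (fun w => X1 (lin_form c (sph_pt 0 0 0 0 1 w))) =
    (fun w => X1 (om1 w * n1 + om2 w * n2 + om3 w * n3)).
  by apply/funext => w; rewrite plane_phase !mul1r !add0r.
move: (sph_avg _) (X 1) (X (-1)) => u v w; clear; lra.
Qed.

End Poisson.

(** * Space-time points as pairs of time and position *)

Section Events.
Context {R : realType}.

Definition j0 : 'I_3 := @Ordinal 3 0 isT.
Definition j1 : 'I_3 := @Ordinal 3 1 isT.
Definition j2 : 'I_3 := @Ordinal 3 2 isT.

Lemma forall3 (P : 'I_3 -> Prop) : P j0 -> P j1 -> P j2 -> forall i, P i.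
Proof.
move=> p0 p1 p2 [[|[|[|//]]] i].
- by have -> : Ordinal i = j0 by exact/val_inj.
- by have -> : Ordinal i = j1 by exact/val_inj.
- by have -> : Ordinal i = j2 by exact/val_inj.
Qed.

Lemma sum3 (F : 'I_3 -> R) : \sum_(i < 3) F i = F j0 + F j1 + F j2.
Proof.
rewrite !big_ord_recl big_ord0 addr0 !addrA.
by congr (F _ + F _ + F _); exact/val_inj.
Qed.

Lemma event_ev (t : R) (x : 'rV[R]_3) : event t x = ev t (x 0 j0) (x 0 j1) (x 0 j2).
Proof.
rewrite /event; apply/rowP; apply: forall4; rewrite evE.
- have -> : ord0 = lshift 3 ord0 :> 'I_(1 + 3) by exact/val_inj.
  by rewrite row_mxEl mxE eqxx.
- have -> : ix1 = rshift 1 j0 by exact/val_inj.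
  by rewrite row_mxEr.
- have -> : ix2 = rshift 1 j1 by exact/val_inj.
  by rewrite row_mxEr.
- have -> : ix3 = rshift 1 j2 by exact/val_inj.
  by rewrite row_mxEr.
Qed.

Lemma tcoord_event (t : R) x : tcoord (event t x) = t.
Proof. by rewrite event_ev /tcoord ev0. Qed.

Lemma xcoord_event (t : R) x : xcoord (event t x) = x.
Proof. exact: row_mxKr. Qed.

Lemma xcoord_j (p : 'rV[R]_(1 + 3)) :
  [/\ xcoord p 0 j0 = p 0 ix1, xcoord p 0 j1 = p 0 ix2 & xcoord p 0 j2 = p 0 ix3].
Proof. by split; rewrite mxE; congr (p 0 _); exact/val_inj. Qed.

Lemma event_eta (p : 'rV[R]_(1 + 3)) : event (tcoord p) (xcoord p) = p.
Proof. by have [a b c] := xcoord_j p; rewrite event_ev a b c -ev_eta. Qed.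

Lemma euclidean_normE (x : 'rV[R]_3) :
  euclidean_norm x = Num.sqrt (x 0 j0 ^+ 2 + x 0 j1 ^+ 2 + x 0 j2 ^+ 2).
Proof. by rewrite /euclidean_norm sum3. Qed.

Lemma sum_sqr_ge0 (x : 'rV[R]_3) : 0 <= x 0 j0 ^+ 2 + x 0 j1 ^+ 2 + x 0 j2 ^+ 2.
Proof. by rewrite !addr_ge0 ?sqr_ge0. Qed.

Lemma euclidean_norm_ge0 (x : 'rV[R]_3) : 0 <= euclidean_norm x.
Proof. exact: sqrtr_ge0. Qed.

Lemma euclidean_norm_sqr (x : 'rV[R]_3) :
  euclidean_norm x ^+ 2 = x 0 j0 ^+ 2 + x 0 j1 ^+ 2 + x 0 j2 ^+ 2.
Proof. by rewrite euclidean_normE sqr_sqrtr// sum_sqr_ge0. Qed.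

Lemma sphere2P (x : 'rV[R]_3) :
  sphere2 x <-> x 0 j0 ^+ 2 + x 0 j1 ^+ 2 + x 0 j2 ^+ 2 = 1.
Proof.
split; first by move=> x1; rewrite -euclidean_norm_sqr x1 expr1n.
by move=> x1; rewrite /sphere2/= euclidean_normE x1 sqrtr1.
Qed.

Definition omv (w : R * R) : 'rV[R]_3 := \row_i [:: om1 w; om2 w; om3 w]`_i.

Lemma omvE w : [/\ omv w 0 j0 = om1 w, omv w 0 j1 = om2 w & omv w 0 j2 = om3 w].
Proof. by split; rewrite mxE. Qed.

Lemma omv_sphere w : sphere2 (omv w).
Proof. by apply/sphere2P; have [-> -> ->] := omvE w; exact: om_norm. Qed.

Lemma sph_pt_event (t r : R) (x : 'rV[R]_3) w :
  sph_pt (x 0 j0) (x 0 j1) (x 0 j2) t r w = event t (x + r *: omv w).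
Proof.
rewrite event_ev /sph_pt; have [a b c] := omvE w.
by rewrite !mxE -a -b -c !mxE.
Qed.

Lemma tcoord_continuous : continuous (@tcoord R).
Proof. by move=> p; exact: coord_continuous. Qed.

Lemma xcoord_continuous : continuous (@xcoord R).
Proof.
move=> p; apply: continuous_row; apply: forall3.
- by apply: (eq_cont (f := fun p : 'rV[R]_(1 + 3) => p 0 ix1)) => [q|]; [have [->] := xcoord_j q|exact: coord_continuous].
- by apply: (eq_cont (f := fun p : 'rV[R]_(1 + 3) => p 0 ix2)) => [q|]; [have [_ ->] := xcoord_j q|exact: coord_continuous].
- by apply: (eq_cont (f := fun p : 'rV[R]_(1 + 3) => p 0 ix3)) => [q|]; [have [_ _ ->] := xcoord_j q|exact: coord_continuous].
Qed.

Lemma event_continuous (T : topologicalType) (t : T -> R) (x : T -> 'rV[R]_3) s :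
  {for s, continuous t} -> {for s, continuous x} ->
  {for s, continuous (fun s => event (t s) (x s))}.
Proof.
move=> tc xc; apply: (eq_cont (f := fun s => ev (t s) (x s 0 j0) (x s 0 j1) (x s 0 j2))).
  by move=> r; rewrite event_ev.
have xj j : {for s, continuous (fun s => x s 0 j)}.
  by apply: (cont_comp (g := fun y : 'rV[R]_3 => y 0 j) xc); exact: coord_continuous.
exact: cont_ev.
Qed.

Lemma omv_continuous : continuous omv.
Proof.
move=> w; apply: continuous_row; apply: forall3.
- by apply: (eq_cont (f := om1)) => [q|]; [have [->] := omvE q|rewrite /om1; repeat cont_step].
- by apply: (eq_cont (f := om2)) => [q|]; [have [_ ->] := omvE q|rewrite /om2; repeat cont_step].
- by apply: (eq_cont (f := om3)) => [q|]; [have [_ _ ->] := omvE q|rewrite /om3; repeat cont_step].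
Qed.

End Events.

(** * Smooth data on the product of the line and the sphere *)

Section Data.
Context {R : realType}.
Implicit Types (f : R -> 'rV[R]_3 -> R).

(** Smooth functions on all of [R x S^2] that vanish near every point whose first coordinate lies
    outside [(0, 1)]. The first variable is unrestricted because the phase of a plane wave takes all
    real values, and the class is closed under [sderiv]. *)
Definition smooth_datum f : Prop :=
  (forall (s : R) (w : 'rV[R]_3), sphere2 w ->
    exists U : set 'rV[R]_(1 + 3), exists F : 'rV[R]_(1 + 3) -> R,
    [/\ open U, U (event s w), (forall k, Ck k U F) &
        forall s' w', sphere2 w' -> U (event s' w') -> f s' w' = F (event s' w')]) /\
  (forall (s : R) (w : 'rV[R]_3), sphere2 w -> ~ (0 < s < 1) ->
    exists U : set 'rV[R]_(1 + 3),
    [/\ open U, U (event s w) &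
        forall s' w', sphere2 w' -> U (event s' w') -> f s' w' = 0]).

Lemma Ck_cst (n k : nat) (c : R) (U : set 'rV[R]_n) : open U -> Ck k U (fun=> c).
Proof.
move=> oU; elim: k c => [|k IH] c; first by split=> // p _; exact: cont_cst.
apply: (@Ck_S _ _ k U _ (fun _ _ => 0)) => //.
- by move=> p _; exact: cont_cst.
Qed.

Lemma event_is_derive (U : set 'rV[R]_(1 + 3)) F (s : R) (w : 'rV[R]_3) :
  open U -> Ck 1 U F -> U (event s w) ->
  is_derive s 1 (fun s => F (event s w)) (partial ord0 F (event s w)).
Proof.
move=> oU FC Us.
have -> : (fun s => F (event s w)) = (fun s => F (ev s (w 0 j0) (w 0 j1) (w 0 j2))).
  by apply/funext => r; rewrite event_ev.
rewrite event_ev in Us *.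
have := ev_chain (t := fun s => s) (x := fun=> w 0 j0) (y := fun=> w 0 j1) (z := fun=> w 0 j2)
  oU FC Us (der_id s) (der_cst _ s) (der_cst _ s) (der_cst _ s).
by rewrite !mul0r !addr0 mul1r.
Qed.

Definition sderiv f : R -> 'rV[R]_3 -> R := fun s w => derive1 (f^~ w) s.

Lemma event_near (U : set 'rV[R]_(1 + 3)) s w : open U -> U (event s w) ->
  \forall s' \near s, U (event s' w).
Proof.
move=> oU Us; have c : {for s, continuous (fun s => event s w)}.
  by apply: event_continuous; [exact: cont_id|exact: cst_continuous].
by apply: c; exact: open_nbhs_nbhs.
Qed.

Lemma smooth_datum_local (U : set 'rV[R]_(1 + 3)) F f s w : sphere2 w ->
  open U -> U (event s w) -> Ck 1 U F ->
  (forall s' w', sphere2 w' -> U (event s' w') -> f s' w' = F (event s' w')) ->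
  is_derive s 1 (f^~ w) (partial ord0 F (event s w)).
Proof.
move=> sw oU Us FC fF.
apply: near_eq_is_derive (event_is_derive oU FC Us).
apply: filterS (event_near oU Us) => s' Us'.
by rewrite fF.
Qed.

Lemma smooth_datum_derive f (s : R) w : smooth_datum f -> sphere2 w ->
  is_derive s 1 (f^~ w) (sderiv f s w).
Proof.
move=> [fs _] sw; have [U [F [oU Us FC fF]]] := fs s w sw.
have H := smooth_datum_local sw oU Us (FC 1%N) fF.
by rewrite /sderiv derive1E; apply: derivableP; case: H.
Qed.

(** Moving [s] alone stays on [R x S^2], so the [s]-derivative of [f] is that of any local extension
    [F], and [partial ord0 F] extends it smoothly. *)
Lemma smooth_datum_sderiv f : smooth_datum f -> smooth_datum (sderiv f).
Proof.
move=> [fs fz]; split.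
  move=> s w sw; have [U [F [oU Us FC fF]]] := fs s w sw.
  exists U, (partial ord0 F); split=> //.
    by move=> k; exact: Ck_partial (FC k.+1).
  move=> s' w' sw' Us'.
  have := smooth_datum_local sw' oU Us' (FC 1%N) fF.
  by case=> _; rewrite /sderiv derive1E.
move=> s w sw s01; have [U [oU Us f0]] := fz s w sw s01.
exists U; split=> // s' w' sw' Us'.
rewrite /sderiv derive1E.
have H : is_derive s' 1 (f^~ w') 0.
  apply: near_eq_is_derive (is_derive_cst 0 s' 1).
  by apply: filterS (event_near oU Us') => r Ur; rewrite f0.
by case: H.
Qed.

Lemma smooth_datum_out f s w : smooth_datum f -> sphere2 w -> ~ (0 < s < 1) -> f s w = 0.
Proof. by move=> [_ fz] sw /(fz s w sw)[U [_ Us]]; exact. Qed.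

Lemma smooth_datum_continuous (T : topologicalType) f (s : T -> R) (w : T -> R * R) t :
  smooth_datum f -> {for t, continuous s} -> {for t, continuous w} ->
  {for t, continuous (fun t => f (s t) (omv (w t)))}.
Proof.
move=> [fs _] sc wc.
have [U [F [oU Us FC fF]]] := fs (s t) (omv (w t)) (omv_sphere _).
have ec : {for t, continuous (fun t => event (s t) (omv (w t)))}.
  by apply: event_continuous => //; apply: (cont_comp wc); exact: omv_continuous.
apply: (near_eq_continuous (f := fun t => F (event (s t) (omv (w t))))).
  have : \forall t \near t, U (event (s t) (omv (w t))).
    by apply: ec; exact: open_nbhs_nbhs.
  by apply: filterS => r Ur; rewrite fF//; exact: omv_sphere.
apply: (cont_comp ec); exact: Ck_continuous (FC 0%N) Us.
Qed.

Lemma cylinder_closure_compact :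
  compact [set p : 'rV[R]_(1 + 3) | 0 <= tcoord p <= 1 /\ sphere2 (xcoord p)].
Proof.
apply: bounded_closed_compact.
  exists 1; split; first exact: num_real.
  move=> M M1 p /= [/andP[t0 t1] /sphere2P s].
  have M0 : 0 <= M by exact: le_trans ler01 (ltW M1).
  have sq1 (a : R) : a ^+ 2 <= 1 -> `|a| <= M.
    move=> a1; apply: le_trans (ltW M1).
    by rewrite -(@expr_le1 _ 2)// real_normK// num_real.
  have [a b c] := xcoord_j p; rewrite a b c in s.
  apply: norm_le_coord => //; apply: forall4.
  - by rewrite ger0_norm// (le_trans t1)// ltW.
  - apply: sq1; rewrite -s -addrA lerDl addr_ge0// sqr_ge0//.
  - by apply: sq1; rewrite -s addrAC lerDr addr_ge0// sqr_ge0.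
  - by apply: sq1; rewrite -s lerDr addr_ge0// sqr_ge0.
rewrite (_ : [set p | _] = (@tcoord R @^-1` [set t | 0 <= t]) `&` ((@tcoord R @^-1` [set t | t <= 1])
   `&` ((fun p : 'rV[R]_(1 + 3) => p 0 ix1 ^+ 2 + p 0 ix2 ^+ 2 + p 0 ix3 ^+ 2) @^-1` [set 1]))).
  apply: closedI; first by apply: closed_comp; [move=> p _; exact: tcoord_continuous|exact: closed_ge].
  apply: closedI; first by apply: closed_comp; [move=> p _; exact: tcoord_continuous|exact: closed_le].
  apply: closed_comp; last exact: closed_eq.
  have c2 i (p : 'rV[R]_(1 + 3)) : {for p, continuous (fun p : 'rV[R]_(1 + 3) => p 0 i ^+ 2)}.
    apply: (eq_cont (f := fun p : 'rV[R]_(1 + 3) => p 0 i * p 0 i)); first by [].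
    by apply: cont_mul; exact: coord_continuous.
  have H : continuous (fun p : 'rV[R]_(1 + 3) => p 0 ix1 ^+ 2 + p 0 ix2 ^+ 2 + p 0 ix3 ^+ 2).
    by apply: contT => p; apply: cont_add; [apply: cont_add|]; exact: c2.
  by move=> p _; exact: H.
apply/seteqP; split => p /=.
  by move=> [/andP[t0 t1] /sphere2P]; have [-> -> ->] := xcoord_j p.
by move=> [t0 [t1 s]]; split; [rewrite t0 t1|apply/sphere2P; have [-> -> ->] := xcoord_j p].
Qed.

Lemma smooth_datum_near f s w (e : R) : smooth_datum f -> sphere2 w -> 0 < e ->
  exists2 d, 0 < d & forall s' w', sphere2 w' -> `|event s w - event s' w'| < d ->
    `|f s w - f s' w'| <= e.
Proof.
move=> [fs _] sw e0; have [U [F [oU Us FC fF]]] := fs s w sw.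
have /cvgrPdist_le/(_ _ e0) Fc := Ck_continuous (FC 0%N) Us.
have : \forall q \near event s w, U q /\ `|F (event s w) - F q| <= e.
  by apply: filterI => //; exact: open_nbhs_nbhs.
move=> /nbhs_ballP[d /= d0 dP]; exists d => // s' w' sw' hd.
have [Us' H] : U (event s' w') /\ `|F (event s w) - F (event s' w')| <= e.
  by apply: dP; rewrite -ball_normE.
by rewrite !fF.
Qed.

(** Compactness of [[0, 1] x S^2] gives the uniform bound there; for other [s] both values are 0, so
    [d] serves all real [s]. *)
Lemma smooth_datum_unif f (e : R) : smooth_datum f -> 0 < e ->
  exists2 d : R, 0 < d & forall s w w', sphere2 w -> sphere2 w' -> `|w - w'| < d ->
    `|f s w - f s w'| <= e.
Proof.
move=> fs e0.
have := (compact_near_coveringP _).1 cylinder_closure_compact R (0^'+)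
  (fun d p => forall w', sphere2 w' -> `|xcoord p - w'| < d -> sphere2 (xcoord p) ->
     `|f (tcoord p) (xcoord p) - f (tcoord p) w'| <= e) _.
case.
  move=> p [_ sp]; have e2 : 0 < e / 2 by rewrite divr_gt0.
  have [d d0 dP] := smooth_datum_near (tcoord p) fs sp e2.
  rewrite event_eta in dP.
  have d2 : 0 < d / 2 by rewrite divr_gt0.
  exists (ball p (d / 2), [set r | r < d / 2]) => /=.
    split; first exact: nbhsx_ballx.
    by apply: nbhs_right_lt.
  move=> [q r] /= [pq rd] w' sw' qw' sq.
  rewrite -ball_normE/= in pq.
  have H1 : `|f (tcoord p) (xcoord p) - f (tcoord q) (xcoord q)| <= e / 2.
    by apply: dP => //; rewrite event_eta (lt_trans pq)// ltr_pdivrMr// mulr_natr mulr2n ltrDl.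
  have H2 : `|f (tcoord p) (xcoord p) - f (tcoord q) w'| <= e / 2.
    apply: dP => //; have -> : p - event (tcoord q) w' = (p - q) + (q - event (tcoord q) w').
      by rewrite addrA subrK.
    rewrite (le_lt_trans (ler_normD _ _))// [ltRHS]splitr ltrD//.
    apply: le_lt_trans (lt_trans qw' rd).
    apply: norm_le_coord => // i; rewrite -{1}(event_eta q) !event_ev !mxE.
    move: i; apply: forall4 => /=; first by rewrite subrr normr0.
    - by have := coord_le_norm (xcoord q - w') j0; rewrite !mxE.
    - by have := coord_le_norm (xcoord q - w') j1; rewrite !mxE.
    - by have := coord_le_norm (xcoord q - w') j2; rewrite !mxE.
  rewrite (le_trans (ler_distD (f (tcoord p) (xcoord p)) _ _))//.
  by rewrite [leRHS]splitr lerD// distrC.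
move=> d /= d0 dP; exists (d / 2); first by rewrite divr_gt0.
move=> s w w' sw sw' ww'.
have [s01|s01] := pselect (0 < s < 1); last first.
  by rewrite !(smooth_datum_out fs)// subrr normr0 ltW.
have := dP (d / 2) _ _ (event s w).
rewrite !tcoord_event !xcoord_event; apply => //.
- rewrite /ball/= sub0r normrN gtr0_norm ?divr_gt0//.
  by rewrite ltr_pdivrMr// mulr_natr mulr2n ltrDl.
- by rewrite divr_gt0.
- by rewrite /= tcoord_event xcoord_event; move: s01 => /andP[/ltW -> /ltW ->].
Qed.

Lemma smooth_datum_bounded f : smooth_datum f ->
  exists2 B : R, 0 <= B & forall s w, sphere2 w -> `|f s w| <= B.
Proof.
move=> fs.
have := (compact_near_coveringP _).1 cylinder_closure_compact R (pinfty_nbhs R)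
  (fun B p => sphere2 (xcoord p) -> `|f (tcoord p) (xcoord p)| <= B) _.
case.
  move=> p [_ sp].
  have [d d0 dP] := smooth_datum_near (tcoord p) fs sp ltr01.
  rewrite event_eta in dP.
  exists (ball p d, [set B | `|f (tcoord p) (xcoord p)| + 1 < B]) => /=.
    split; first exact: nbhsx_ballx.
    by apply: nbhs_pinfty_gt; exact: num_real.
  move=> [q B] /= [pq qB] sq.
  rewrite -ball_normE/= in pq.
  have H : `|f (tcoord p) (xcoord p) - f (tcoord q) (xcoord q)| <= 1.
    by apply: dP => //; rewrite event_eta.
  have := ler_normB (f (tcoord p) (xcoord p)) (f (tcoord p) (xcoord p) - f (tcoord q) (xcoord q)).
  by rewrite opprB addrC subrK; move: H qB; clear; lra.
move=> M [_ MP]; exists (`|M| + 1); first by rewrite addr_ge0.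
move=> s w sw; have [s01|s01] := pselect (0 < s < 1); last first.
  by rewrite (smooth_datum_out fs)// normr0 addr_ge0.
have := MP (`|M| + 1) _ (event s w); rewrite !tcoord_event !xcoord_event; apply => //.
- by rewrite (le_lt_trans (ler_norm _))// ltrDl.
- by rewrite /= tcoord_event xcoord_event; move: s01 => /andP[/ltW -> /ltW ->].
Qed.

End Data.

(** * Means of plane waves as smooth solutions of the wave equation *)

Section Superposition.
Context {R : realType}.
Implicit Types (g : R -> 'rV[R]_3 -> R) (h : R * R -> R).

Definition pv (w : R * R) : 'I_(1 + 3) -> R := plane_vec (om1 w) (om2 w) (om3 w).

Lemma pvE w : [/\ pv w ord0 = 1, pv w ix1 = om1 w, pv w ix2 = om2 w & pv w ix3 = om3 w].
Proof. by split; rewrite /pv /plane_vec evE. Qed.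

Lemma phaseE w (p : 'rV[R]_(1 + 3)) : lin_form (pv w) p =
  p 0 ord0 + p 0 ix1 * om1 w + p 0 ix2 * om2 w + p 0 ix3 * om3 w.
Proof. by rewrite {1}(ev_eta p) /pv plane_phase. Qed.

Lemma pv_continuous i : continuous (fun w => pv w i).
Proof.
move: i; apply: forall4; apply: contT => w.
- by apply: (eq_cont (f := fun _ : R * R => 1 : R)) => [q|]; [have [->] := pvE q|exact: cont_cst].
- by apply: (eq_cont (f := om1)) => [q|]; [have [_ ->] := pvE q|rewrite /om1; repeat cont_step].
- by apply: (eq_cont (f := om2)) => [q|]; [have [_ _ ->] := pvE q|rewrite /om2; repeat cont_step].
- by apply: (eq_cont (f := om3)) => [q|]; [have [_ _ _ ->] := pvE q|rewrite /om3; repeat cont_step].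
Qed.

Lemma phase_continuous (T : topologicalType) (w : T -> R * R) (p : T -> 'rV[R]_(1 + 3)) t :
  {for t, continuous w} -> {for t, continuous p} ->
  {for t, continuous (fun t => lin_form (pv (w t)) (p t))}.
Proof.
move=> wc pc.
apply: (eq_cont (f := fun t => p t 0 ord0 + p t 0 ix1 * om1 (w t) + p t 0 ix2 * om2 (w t)
  + p t 0 ix3 * om3 (w t))); first by move=> s; rewrite phaseE.
have pj j : {for t, continuous (fun t => p t 0 j)}.
  by apply: (cont_comp (g := fun y : 'rV[R]_(1 + 3) => y 0 j) pc); exact: coord_continuous.
have o1 := cont_om1 wc; have o2 := cont_om2 wc; have o3 := cont_om3 wc.
by repeat cont_step; [exact: pj|exact: pj|exact: o1|exact: pj|exact: o2|exact: pj|exact: o3].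
Qed.

(* The mean value over w of plane waves travelling in the direction - w. *)
Definition superpos (l : R) h g (p : 'rV[R]_(1 + 3)) : R :=
  sph_avg (fun w => h w * g (l * lin_form (pv w) p) (omv w)).

Lemma superpos_integrand_continuous (T : topologicalType) l h g (w : T -> R * R)
    (p : T -> 'rV[R]_(1 + 3)) t :
  continuous h -> smooth_datum g -> {for t, continuous w} -> {for t, continuous p} ->
  {for t, continuous (fun t => h (w t) * g (l * lin_form (pv (w t)) (p t)) (omv (w t)))}.
Proof.
move=> hc gs wc pc; apply: cont_mul; first by apply: (cont_comp wc); exact: hc.
apply: smooth_datum_continuous => //.
by apply: cont_mul; [exact: cont_cst|exact: phase_continuous].
Qed.

Lemma superpos_slice_continuous l h g p : continuous h -> smooth_datum g ->
  continuous (fun w => h w * g (l * lin_form (pv w) p) (omv w)).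
Proof.
move=> hc gs; apply: contT => w.
apply: (superpos_integrand_continuous (w := fun w => w) (p := fun=> p)) => //.
exact: cst_continuous.
Qed.

Lemma superpos_continuous l h g : continuous h -> smooth_datum g ->
  continuous (superpos l h g).
Proof.
move=> hc gs; apply: contT => p.
apply: (pos_fun_continuous sph_avg_positive
  (F := fun p w => h w * g (l * lin_form (pv w) p) (omv w))).
  by apply: (@filterE _ (nbhs p)) => q; exact: superpos_slice_continuous.
move=> w _; apply: (superpos_integrand_continuous
  (w := fun z : 'rV[R]_(1 + 3) * (R * R) => z.2) (p := fun z => z.1) hc gs).
- exact: cvg_snd.
- exact: cvg_fst.
Qed.

(** Each derivative multiplies the weight by [l * pv w i] and replaces the profile by its
    [s]-derivative; the weight [h] is carried along to make superpositions closed under this. *)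
Lemma superpos_is_derive l h g p i : continuous h -> smooth_datum g ->
  is_derive p (delta_mx 0 i) (superpos l h g)
    (superpos l (fun w => h w * (l * pv w i)) (sderiv g) p).
Proof.
move=> hc gs; apply: (is_derive_dirP _ _ _ _).2; rewrite /superpos.
have gs' := smooth_datum_sderiv gs.
have hc' : continuous (fun w => h w * (l * pv w i)).
  apply: contT => w; apply: cont_mul; first exact: hc.
  by apply: cont_mul; [exact: cont_cst|exact: pv_continuous].
have lc (r : R) : {for r, continuous (fun r : R => r *: delta_mx 0 i + p)}.
  apply: continuous_row => j.
  apply: (eq_cont (f := fun r : R => r * (delta_mx 0 i : 'rV[R]_(1 + 3)) 0 j + p 0 j)).
    by move=> s; rewrite !mxE.
  by repeat cont_step.
have := @pos_fun_is_derive R _ _ _ (@sph_avg_positive R)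
  (fun r w => h w * g (l * lin_form (pv w) (r *: delta_mx 0 i + p)) (omv w))
  (fun r w => h w * (l * pv w i) * sderiv g (l * lin_form (pv w) (r *: delta_mx 0 i + p)) (omv w)) 0.
rewrite scale0r add0r; apply.
- by apply: (@filterE _ (nbhs (0 : R))) => r; exact: superpos_slice_continuous.
- apply: (@filterE _ (nbhs (0 : R))) => r w _.
  have ld : is_derive r 1 (fun r => l * lin_form (pv w) (r *: delta_mx 0 i + p)) (l * pv w i).
    have -> : (fun r => l * lin_form (pv w) (r *: delta_mx 0 i + p)) =
       (fun r => l * (r * pv w i + lin_form (pv w) p)).
      by apply/funext => s; rewrite linearP/= lin_form_delta.
    der; by rewrite mul0r add0r mulr0 mul1r !addr0.
  have gd := smooth_datum_derive (l * lin_form (pv w) (r *: delta_mx 0 i + p)) gs (omv_sphere w).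
  have cd := @der_comp R (g^~ (omv w)) (fun r => l * lin_form (pv w) (r *: delta_mx 0 i + p)) r _ _ gd ld.
  have := der_mul (der_cst (h w) r) cd.
  congr (is_derive _ _ _ _); rewrite mul0r add0r -mulrA; congr (_ * _).
  exact: mulrC.
- exact: superpos_slice_continuous.
- move=> w _; apply: (superpos_integrand_continuous (w := fun z : R * (R * R) => z.2)
    (p := fun z : R * (R * R) => z.1 *: delta_mx 0 i + p) hc' gs'); first exact: cvg_snd.
  by apply: (cont_comp (g := fun r : R => r *: delta_mx 0 i + p)); [exact: cvg_fst|exact: lc].
Qed.

Lemma superpos_Ck k l h g : continuous h -> smooth_datum g -> Ck k setT (superpos l h g).
Proof.
elim: k h g => [|k IH] h g hc gs.
  by split=> // p _; exact: superpos_continuous.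
apply: (@Ck_S _ _ k setT _ (fun i => superpos l (fun w => h w * (l * pv w i)) (sderiv g))).
- exact: openT.
- by move=> p _; exact: superpos_continuous.
- by move=> i p _; exact: superpos_is_derive.
- move=> i; apply: IH; last exact: smooth_datum_sderiv.
  apply: contT => w; apply: cont_mul; first exact: hc.
  by apply: cont_mul; [exact: cont_cst|exact: pv_continuous].
Qed.

Lemma partial_superpos l h g i : continuous h -> smooth_datum g ->
  partial i (superpos l h g) = superpos l (fun w => h w * (l * pv w i)) (sderiv g).
Proof.
move=> hc gs; apply/funext => p; have H := superpos_is_derive l p i hc gs.
exact: (@derive_val _ _ _ _ _ _ _ H).
Qed.

(** The covector [(1, om)] is null, so the four second-derivative weights cancel pointwise in
    [w]. *)
Lemma superpos_box l h g p : continuous h -> smooth_datum g -> box (superpos l h g) p = 0.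
Proof.
move=> hc gs; have gs' := smooth_datum_sderiv gs; have gs2 := smooth_datum_sderiv gs'.
have hc' i : continuous (fun w => h w * (l * pv w i)).
  apply: contT => w; apply: cont_mul; first exact: hc.
  by apply: cont_mul; [exact: cont_cst|exact: pv_continuous].
have hc2 i : continuous (fun w => h w * (l * pv w i) * (l * pv w i)).
  apply: contT => w; apply: cont_mul; first exact: hc'.
  by apply: cont_mul; [exact: cont_cst|exact: pv_continuous].
have E i : partial i (partial i (superpos l h g)) =
    superpos l (fun w => h w * (l * pv w i) * (l * pv w i)) (sderiv (sderiv g)).
  by rewrite partial_superpos// partial_superpos.
rewrite boxE !E /superpos.
set G := sderiv (sderiv g).
pose I i w := h w * (l * pv w i) * (l * pv w i) * G (l * lin_form (pv w) p) (omv w).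
rewrite -/(I ord0) -/(I ix1) -/(I ix2) -/(I ix3).
have c' i : continuous (I i) by exact: (superpos_slice_continuous (hc2 i) gs2).
have cs (a b : R * R -> R) : continuous a -> continuous b -> continuous (fun w => a w + b w).
  by move=> ac bc; apply: contT => w; apply: cont_add; [exact: ac|exact: bc].
have cN : continuous (fun w => -1 * I ord0 w).
  by apply: contT => w; apply: cont_mul; [exact: cont_cst|exact: c'].
rewrite -[- sph_avg _]mulN1r -(pos_funZ sph_avg_positive)//.
have c1 := cs _ _ cN (c' ix1); have c2 := cs _ _ c1 (c' ix2).
rewrite -(pos_funD sph_avg_positive cN (c' ix1)) -(pos_funD sph_avg_positive c1 (c' ix2)).
rewrite -(pos_funD sph_avg_positive c2 (c' ix3)).
rewrite -[RHS](pos_fun0 sph_avg_positive); congr sph_avg; apply/funext => w.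
rewrite /I; have [-> -> -> ->] := pvE w; have := om_norm w.
move: (om1 w) (om2 w) (om3 w) (h w) (G _ _) => a b d k q H.
have {}H : a ^+ 2 = 1 - b ^+ 2 - d ^+ 2 by clear -H; lra.
ring: H.
Qed.

End Superposition.

(** * Means of functions concentrated on a thin band of directions *)

Section Concentration.
Context {R : realType}.

(** The derivative of [atan]: a positive smooth weight whose integral over any interval is at most
    [pi]. *)
Definition lorentz (s : R) : R := (1 + s ^+ 2)^-1.

Lemma lorentz_denom_gt0 (s : R) : 0 < 1 + s ^+ 2.
Proof. by rewrite ltr_pwDl// sqr_ge0. Qed.

Lemma lorentz_gt0 (s : R) : 0 < lorentz s.
Proof. by rewrite invr_gt0 lorentz_denom_gt0. Qed.

Lemma lorentz_ge (s : R) : 0 < s < 1 -> 1 <= 2 * lorentz s.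
Proof.
move=> /andP[s0 s1]; rewrite ler_pdivlMr ?lorentz_denom_gt0// mul1r.
have : s ^+ 2 <= 1 by rewrite expr_le1// ltW.
lra.
Qed.

Lemma der_lorentz (s : R) : is_derive s 1 lorentz (-2 * s * lorentz s ^+ 2).
Proof.
have n0 : 1 + s ^+ 2 != 0 by rewrite gt_eqF// lorentz_denom_gt0.
have d : is_derive s 1 (fun s : R => 1 + s * s) (2 * s) by der; ring.
split.
  by apply: derivableV => //; have [] := d.
rewrite /lorentz.
have -> : (fun s : R => (1 + s ^+ 2)^-1) = (fun s : R => (1 + s * s)^-1) by [].
have dd : derivable (fun s : R => 1 + s * s) s 1 by have [] := d.
rewrite (deriveV (f := fun s : R => 1 + s * s))//.
have [_ ->] := d; rewrite -[_ *: _]/(_ * _) -expr2 -exprVn; ring.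
Qed.

Lemma lorentz_continuous : continuous lorentz.
Proof. by apply: contT => s; exact: der_continuous (der_lorentz s). Qed.

Definition lorentz1 (s : R) : R := -2 * s * lorentz s ^+ 2.

Definition lorentz2 (s : R) : R :=
  -2 * lorentz s ^+ 2 + 8 * s ^+ 2 * lorentz s ^+ 3.

Lemma der_lorentz1 (s : R) : is_derive s 1 lorentz1 (lorentz2 s).
Proof.
have H : is_derive s 1 (fun s => -2 * s * (lorentz s * lorentz s)) (lorentz2 s).
  have dl := der_lorentz s.
  der; [exact: dl|exact: dl|].
  by rewrite /lorentz2; ring.
by move: H; congr (is_derive _ _ _ _).
Qed.

Lemma lorentz2_continuous : continuous lorentz2.
Proof.
have c s : {for s, continuous lorentz} by exact: lorentz_continuous.
apply: contT => s.
apply: (eq_cont (f := fun s => -2 * (lorentz s * lorentz s)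
  + 8 * (s * s) * (lorentz s * lorentz s * lorentz s))).
  by move=> r; rewrite /lorentz2; ring.
by repeat cont_step; exact: c.
Qed.

Lemma affine_der (a k x : R) : is_derive x 1 (fun x => a + k * x) k.
Proof. by der; ring. Qed.

Lemma affine_comp_continuous (a k : R) (g : R -> R) :
  continuous g -> continuous (fun x => g (a + k * x)).
Proof.
move=> gc; apply: contT => x; apply: (cont_comp (g := g)); last exact: gc.
exact: der_continuous (affine_der a k x).
Qed.

(* The mean value over the sphere of a function of n . omega, by Archimedes'
   hat-box theorem. *)
Lemma sph_avg_affine (G G1 G2 G3 : R -> R) (a k n1 n2 n3 : R) :
  0 < k -> n1 ^+ 2 + n2 ^+ 2 + n3 ^+ 2 = 1 ->
  (forall s : R, is_derive s 1 G (G1 s)) -> (forall s : R, is_derive s 1 G1 (G2 s)) ->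
  (forall s : R, is_derive s 1 G2 (G3 s)) -> continuous G3 ->
  sph_avg (fun w => G1 (a + k * (om1 w * n1 + om2 w * n2 + om3 w * n3))) =
  (G (a + k) - G (a - k)) / (2 * k).
Proof.
move=> k0 n123 Gd G1d G2d G3c.
have cd (F F' : R -> R) (x : R) : (forall s : R, is_derive s 1 F (F' s)) ->
    is_derive x 1 (fun x => F (a + k * x)) (F' (a + k * x) * k).
  by move=> Fd; apply: (@der_comp _ F (fun x => a + k * x)) => //; exact: affine_der.
have sc (F : R -> R) (F' c x : R) : is_derive x 1 F F' -> is_derive x 1 (fun x => c * F x) (c * F').
  by move=> Fd; have := der_mul (der_cst c x) Fd; rewrite mul0r add0r.
have H0 x : is_derive (x : R) 1 (fun x => k^-1 * G (a + k * x)) (G1 (a + k * x)).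
  have := sc _ _ k^-1 _ (cd _ _ x Gd).
  by rewrite mulrCA mulVf ?mulr1// gt_eqF.
have H1 x : is_derive (x : R) 1 (fun x => G1 (a + k * x)) (k * G2 (a + k * x)).
  by have := cd _ _ x G1d; rewrite mulrC.
have H2 x : is_derive (x : R) 1 (fun x => k * G2 (a + k * x)) (k * (k * G3 (a + k * x))).
  by have := sc _ _ k _ (cd _ _ x G2d); rewrite [_ * k]mulrC.
have H3 : continuous (fun x => k * (k * G3 (a + k * x))).
  apply: contT => x; do 2 (apply: cont_mul; first exact: cont_cst).
  exact: affine_comp_continuous.
have E := sph_avg_plane n123 H0 H1 H2 H3.
by rewrite E mulr1 mulrN1 -mulrBr invfM; ring.
Qed.

(** The hat-box formula leaves an increment of [atan], which is less than [pi] for every [a]. This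
    stands in for the measure of the band of directions where the phase lies in [(0, 1)]. *)
Lemma sph_avg_lorentz (a k n1 n2 n3 : R) : 0 < k -> n1 ^+ 2 + n2 ^+ 2 + n3 ^+ 2 = 1 ->
  sph_avg (fun w => lorentz (a + k * (om1 w * n1 + om2 w * n2 + om3 w * n3)))
    <= pi / (2 * k).
Proof.
move=> k0 n123.
have E := sph_avg_affine a k0 n123 (@is_derive1_atan R) der_lorentz der_lorentz1
  lorentz2_continuous.
rewrite E ler_pM2r ?invr_gt0 ?mulr_gt0//.
have := atan_ltpi2 (a + k); have := atan_gtNpi2 (a - k).
move: (atan _) (atan _) (@pi R) => u v q; clear; lra.
Qed.

End Concentration.

(** * Extension of the datum by zero *)

Section DataExtension.
Context {R : realType}.
Variable psi0 : R -> 'rV[R]_3 -> R.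

(** [psi0] is a total function with arbitrary values for [s] outside [(0, 1)]; these are overwritten
    by 0. *)
Definition zero_ext (s : R) (w : 'rV[R]_3) : R := if 0 < s < 1 then psi0 s w else 0.

Lemma zero_ext_smooth :
  smooth_on cylinder (fun p => psi0 (tcoord p) (xcoord p)) ->
  compactly_supported_in cylinder (fun p => psi0 (tcoord p) (xcoord p)) ->
  smooth_datum zero_ext.
Proof.
move=> psis [K [Kc Kcyl K0]].
have oK : open (~` K) by apply: closed_openC; exact: compact_closed.
have KP s' w' : sphere2 w' -> ~ K (event s' w') -> zero_ext s' w' = 0.
  rewrite /zero_ext; case: ifP => // s01 sw' nK.
  have := K0 (event s' w'); rewrite tcoord_event xcoord_event; apply => //.
  by rewrite /cylinder/= tcoord_event xcoord_event.
split=> s w sw.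
  have [Ksw|nKsw] := pselect (K (event s w)); last first.
    exists (~` K), (fun=> 0); split=> //; first by move=> k; exact: Ck_cst.
  have [U [F [oU Us FC fF]]] := psis _ (Kcyl _ Ksw).
  exists (U `&` (@tcoord R @^-1` [set t | 0 < t] `&` @tcoord R @^-1` [set t | t < 1])), F; split.
  - apply: openI => //; apply: openI.
    + by apply: open_comp; [move=> p _; exact: tcoord_continuous|exact: open_gt].
    + by apply: open_comp; [move=> p _; exact: tcoord_continuous|exact: open_lt].
  - have := Kcyl _ Ksw; rewrite /cylinder/= => -[/andP[]]; rewrite /= => a b _.
    by split.
  - by move=> k; apply: Ck_subset (FC k) => q [].
  - move=> s' w' sw' [Us' /= []]; rewrite !tcoord_event => s0 s1.
    rewrite /zero_ext s0 s1/=.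
    have := fF (event s' w') Us'; rewrite tcoord_event xcoord_event; apply.
    by rewrite /cylinder/= tcoord_event xcoord_event s0 s1.
move=> s01; exists (~` K); split=> //.
by move=> Ksw; apply: s01; have := Kcyl _ Ksw; rewrite /cylinder/= tcoord_event => -[].
Qed.

Lemma past_dataE (delta ub : R) w : 0 < delta ->
  past_data psi0 delta ub w = Num.sqrt delta * zero_ext (ub / delta) w.
Proof.
move=> d0; rewrite /past_data /zero_ext ltr_pdivrMr// mul1r pmulr_lgt0 ?invr_gt0//.
by case: ifP => // _; rewrite mulr0.
Qed.

End DataExtension.

(** * Euclidean geometry of space and null-polar coordinates *)

Section Euclid.
Context {R : realType}.
Implicit Types x y : 'rV[R]_3.

Lemma cauchy_schwarz3 (a1 a2 a3 b1 b2 b3 r s : R) : 0 <= r -> 0 <= s ->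
  a1 ^+ 2 + a2 ^+ 2 + a3 ^+ 2 = r ^+ 2 -> b1 ^+ 2 + b2 ^+ 2 + b3 ^+ 2 = s ^+ 2 ->
  a1 * b1 + a2 * b2 + a3 * b3 <= r * s.
Proof.
move=> r0 s0 ar bs; apply: le_trans (ler_norm _) _.
rewrite -(@ler_pXn2r _ 2)// ?nnegrE ?mulr_ge0// real_normK ?num_real//.
rewrite exprMn -ar -bs -subr_ge0.
rewrite (_ : _ - _ = (a1 * b2 - a2 * b1) ^+ 2 + (a1 * b3 - a3 * b1) ^+ 2 + (a2 * b3 - a3 * b2) ^+ 2); last by ring.
by rewrite !addr_ge0// sqr_ge0.
Qed.

Lemma euclidean_norm_triangle x y :
  euclidean_norm (x + y) <= euclidean_norm x + euclidean_norm y.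
Proof.
have x0 := euclidean_norm_ge0 x; have y0 := euclidean_norm_ge0 y.
rewrite -(@ler_pXn2r _ 2)// ?nnegrE ?addr_ge0//; last exact: euclidean_norm_ge0.
have := cauchy_schwarz3 x0 y0 (esym (euclidean_norm_sqr x)) (esym (euclidean_norm_sqr y)).
have := euclidean_norm_sqr x; have := euclidean_norm_sqr y.
rewrite (euclidean_norm_sqr (x + y)) !mxE.
move: (euclidean_norm x) (euclidean_norm y) => r s.
move: (x 0 j0) (x 0 j1) (x 0 j2) (y 0 j0) (y 0 j1) (y 0 j2) => a b c d e f.
by clear => sE rE H; nra.
Qed.

Lemma euclidean_normZ (c : R) x : euclidean_norm (c *: x) = `|c| * euclidean_norm x.
Proof.
rewrite !euclidean_normE !mxE !exprMn -!mulrDr sqrtrM ?sqr_ge0//.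
by rewrite sqrtr_sqr.
Qed.

Lemma euclidean_normN x : euclidean_norm (- x) = euclidean_norm x.
Proof. by rewrite -scaleN1r euclidean_normZ normrN1 mul1r. Qed.

Lemma euclidean_norm_continuous : continuous (@euclidean_norm R 3).
Proof.
have c2 i x : {for x, continuous (fun x : 'rV[R]_3 => x 0 i ^+ 2)}.
  apply: (eq_cont (f := fun x : 'rV[R]_3 => x 0 i * x 0 i)); first by [].
  by apply: cont_mul; exact: coord_continuous.
apply: contT => x.
apply: (eq_cont (f := fun x : 'rV[R]_3 => Num.sqrt (x 0 j0 ^+ 2 + x 0 j1 ^+ 2 + x 0 j2 ^+ 2))).
  by move=> y; rewrite euclidean_normE.
apply: (cont_comp (g := @Num.sqrt R)); last exact: sqrt_continuous.
by apply: cont_add; [apply: cont_add|]; exact: c2.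
Qed.

Lemma norm_le_euclidean x : `|x| <= euclidean_norm x.
Proof.
apply: norm_le_coord; first exact: euclidean_norm_ge0.
have H (c : R) : c ^+ 2 <= euclidean_norm x ^+ 2 -> `|c| <= euclidean_norm x.
  move=> H; rewrite -(@ler_pXn2r _ 2)// ?nnegrE ?euclidean_norm_ge0//.
  by rewrite real_normK ?num_real.
apply: forall3; apply: H; rewrite euclidean_norm_sqr.
- by rewrite -addrA lerDl addr_ge0// sqr_ge0.
- by rewrite addrAC lerDr addr_ge0// sqr_ge0.
- by rewrite lerDr addr_ge0// sqr_ge0.
Qed.

Lemma sphere2_dist x y : sphere2 x -> sphere2 y ->
  euclidean_norm (x - y) ^+ 2 =
  2 - 2 * (x 0 j0 * y 0 j0 + x 0 j1 * y 0 j1 + x 0 j2 * y 0 j2).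
Proof.
move=> /sphere2P x1 /sphere2P y1; rewrite euclidean_norm_sqr !mxE.
move: x1 y1; move: (x 0 j0) (x 0 j1) (x 0 j2) (y 0 j0) (y 0 j1) (y 0 j2) => a b c d k l.
by clear => H1 H2; nra.
Qed.

Lemma sphere2_normalize x : 0 < euclidean_norm x -> sphere2 ((euclidean_norm x)^-1 *: x).
Proof.
by move=> x0; rewrite /sphere2/= euclidean_normZ gtr0_norm ?invr_gt0// mulVf// gt_eqF.
Qed.

Lemma null_polar_eta (t : R) x : 0 < euclidean_norm x ->
  null_polar ((t - euclidean_norm x) / 2) ((t + euclidean_norm x) / 2)
    ((euclidean_norm x)^-1 *: x) = event t x.
Proof.
move=> x0; rewrite /null_polar.
rewrite (_ : _ + _ = t); last by field.
rewrite (_ : _ - _ = euclidean_norm x); last by field.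
by rewrite scalerA mulfV ?scale1r// gt_eqF.
Qed.

Lemma ubar_event (t : R) x : ubar (event t x) = (t + euclidean_norm x) / 2.
Proof. by rewrite /ubar tcoord_event xcoord_event. Qed.

End Euclid.

(** The arithmetic of the radiation limit, with [sd = sqrt delta], [phi] the profile value and [E]
    the mean of the remainder. As [- u = r - ub], the main term misses [sd * phi] by
    [sd * phi * ub / r]; this and the remainder term are each at most [e / 4]. *)
Lemma radiation_error (R : realType) (u ub r sd delta phi E e B A l : R) :
  sd ^+ 2 = delta -> 0 < sd -> 0 < r -> r = ub - u -> u < 0 -> 0 < e -> 0 <= B ->
  `|phi| <= B -> `|ub| <= A -> - u <= 2 * r -> 8 * sd * B * A / e <= 2 * r ->
  `|E| * r <= 2 * delta * l -> 4 * sd * l <= e / 4 ->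
  `| `|u| * (sd^-1 * (phi * delta / r + E)) - sd * phi | < e.
Proof.
move=> sdE sd0 r0 rE u0 e0 B0 phiB ubA ur eA Er le.
rewrite (ltr0_norm u0).
have -> : - u * (sd^-1 * (phi * delta / r + E)) - sd * phi =
    (- (sd * phi * ub) - u * sd^-1 * (E * r)) / r.
  rewrite -sdE; have -> : ub = r + u by rewrite rE subrK.
  by field; rewrite !gt_eqF.
rewrite normrM normfV (gtr0_norm r0) ltr_pdivrMr//.
apply: le_lt_trans (ler_normB _ _) _.
rewrite normrN !normrM (gtr0_norm sd0) normfV (gtr0_norm sd0) (ltr0_norm u0) -normrM.
have H1 : sd * `|phi| * `|ub| <= e / 4 * r.
  apply: (@le_trans _ _ (sd * B * A)).
    by rewrite -!mulrA ler_pM2l// ler_pM.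
  have : 8 * sd * B * A <= 2 * r * e by rewrite -ler_pdivrMr.
  by clear; lra.
have H2 : - u * sd^-1 * `|E * r| <= e / 4 * r.
  rewrite normrM (gtr0_norm r0).
  apply: (@le_trans _ _ (2 * r * sd^-1 * (2 * delta * l))).
    have u0' : 0 <= - u by rewrite oppr_ge0 ltW.
    by apply: ler_pM => //; rewrite ?mulr_ge0// ?invr_ge0 ?(ltW sd0) ?(ltW r0)// ler_wpM2r// invr_ge0 ltW.
  rewrite -sdE (_ : _ * _ = 4 * sd * l * r); last by field; rewrite gt_eqF.
  by rewrite ler_pM2r.
have H3 : e / 4 * r + e / 4 * r < e * r.
  by rewrite -mulrDl ltr_pM2r//; move: e0; clear; lra.
by apply: le_lt_trans H3; exact: lerD.
Qed.

(** * The linear solution with prescribed radiation field *)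

Section Solution.
Context {R : realType}.
Variables (f : R -> 'rV[R]_3 -> R).
Hypothesis fs : smooth_datum f.

(* The superposition of plane waves whose radiation field at past null infinity
   is [sqrt delta * f (ub / delta) w]. *)
Definition wave (delta : R) : 'rV[R]_(1 + 3) -> R :=
  superpos (2 * delta)^-1 (fun=> (Num.sqrt delta)^-1) (sderiv f).

Let cstc (c : R) : continuous (fun _ : R * R => c).
Proof. by apply: contT => w; exact: cont_cst. Qed.

Let fs' := smooth_datum_sderiv fs.

Lemma wave_Ck k delta : Ck k setT (wave delta).
Proof. exact: superpos_Ck. Qed.

Lemma wave_box delta p : box (wave delta) p = 0.
Proof. exact: superpos_box. Qed.

Lemma phase_event (t r l : R) (x : 'rV[R]_3) w :
  l * lin_form (pv w) (event t (r *: x)) =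
  l * t + l * r * (om1 w * x 0 j0 + om2 w * x 0 j1 + om3 w * x 0 j2).
Proof. by rewrite event_ev plane_phase !mxE; ring. Qed.

Lemma affine_om_continuous (a k n1 n2 n3 : R) :
  continuous (fun w => a + k * (om1 w * n1 + om2 w * n2 + om3 w * n3)).
Proof. by apply: contT => w; rewrite /om1 /om2 /om3; repeat cont_step. Qed.

(* The weight 2 / (1 + s^2) dominates the indicator function of (0, 1). *)
Lemma sph_avg_dominated (F : R * R -> R) (e a k n1 n2 n3 : R) :
  continuous F -> 0 <= e -> 0 < k -> n1 ^+ 2 + n2 ^+ 2 + n3 ^+ 2 = 1 ->
  (forall w, let s := a + k * (om1 w * n1 + om2 w * n2 + om3 w * n3) in
    `|F w| <= e /\ (~ (0 < s < 1) -> F w = 0)) ->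
  `|sph_avg F| <= e * pi / k.
Proof.
move=> Fc e0 k0 n123 FP.
pose s w := a + k * (om1 w * n1 + om2 w * n2 + om3 w * n3).
have lc : continuous (fun w => lorentz (s w)).
  apply: contT => w; apply: (cont_comp (g := lorentz)); last exact: lorentz_continuous.
  exact: affine_om_continuous.
have gc : continuous (fun w => e * 2 * lorentz (s w)).
  by apply: contT => w; apply: cont_mul; [exact: cont_cst|exact: lc].
apply: (@le_trans _ _ (sph_avg (fun w => e * 2 * lorentz (s w)))).
  apply: (pos_fun_norm sph_avg_positive) => // w _.
  have [Fe F0] := FP w; rewrite -/(s w) in F0.
  have [s01|s01] := pselect (0 < s w < 1).
    by rewrite (le_trans Fe)// -mulrA ler_peMr// lorentz_ge.
  by rewrite F0// normr0 !mulr_ge0// ltW// lorentz_gt0.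
rewrite (pos_funZ sph_avg_positive)//.
have H := sph_avg_lorentz a k0 n123.
apply: le_trans (ler_wpM2l _ H) _; first by rewrite mulr_ge0.
rewrite le_eqVlt; apply/orP; left; apply/eqP; field.
by rewrite gt_eqF.
Qed.

Lemma wave_bound : exists2 C : R, 0 <= C & forall delta p, 0 < delta ->
  tcoord p <= -1 -> `|wave delta p| <= C * Num.sqrt delta.
Proof.
have [B B0 BP] := smooth_datum_bounded fs'.
exists (2 * pi * B); first by rewrite !mulr_ge0// pi_ge0.
move=> delta p d0 pt.
have sd0 : 0 < Num.sqrt delta by rewrite sqrtr_gt0.
set t := tcoord p in pt; set x := xcoord p; set r := euclidean_norm x.
have r0 : 0 <= r by exact: euclidean_norm_ge0.
have l0 : 0 < (2 * delta)^-1 by rewrite invr_gt0 mulr_gt0.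
rewrite /wave /superpos.
have Ic : continuous (fun w => (Num.sqrt delta)^-1 *
    sderiv f ((2 * delta)^-1 * lin_form (pv w) p) (omv w)).
  exact: superpos_slice_continuous.
(* Near the axis no plane wave is active: for [r <= 1] and [t <= -1] the phase is at most
   [t + r <= 0], where the profile vanishes. This removes the case of small [r], in which the band
   estimate is useless. *)
have [r1|r1] := leP r 1.
  have -> : (fun w => (Num.sqrt delta)^-1 *
    sderiv f ((2 * delta)^-1 * lin_form (pv w) p) (omv w)) = fun=> 0.
    apply/funext => w; rewrite (smooth_datum_out fs') ?mulr0//; first exact: omv_sphere.
    apply/negP; rewrite negb_and -leNgt; apply/orP; left.
    rewrite pmulr_rle0// -(event_eta p) event_ev plane_phase -/t -/x.
    have := @cauchy_schwarz3 R (x 0 j0) (x 0 j1) (x 0 j2) (om1 w) (om2 w) (om3 w) r 1 r0 ler01.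
    rewrite expr1n -euclidean_norm_sqr om_norm -/r => /(_ erefl erefl).
    by move: pt r1; clear; lra.
  by rewrite (pos_fun0 sph_avg_positive) normr0 !mulr_ge0// ?pi_ge0// ltW.
have r0' : 0 < r := lt_trans ltr01 r1.
have xE : x = r *: (r^-1 *: x) by rewrite scalerA mulfV ?scale1r// gt_eqF.
have /sphere2P nx : sphere2 (r^-1 *: x) by exact: sphere2_normalize.
have k0 : 0 < (2 * delta)^-1 * r by rewrite mulr_gt0.
have e0 : 0 <= (Num.sqrt delta)^-1 * B by rewrite mulr_ge0// invr_ge0 ltW.
apply: le_trans (sph_avg_dominated (a := (2 * delta)^-1 * t) Ic e0 k0 nx _) _.
  move=> w /=; rewrite -phase_event -xE (event_eta p); split.
    rewrite normrM gtr0_norm ?invr_gt0// ler_wpM2l ?invr_ge0 ?(ltW sd0)//.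
    by apply: BP; exact: omv_sphere.
  by move=> s01; rewrite (smooth_datum_out fs') ?mulr0//; exact: omv_sphere.
(* The band estimate with [k = r / (2 delta)] gains a factor [delta] against the amplitude
   [1 / sqrt delta], and [r > 1] finishes. *)
rewrite (_ : _ / _ = 2 * pi * B * Num.sqrt delta / r).
  rewrite ler_pdivrMr// -[leLHS]mulr1 ler_wpM2l//; last exact: ltW.
  by rewrite !mulr_ge0// ?pi_ge0// ltW.
have sdE : Num.sqrt delta ^+ 2 = delta by rewrite sqr_sqrtr// ltW.
have aux (D s q : R) : s ^+ 2 = D -> 0 < s -> 0 < q ->
    s^-1 * B * pi / ((2 * D)^-1 * q) = 2 * pi * B * s / q.
  by move=> <- s0 q0; field; rewrite !gt_eqF.
exact: aux.
Qed.

Lemma wave_radiation delta : 0 < delta ->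
  has_radiation_field delta (wave delta)
    (fun ub w => Num.sqrt delta * f (ub / delta) w).
Proof.
move=> d0 a e e0; set sd := Num.sqrt delta.
have sd0 : 0 < sd by rewrite sqrtr_gt0.
have sdE : sd ^+ 2 = delta by rewrite sqr_sqrtr// ltW.
have [B B0 BP] := smooth_datum_bounded fs.
have pi0 : 0 < pi :> R by exact: pi_gt0.
(* Chosen so that [4 * sd * (e1 * pi) = e / 4], as the final error estimate demands. *)
pose e1 := e / (16 * pi * sd).
have e10 : 0 < e1 by rewrite divr_gt0// !mulr_gt0.
have [eta eta0 etaP] := smooth_datum_unif fs' e10.
pose A := `|a| + delta.
have A0 : 0 <= A by rewrite addr_ge0// ltW.
have eta2 : 0 < eta ^+ 2 by rewrite exprn_gt0.
have M1 : 0 <= 8 * delta / eta ^+ 2 by rewrite divr_ge0 ?mulr_ge0// ltW.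
have M2 : 0 <= 8 * sd * B * A / e by rewrite divr_ge0 ?(ltW e0)// !mulr_ge0// ltW.
(* The part [2 * A + 1] makes [u] negative and [- u <= 2 * r]; the next term gives
   [4 * delta <= r * eta ^+ 2], which confines active directions to the [eta]-cap about [w]; the
   last controls the main term. *)
exists (- (2 * A + 1 + 8 * delta / eta ^+ 2 + 8 * sd * B * A / e)); split.
  exact: num_real.
move=> u /= uM ub w /andP[aub ubd] sw.
have ubA : `|ub| <= A.
  rewrite ler_norml /A; apply/andP; split; last by rewrite (le_trans ubd)// lerDr.
  have := ler_norm (- a); rewrite normrN; move: aub d0; clear; lra.
have [ubA1 ubA2] : - A <= ub /\ ub <= A by move: ubA; rewrite ler_norml => /andP[].
have u0 : u < 0 by move: uM M1 M2 A0; clear; lra.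
pose r := ub - u.
have r0 : 0 < r by rewrite /r; move: uM M1 M2 A0 ubA1; clear; lra.
have ur : - u <= 2 * r by rewrite /r; move: uM M1 M2 A0 ubA1; clear; lra.
have rM1 : 8 * delta / eta ^+ 2 <= 2 * r by rewrite /r; move: uM M1 M2 A0 ubA1; clear; lra.
have rM2 : 8 * sd * B * A / e <= 2 * r by rewrite /r; move: uM M1 M2 A0 ubA1; clear; lra.
have reta : 4 * delta <= r * eta ^+ 2.
  by move: rM1; rewrite ler_pdivrMr//; clear; lra.
pose l := (2 * delta)^-1.
have l0 : 0 < l by rewrite invr_gt0 mulr_gt0.
pose k := l * r; have k0 : 0 < k by rewrite mulr_gt0.
pose dot w' := om1 w' * w 0 j0 + om2 w' * w 0 j1 + om3 w' * w 0 j2.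
pose sg w' := l * (u + ub) + k * dot w'.
have sgc : continuous sg by exact: affine_om_continuous.
pose G0 w' := sderiv f (sg w') (omv w').
pose G1 w' := sderiv f (sg w') w.
have G0c : continuous G0.
  apply: contT => w'.
  by apply: (smooth_datum_continuous fs') => //; exact: sgc.
have fs2 := smooth_datum_sderiv fs'.
have fs3 := smooth_datum_sderiv fs2.
have G1c : continuous G1.
  apply: contT => w'; apply: (cont_comp (g := (sderiv f)^~ w)); first exact: sgc.
  exact: der_continuous (smooth_datum_derive _ fs' sw).
have waveE : wave delta (null_polar u ub w) = sd^-1 * sph_avg G0.
  rewrite /wave /superpos -(pos_funZ sph_avg_positive _ G0c); congr sph_avg.
  by apply/funext => w'; rewrite /null_polar phase_event.
(* The phase ranges from [u / delta] to [ub / delta], so the hat-box formula gives an increment of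
   [f] between these, and [f] vanishes at the negative end. *)
have G1E : sph_avg G1 = f (ub / delta) w * delta / r.
  have /sphere2P nw := sw.
  have G3c : continuous ((sderiv (sderiv (sderiv f)))^~ w).
    apply: contT => s; exact: der_continuous (smooth_datum_derive s fs3 sw).
  have -> := sph_avg_affine (l * (u + ub)) k0 nw
    (fun s => smooth_datum_derive s fs sw) (fun s => smooth_datum_derive s fs' sw)
    (fun s => smooth_datum_derive s fs2 sw) G3c.
  have -> : l * (u + ub) + k = ub / delta by rewrite /k /r /l; field; rewrite gt_eqF.
  have -> : l * (u + ub) - k = u / delta by rewrite /k /r /l; field; rewrite gt_eqF.
  rewrite (smooth_datum_out fs sw (s := u / delta)); last first.
    by rewrite pmulr_lgt0 ?invr_gt0// ltNge (ltW u0).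
  rewrite subr0 /k /l; field.
  by rewrite !gt_eqF.
have EE : `|sph_avg (fun w' => G0 w' - G1 w')| <= e1 * pi / k.
  have /sphere2P nw := sw.
  apply: (sph_avg_dominated (a := l * (u + ub)) _ (ltW e10) k0 nw).
    by apply: contT => w'; apply: cont_sub; [exact: G0c|exact: G1c].
  move=> w' /=; rewrite -/(dot w') -/(sg w').
  have z : ~ (0 < sg w' < 1) -> G0 w' = 0 /\ G1 w' = 0.
    by move=> s01; rewrite /G0 /G1 !(smooth_datum_out fs')//; exact: omv_sphere.
  split; last by move=> /z[-> ->]; rewrite subrr.
  (* Outside the cap the phase is nonpositive: up to the factor [2 * delta] it is
     [2 ub - r (1 - dot)], where [2 ub <= 2 delta] and [r (1 - dot) = r |om - w|^2 / 2 >= 2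
     delta]. *)
  have [near_w|far_w] := ltP `|omv w' - w| eta.
    by apply: etaP => //; exact: omv_sphere.
  suff /z[-> ->] : ~ (0 < sg w' < 1) by rewrite subrr normr0 ltW.
  apply/negP; rewrite negb_and -leNgt; apply/orP; left.
  have : eta ^+ 2 <= euclidean_norm (omv w' - w) ^+ 2.
    rewrite ler_pXn2r// ?nnegrE ?euclidean_norm_ge0 ?(ltW eta0)//.
    exact: le_trans far_w (norm_le_euclidean _).
  rewrite (sphere2_dist (omv_sphere _) sw); have [-> -> ->] := omvE w'.
  rewrite -/(dot w') => dw.
  rewrite /sg /k -mulrA -mulrDr pmulr_rle0//.
  have : r * eta ^+ 2 <= r * (2 - 2 * dot w') by rewrite ler_pM2l.
  move: reta ubd; rewrite /r; move: (dot w') => q; clear; lra.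
rewrite waveE.
have -> : sph_avg G0 = f (ub / delta) w * delta / r + sph_avg (fun w' => G0 w' - G1 w').
  by rewrite (pos_funB sph_avg_positive)// G1E addrC subrK.
apply: (@radiation_error R u ub r sd delta (f (ub / delta) w) _ e B A (e1 * pi)) => //.
- exact: BP.
- have -> : 2 * delta * (e1 * pi) = e1 * pi / k * r by rewrite /k /l; field; rewrite !gt_eqF.
  by rewrite ler_pM2r.
- have aux (q : R) : 0 < q -> 4 * sd * (e / (16 * q * sd) * q) = e / 4.
    by move=> q0; field; rewrite !gt_eqF.
  by rewrite (aux _ pi0).
Qed.

End Solution.

(** * Composition with a function of one variable *)

Section Composition.
Context {R : realType} {n : nat}.
Variables (U : set 'rV[R]_n) (f : 'rV[R]_n -> R) (S S1 S2 : R -> R).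
Hypotheses (oU : open U) (fC : Ck 2 U f).
Hypothesis dS : forall p, U p -> is_derive (f p) 1 S (S1 (f p)).
Hypothesis dS1 : forall p, U p -> is_derive (f p) 1 S1 (S2 (f p)).
Hypothesis S2c : forall p, U p -> {for f p, continuous S2}.

Let line_der i p : U p ->
  is_derive (0 : R) 1 (fun h : R => f (h *: delta_mx 0 i + p)) (partial i f p).
Proof. by move=> Up; apply: (is_derive_dirP _ _ _ _).1; exact: Ck_is_derive fC Up. Qed.

Let line_der2 i j p : U p ->
  is_derive (0 : R) 1 (fun h : R => partial i f (h *: delta_mx 0 j + p)) (partial j (partial i f) p).
Proof.
move=> Up; apply: (is_derive_dirP _ _ _ _).1.
exact: Ck_is_derive (Ck_partial i fC) Up.
Qed.

Lemma comp_is_derive i p : U p ->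
  is_derive p (delta_mx 0 i) (fun q => S (f q)) (S1 (f p) * partial i f p).
Proof.
move=> Up; apply: (is_derive_dirP _ _ _ _).2.
notypeclasses refine (der_comp _ _); last exact: line_der.
by rewrite scale0r add0r; exact: dS.
Qed.

Lemma comp_is_derive2 i j p : U p ->
  is_derive p (delta_mx 0 j) (fun q => S1 (f q) * partial i f q)
    (S2 (f p) * partial j f p * partial i f p + S1 (f p) * partial j (partial i f) p).
Proof.
move=> Up; apply: (is_derive_dirP _ _ _ _).2.
have H1 : is_derive (0 : R) 1 (fun h : R => S1 (f (h *: delta_mx 0 j + p)))
    (S2 (f p) * partial j f p).
  notypeclasses refine (der_comp _ _); last exact: line_der.
  by rewrite scale0r add0r; exact: dS1.
notypeclasses refine (der_eq (ex_intro2 _ _ _ (der_mul H1 (line_der2 i j Up)) _)).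
by rewrite /= scale0r add0r.
Qed.

Lemma comp_Ck2 : Ck 2 U (fun q => S (f q)).
Proof.
have fc p : U p -> {for p, continuous f} by move=> Up; exact: Ck_continuous fC Up.
have f1c i p : U p -> {for p, continuous (partial i f)}.
  by move=> Up; exact: Ck_continuous (Ck_partial i fC) Up.
have f2c i j p : U p -> {for p, continuous (partial j (partial i f))}.
  by move=> Up; exact: Ck_continuous (Ck_partial j (Ck_partial i fC)) Up.
have S1c p : U p -> {for p, continuous (fun q => S1 (f q))}.
  move=> Up; apply: (cont_comp (g := S1)); first exact: fc.
  exact: der_continuous (dS1 Up).
apply: (Ck_S (g := fun i q => S1 (f q) * partial i f q)) => //.
- move=> p Up; apply: (cont_comp (g := S)); first exact: fc.
  exact: der_continuous (dS Up).
- exact: comp_is_derive.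
move=> i; apply: (Ck_S (g := fun j q => S2 (f q) * partial j f q * partial i f q +
    S1 (f q) * partial j (partial i f) q)) => //.
- by move=> p Up; apply: cont_mul; [exact: S1c|exact: f1c].
- by move=> j p Up; exact: comp_is_derive2.
move=> j; split=> // p Up; apply: cont_add.
  apply: cont_mul; last exact: f1c.
  apply: cont_mul; last exact: f1c.
  by apply: (cont_comp (g := S2)); [exact: fc|exact: S2c].
by apply: cont_mul; [exact: S1c|exact: f2c].
Qed.

Lemma comp_partial i p : U p ->
  partial i (fun q => S (f q)) p = S1 (f p) * partial i f p.
Proof. by move=> Up; exact: @derive_val _ _ _ _ _ _ _ (comp_is_derive i Up). Qed.

Lemma comp_partial2 i p : U p ->
  partial i (partial i (fun q => S (f q))) p =
  S2 (f p) * partial i f p ^+ 2 + S1 (f p) * partial i (partial i f) p.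
Proof.
move=> Up; rewrite (eq_partial i oU (comp_partial i) Up) expr2 mulrA.
exact: @derive_val _ _ _ _ _ _ _ (comp_is_derive2 i i Up).
Qed.

End Composition.

(** The gradient term is where a null form is absorbed or created: [S2 = - c S1] cancels it for a
    solution of the nonlinear equation, and [S2 = c S1^2] produces it from a solution of the wave
    equation. *)
Lemma box_comp (R : realType) (U : set 'rV[R]_(1 + 3)) (f : 'rV[R]_(1 + 3) -> R)
    (S S1 S2 : R -> R) p :
  open U -> Ck 2 U f ->
  (forall p, U p -> is_derive (f p) 1 S (S1 (f p))) ->
  (forall p, U p -> is_derive (f p) 1 S1 (S2 (f p))) -> U p ->
  box (fun q => S (f q)) p =
  S2 (f p) * (\sum_(a < 1 + 3) metric_sign a * partial a f p ^+ 2) + S1 (f p) * box f p.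
Proof.
move=> oU fC dS dS1 Up.
rewrite /box !mulr_sumr -big_split; apply: eq_bigr => a _.
by rewrite (comp_partial2 oU fC dS dS1)// mulrDr !mulrA !(mulrC (metric_sign a)).
Qed.

(** Nine null vectors suffice. The vectors [(1, e_i)] and [(1, - e_i)] give the diagonal and kill
    the symmetrized time-space coefficients; the Pythagorean triple 3, 4, 5 then kills the
    symmetrized space-space ones without square roots. *)
Lemma null_form_metric (R : realType) (Q : 'M[R]_(1 + 3)) : null_form Q ->
  exists c : R, forall xi, Defs.form Q xi xi =
    c * \sum_(a < 1 + 3) metric_sign a * xi 0 a ^+ 2.
Proof.
move=> Q0; exists (- Q ord0 ord0) => xi.
have formE x : Defs.form Q x x =
    Q ord0 ord0 * x 0 ord0 ^+ 2 + Q ix1 ix1 * x 0 ix1 ^+ 2 + Q ix2 ix2 * x 0 ix2 ^+ 2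
    + Q ix3 ix3 * x 0 ix3 ^+ 2 + (Q ord0 ix1 + Q ix1 ord0) * (x 0 ord0 * x 0 ix1)
    + (Q ord0 ix2 + Q ix2 ord0) * (x 0 ord0 * x 0 ix2)
    + (Q ord0 ix3 + Q ix3 ord0) * (x 0 ord0 * x 0 ix3)
    + (Q ix1 ix2 + Q ix2 ix1) * (x 0 ix1 * x 0 ix2)
    + (Q ix1 ix3 + Q ix3 ix1) * (x 0 ix1 * x 0 ix3)
    + (Q ix2 ix3 + Q ix3 ix2) * (x 0 ix2 * x 0 ix3).
  rewrite /Defs.form sum4 !sum4.
  move: (x 0 ord0) (x 0 ix1) (x 0 ix2) (x 0 ix3) => a b c d.
  move: (Q ord0 ord0) (Q ord0 ix1) (Q ord0 ix2) (Q ord0 ix3).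
  move: (Q ix1 ord0) (Q ix1 ix1) (Q ix1 ix2) (Q ix1 ix3).
  move: (Q ix2 ord0) (Q ix2 ix1) (Q ix2 ix2) (Q ix2 ix3).
  move: (Q ix3 ord0) (Q ix3 ix1) (Q ix3 ix2) (Q ix3 ix3).
  by clear=> *; ring.
have test (t x y z : R) : x ^+ 2 + y ^+ 2 + z ^+ 2 = t ^+ 2 -> Defs.form Q (ev t x y z) (ev t x y z) = 0.
  move=> txyz; apply: Q0.
  by rewrite /null_vector sum_metric ev0 ev1 ev2 ev3 -txyz; ring.
rewrite sum_metric formE.
have := test 5 0 3 4; have := test 5 3 0 4; have := test 5 3 4 0.
have := test 1 0 0 (-1); have := test 1 0 (-1) 0; have := test 1 (-1) 0 0.
have := test 1 0 0 1; have := test 1 0 1 0; have := test 1 1 0 0.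
rewrite !formE !(ev0, ev1, ev2, ev3).
move: (xi 0 ord0) (xi 0 ix1) (xi 0 ix2) (xi 0 ix3) => a b c d.
move: (Q ord0 ord0) (Q ix1 ix1) (Q ix2 ix2) (Q ix3 ix3) => q0 q1 q2 q3.
move: (Q ord0 ix1 + Q ix1 ord0) (Q ord0 ix2 + Q ix2 ord0) (Q ord0 ix3 + Q ix3 ord0) => r1 r2 r3.
move: (Q ix1 ix2 + Q ix2 ix1) (Q ix1 ix3 + Q ix3 ix1) (Q ix2 ix3 + Q ix3 ix2) => s1 s2 s3.
clear => H1 H2 H3 H4 H5 H6 H7 H8 H9.
have {}H1 := H1 ltac:(by ring). have {}H2 := H2 ltac:(by ring). have {}H3 := H3 ltac:(by ring).
have {}H4 := H4 ltac:(by ring). have {}H5 := H5 ltac:(by ring). have {}H6 := H6 ltac:(by ring).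
have {}H7 := H7 ltac:(by ring). have {}H8 := H8 ltac:(by ring). have {}H9 := H9 ltac:(by ring).
have -> : r1 = 0 by lra.
have -> : r2 = 0 by lra.
have -> : r3 = 0 by lra.
have -> : s1 = 0 by lra.
have -> : s2 = 0 by lra.
have -> : s3 = 0 by lra.
have -> : q1 = - q0 by lra.
have -> : q2 = - q0 by lra.
have -> : q3 = - q0 by lra.
by ring.
Qed.

(** * Nirenberg's substitution *)

Section NirenbergTransform.
Context {R : realType}.
Variable c : R.

(** The solution of [S'' = - c S'] with [S 0 = 0] and [S' 0 = 1]; the case [c = 0] is separate
    because of the division. *)
Definition nirenberg (y : R) : R := if c == 0 then y else (1 - expR (- (c * y))) / c.

(** An inverse only where [c * y < 1]; beyond that [ln] has a default value. There its derivatives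
    satisfy [S'' = c S'^2]. *)
Definition nirenberg_inv (y : R) : R := if c == 0 then y else - ln (1 - c * y) / c.

Lemma nirenberg_derive1 (y : R) :
  is_derive y 1 (fun s : R => expR (- (c * s))) (- c * expR (- (c * y))).
Proof.
notypeclasses refine (der_eq (ex_intro2 _ _ _ (der_comp (is_derive_expR _) _) _)).
- by der_step; der_step.
- by rewrite mul0r add0r mulr1 mulrC.
Qed.

Lemma nirenberg_derive (y : R) : is_derive y 1 nirenberg (expR (- (c * y))).
Proof.
have [c0|c0] := eqVneq c 0.
  have -> : nirenberg = id by apply/funext => s; rewrite /nirenberg c0 eqxx.
  by rewrite c0 mul0r oppr0 expR0; exact: der_id.
have -> : nirenberg = fun s => (1 - expR (- (c * s))) * c^-1.
  by apply/funext => s; rewrite /nirenberg (negbTE c0).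
der; first exact: nirenberg_derive1.
by move: (expR _) => q; field.
Qed.

(** Injectivity on all of [R] carries uniqueness back from the wave equation to solutions of
    arbitrary size. *)
Lemma nirenberg_inj : injective nirenberg.
Proof.
rewrite /nirenberg; have [_|c0] := eqVneq c 0; first by [].
move=> x y /(mulIf _) H; have {H} := H ltac:(by rewrite invr_eq0).
by move=> /addrI /oppr_inj /expR_inj /oppr_inj /(mulfI c0).
Qed.

Lemma nirenberg0 : nirenberg 0 = 0.
Proof. by rewrite /nirenberg mulr0 oppr0 expR0 subrr mul0r if_same. Qed.

Lemma nirenberg_inv0 : nirenberg_inv 0 = 0.
Proof. by rewrite /nirenberg_inv mulr0 subr0 ln1 oppr0 mul0r if_same. Qed.

Lemma nirenberg_invK (y : R) : c * y < 1 -> nirenberg (nirenberg_inv y) = y.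
Proof.
rewrite /nirenberg /nirenberg_inv; have [//|c0] := eqVneq c 0 => cy.
have -> : - (c * (- ln (1 - c * y) / c)) = ln (1 - c * y) by field.
by rewrite lnK ?posrE ?subr_gt0//; field.
Qed.

Lemma nirenberg_inv_derive (y : R) : c * y < 1 ->
  is_derive y 1 nirenberg_inv (1 - c * y)^-1.
Proof.
move=> cy; have [c0|c0] := eqVneq c 0.
  have -> : nirenberg_inv = id by apply/funext => s; rewrite /nirenberg_inv c0 eqxx.
  by rewrite c0 mul0r subr0 invr1; exact: der_id.
have -> : nirenberg_inv = fun s => - ln (1 - c * s) * c^-1.
  by apply/funext => s; rewrite /nirenberg_inv (negbTE c0).
have cy0 : 0 < 1 - c * y by rewrite subr_gt0.
der.
  notypeclasses refine (der_comp (g := fun s : R => 1 - c * s) (is_derive1_ln cy0) _).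
  by repeat der_step.
by move: (ln _) => q; rewrite /=; field; rewrite c0 gt_eqF.
Qed.

Lemma nirenberg_inv_derive1 (y : R) : c * y < 1 ->
  is_derive y 1 (fun s : R => (1 - c * s)^-1) (c * (1 - c * y)^-1 ^+ 2).
Proof.
move=> cy; have cy0 : 1 - c * y != 0 by rewrite gt_eqF// subr_gt0.
have H : is_derive y 1 (fun s : R => 1 - c * s) (- c).
  by der; ring.
notypeclasses refine (der_eq (ex_intro2 _ _ _ (@is_deriveV _ (fun s : R => 1 - c * s) _ _ _ cy0 H) _)).
by rewrite /GRing.scale/=; field.
Qed.

End NirenbergTransform.

(** * Differences and substitutions of radiation fields *)

Section RadiationField.
Context {R : realType}.
Implicit Types (phi psi : 'rV[R]_(1 + 3) -> R) (f g : R -> 'rV[R]_3 -> R).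

Lemma has_radiation_field_sub (delta : R) phi psi f g :
  has_radiation_field delta phi f -> has_radiation_field delta psi g ->
  has_radiation_field delta (fun p => phi p - psi p) (fun ub w => f ub w - g ub w).
Proof.
move=> pf pg a e e0.
have e2 : 0 < e / 2 by rewrite divr_gt0.
have [M [_ HM]] := pf a _ e2; have [N [_ HN]] := pg a _ e2.
exists (Order.min M N); split; first exact: num_real.
move=> u; rewrite lt_min => /andP[uM uN] ub w abd sw.
have := ltrD (HM u uM ub w abd sw) (HN u uN ub w abd sw).
rewrite -splitr; apply: le_lt_trans.
apply: le_trans (ler_normB _ _); rewrite le_eqVlt; apply/orP; left; apply/eqP.
by congr `| _ |; ring.
Qed.

(** Convergence with error 1 gives [|u| |phi| <= |B| + 1]; hence [|phi| < eta] once [|u|] exceeds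
    [(|B| + 1) / eta], and the deviation of [S] from the identity, relative to [|phi|], contributes
    at most [e / 2] after multiplication by [|u|]. *)
Lemma has_radiation_field_comp (delta B : R) phi f (S : R -> R) :
  (forall ub w, ub <= delta -> sphere2 w -> `|f ub w| <= B) ->
  S 0 = 0 -> is_derive (0 : R) 1 S 1 ->
  has_radiation_field delta phi f -> has_radiation_field delta (fun p => S (phi p)) f.
Proof.
move=> fB S0 dS pf a e e0.
have e2 : 0 < e / 2 by rewrite divr_gt0.
have B1 : 0 < `|B| + 1 by rewrite ltr_wpDl.
have e3 : 0 < e / 2 / (`|B| + 1) by rewrite divr_gt0.
have [eta eta0 etaP] := derive_near_id S0 dS e3.
have [M [_ HM]] := pf a _ e2; have [N [_ HN]] := pf a _ ltr01.
exists (Order.min (Order.min M N) (- ((`|B| + 1) / eta))); split; first exact: num_real.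
move=> u; rewrite !lt_min => /andP[/andP[uM uN] uB] ub w abd sw.
have {HM} HM := HM u uM ub w abd sw; have {HN} HN := HN u uN ub w abd sw.
have {fB} fB : `|f ub w| <= B by apply: fB => //; case/andP: abd.
have uB' : (`|B| + 1) / eta < `|u|.
  by rewrite -[`|u|]normrN; apply: lt_le_trans (ler_norm _); rewrite ltrNr.
have u0 : 0 < `|u| by apply: lt_trans uB'; rewrite divr_gt0.
set y := phi _ in HM HN *.
have yB : `|u| * `|y| <= `|B| + 1.
  rewrite -[X in X * _ <= _]normr_id -normrM.
  have -> : `|u| * y = f ub w + (`|u| * y - f ub w) by rewrite addrC subrK.
  apply: le_trans (ler_normD _ _) _; apply: lerD; last exact: ltW.
  exact: le_trans fB (ler_norm _).
have yeta : `|y| < eta.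
  rewrite -(ltr_pM2l u0) (le_lt_trans yB)// mulrC -ltr_pdivrMl//.
  by rewrite mulrC.
have -> : `|u| * S y - f ub w = `|u| * (S y - y) + (`|u| * y - f ub w) by ring.
apply: le_lt_trans (ler_normD _ _) _; rewrite [ltRHS](splitr e).
apply: ler_ltD => //; rewrite normrM normr_id.
apply: (@le_trans _ _ (`|u| * (e / 2 / (`|B| + 1) * `|y|))).
  by rewrite ler_wpM2l// etaP.
rewrite mulrCA; apply: (@le_trans _ _ (e / 2 / (`|B| + 1) * (`|B| + 1))).
  by rewrite ler_wpM2l// ltW.
by rewrite divfK// gt_eqF.
Qed.

End RadiationField.

(** * Local character of the equation and its two substitutions *)

Section LocalProperties.
Context {R : realType}.

Lemma Ck_local n k (U : set 'rV[R]_n) (f : 'rV[R]_n -> R) :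
  (forall p, U p -> exists V : set 'rV[R]_n, V p /\ Ck k V f) -> Ck k U f.
Proof.
elim: k f => [|k IH] f loc; split=> //.
- by move=> p /loc[V [Vp fC]]; exact: Ck_continuous fC Vp.
- by move=> p /loc[V [Vp fC]]; exact: Ck_continuous fC Vp.
move=> i; split; first by move=> p /loc[V [Vp fC]]; exact: Ck_derivable fC Vp.
by apply: IH => p /loc[V [Vp fC]]; exists V; split=> //; exact: Ck_partial fC.
Qed.

Lemma Ck_sub n k (U : set 'rV[R]_n) (f g : 'rV[R]_n -> R) : open U ->
  Ck k U f -> Ck k U g -> Ck k U (fun p => f p - g p).
Proof.
move=> oU; elim: k f g => [|k IH] f g fC gC.
  by split=> // p Up; apply: cont_sub; [exact: Ck_continuous fC Up|exact: Ck_continuous gC Up].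
apply: (Ck_S (g := fun i p => partial i f p - partial i g p)) => //.
- by move=> p Up; apply: cont_sub; [exact: Ck_continuous fC Up|exact: Ck_continuous gC Up].
- by move=> i p Up; exact: is_deriveB (Ck_is_derive i fC Up) (Ck_is_derive i gC Up).
by move=> i; apply: IH; exact: Ck_partial.
Qed.

Lemma partial_sub n k (U : set 'rV[R]_n) (f g : 'rV[R]_n -> R) i p :
  Ck k.+1 U f -> Ck k.+1 U g -> U p ->
  partial i (fun p => f p - g p) p = partial i f p - partial i g p.
Proof.
move=> fC gC Up.
have H : is_derive p (delta_mx 0 i) (fun p => f p - g p) (partial i f p - partial i g p).
  exact: is_deriveB (Ck_is_derive i fC Up) (Ck_is_derive i gC Up).
exact: @derive_val _ _ _ _ _ _ _ H.
Qed.

Lemma box_sub (U : set 'rV[R]_(1 + 3)) (f g : 'rV[R]_(1 + 3) -> R) p : open U ->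
  Ck 2 U f -> Ck 2 U g -> U p -> box (fun p => f p - g p) p = box f p - box g p.
Proof.
move=> oU fC gC Up; rewrite /box -sumrB; apply: eq_bigr => a _.
rewrite -mulrBr; congr (_ * _).
rewrite (eq_partial (g := fun p => partial a f p - partial a g p) a oU _ Up).
  exact: partial_sub (Ck_partial a fC) (Ck_partial a gC) Up.
by move=> q Uq; exact: partial_sub fC gC Uq.
Qed.

Lemma eq_box (U : set 'rV[R]_(1 + 3)) (f g : 'rV[R]_(1 + 3) -> R) p : open U ->
  (forall q, U q -> f q = g q) -> U p -> box f p = box g p.
Proof.
move=> oU fg Up; rewrite /box; apply: eq_bigr => a _.
have E q : U q -> partial a f q = partial a g q by move=> Uq; exact: eq_partial fg Uq.
by rewrite (eq_partial a oU E Up).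
Qed.

(** On an open subset of [X] each local extension agrees with [phi] near the point, so its
    derivatives are those of [phi] itself. *)
Lemma classical_solution_open (Q : 'M[R]_(1 + 3)) (X U : set 'rV[R]_(1 + 3)) phi :
  open U -> U `<=` X -> classical_solution Q X phi ->
  Ck 2 U phi /\
  forall p, U p -> box phi p = Defs.form Q (gradient phi p) (gradient phi p).
Proof.
move=> oU UX sol; split.
  apply: Ck_local => p Up; have [V [F [oV Vp FC phiF _]]] := sol _ (UX _ Up).
  have oVU : open (V `&` U) by exact: openI.
  exists (V `&` U); split=> //; apply: (eq_Ck (f := F)) => //.
    by move=> q [Vq Uq]; rewrite phiF//; exact: UX.
  by apply: Ck_subset FC => q [].
move=> p Up; have [V [F [oV Vp FC phiF Feq]]] := sol _ (UX _ Up).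
have oVU : open (V `&` U) by exact: openI.
have FE q : (V `&` U) q -> F q = phi q by move=> [Vq Uq]; rewrite phiF//; exact: UX.
have VUp : (V `&` U) p by [].
rewrite -(eq_box oVU FE VUp) Feq//; last exact: UX.
suff -> : gradient F p = gradient phi p by [].
by apply/rowP => i; rewrite !mxE; exact: eq_partial FE VUp.
Qed.

Lemma nirenberg_box (Q : 'M[R]_(1 + 3)) (c : R) (U : set 'rV[R]_(1 + 3)) phi p :
  (forall xi, Defs.form Q xi xi = c * \sum_(a < 1 + 3) metric_sign a * xi 0 a ^+ 2) ->
  open U -> Ck 2 U phi ->
  box phi p = Defs.form Q (gradient phi p) (gradient phi p) -> U p ->
  box (fun q => nirenberg c (phi q)) p = 0.
Proof.
move=> QE oU phiC phiE Up.
have dT q : U q -> is_derive (phi q) 1 (nirenberg c) (expR (- (c * phi q))).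
  by move=> _; exact: nirenberg_derive.
have dT1 q : U q -> is_derive (phi q) 1 (fun y : R => expR (- (c * y))) (- c * expR (- (c * phi q))).
  by move=> _; exact: nirenberg_derive1.
rewrite (box_comp (S1 := fun y => expR (- (c * y))) (S2 := fun y => - c * expR (- (c * y)))
  oU phiC dT dT1 Up).
rewrite phiE QE.
have -> : \sum_(a < 1 + 3) metric_sign a * gradient phi p 0 a ^+ 2 =
    \sum_(a < 1 + 3) metric_sign a * partial a phi p ^+ 2.
  by apply: eq_bigr => a _; rewrite mxE.
by move: (expR _) (\sum_(a < _) _) => y z; ring.
Qed.

Lemma nirenberg_inv_solution (Q : 'M[R]_(1 + 3)) (c : R) (X : set 'rV[R]_(1 + 3)) w :
  (forall xi, Defs.form Q xi xi = c * \sum_(a < 1 + 3) metric_sign a * xi 0 a ^+ 2) ->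
  Ck 2 setT w -> (forall p, box w p = 0) -> (forall p, X p -> c * w p < 1) ->
  classical_solution Q X (fun p => nirenberg_inv c (w p)).
Proof.
move=> QE wC w0 wX p Xp.
(* A single open set serves every point of [X]: [w] is defined on the whole space, and the
   transformed function is its own extension on [U]. *)
pose U := [set q | c * w q < 1].
have cwc : continuous (fun q => c * w q).
  by apply: contT => q; apply: cont_mul; [exact: cont_cst|exact: Ck_continuous wC _].
have oU : open U.
  by apply: (@open_comp _ _ (fun q => c * w q) [set y | y < 1]); [move=> q _; exact: cwc|exact: open_lt].
have wUC : Ck 2 U w by apply: Ck_subset wC.
pose S1 (y : R) := (1 - c * y)^-1.
pose S2 (y : R) := c * (1 - c * y)^-1 ^+ 2.
have dS q : U q -> is_derive (w q) 1 (nirenberg_inv c) (S1 (w q)).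
  exact: nirenberg_inv_derive.
have dS1 q : U q -> is_derive (w q) 1 S1 (S2 (w q)) by exact: nirenberg_inv_derive1.
exists U, (fun q => nirenberg_inv c (w q)).
have FC : Ck 2 U (fun q => nirenberg_inv c (w q)).
  apply: (comp_Ck2 oU wUC dS dS1) => q Uq.
  have Sc := der_continuous (dS1 q Uq).
  apply: (eq_cont (f := fun y => c * (S1 y * S1 y))).
    by move=> y; rewrite /S2 expr2.
  by apply: cont_mul; [exact: cont_cst|apply: cont_mul].
split; [exact: oU|exact: wX|exact: FC|by []|].
move=> q Uq _; rewrite (box_comp oU wUC dS dS1 Uq) w0 mulr0 addr0 QE.
rewrite /S2 mulr_sumr [RHS]mulr_sumr; apply: eq_bigr => a _.
by rewrite mxE (comp_partial wUC dS)// /S1; move: (partial _ _ _) (_^-1) => y z; ring.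
Qed.

End LocalProperties.

(** * Vanishing radiation field and passage to the boundary *)

Section Uniqueness.
Context {R : realType}.
Variable delta : R.

Let Omega := [set p : 'rV[R]_(1 + 3) | ubar p < delta /\ tcoord p < -1].

Lemma region_interior_open : open Omega.
Proof.
have -> : Omega = (@ubar R @^-1` [set y | y < delta]) `&` (@tcoord R @^-1` [set y | y < -1]).
  by [].
have uc : continuous (@ubar R).
  apply: contT => p; apply: cont_mul; last exact: cont_cst.
  apply: cont_add; first exact: tcoord_continuous.
  apply: (cont_comp (g := @euclidean_norm R 3)); last exact: euclidean_norm_continuous.
  exact: xcoord_continuous.
apply: openI; apply: open_comp; try exact: open_lt.
  by move=> p _; exact: uc.
by move=> p _; exact: tcoord_continuous.
Qed.

(** The backward cone of an interior point stays in the interior, with slack [e] for vertex times up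
    to [t + e] and radii down to [- e]. There [|r| <= r + 2 e], so [t + |x|] grows by less than
    [3 e] and the time by less than [2 e]. *)
Lemma event_region_interior (t s r e : R) (x y : 'rV[R]_3) :
  0 <= e -> euclidean_norm y = 1 -> 3 * e <= 2 * delta - t - euclidean_norm x ->
  2 * e <= -1 - t -> s < t + e -> - e < r -> Omega (event (s - r) (x + r *: y)).
Proof.
move=> e0 y1 e1 e2 st er; rewrite /Omega/= ubar_event tcoord_event.
have : euclidean_norm (x + r *: y) <= euclidean_norm x + `|r|.
  apply: le_trans (euclidean_norm_triangle _ _) _.
  by rewrite euclidean_normZ y1 mulr1.
have : `|r| <= r + 2 * e.
  by rewrite ler_norml; move: er e0; clear; lra.
move: `|r| (euclidean_norm x) (euclidean_norm (x + _)) e1 => q n m e1 qr mn.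
by move: e1 e2 st er qr mn; clear; split; lra.
Qed.

(** Points of the sphere of radius [b] about [x] have distance between [b - |x|] and [b + |x|] from
    the origin. At time [T - b] their [ub] therefore stays in a bounded interval while [u] tends to
    [-oo] with [b]. Each sphere meets all directions and a range of [ub], which is where local
    uniformity of the limit enters. *)
Lemma radiation_field0_vanish v : Ck 2 Omega v ->
  (forall p, Omega p -> box v p = 0) ->
  has_radiation_field delta v (fun _ _ => 0) -> forall p, Omega p -> v p = 0.
Proof.
move=> vC v0 vrad p Op.
set t0 := tcoord p; set x := xcoord p; set n := euclidean_norm x.
have n0 : 0 <= n by exact: euclidean_norm_ge0.
have [tn t1] : t0 + n < 2 * delta /\ t0 < -1.
  by case: Op; rewrite /ubar -/t0 -/x -/n; clear; lra.
pose e := Order.min ((2 * delta - t0 - n) / 3) ((-1 - t0) / 2).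
have e0 : 0 < e by rewrite /e lt_min; move: tn t1; clear; lra.
have [e1 e2] : 3 * e <= 2 * delta - t0 - n /\ 2 * e <= -1 - t0.
  have : e <= (2 * delta - t0 - n) / 3 by rewrite /e ge_min lexx.
  have : e <= (-1 - t0) / 2 by rewrite /e ge_min lexx orbT.
  by clear; lra.
have dom T r w : T < t0 + e -> - e < r ->
    Omega (sph_pt (x 0 j0) (x 0 j1) (x 0 j2) (T - r) r w).
  by move=> Tt er; rewrite sph_pt_event; exact: event_region_interior (ltW e0) (omv_sphere w) e1 e2 Tt er.
rewrite -(event_eta p) event_ev -/t0 -/x.
apply: (decay_vanish (U := Omega) (c := - e) (Tm := t0 + e)) => //.
- exact: region_interior_open.
- by rewrite oppr_lt0.
- by rewrite ltrDl.
move=> e' e'0.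
(* The factor 2 comes from [b <= 2 |u|] below; the left end of the [ub] range is that of
   [T >= t0 - 1] and distance at least [b - n]. *)
have e'2 : 0 < e' / 2 by rewrite divr_gt0.
have [M [_ HM]] := vrad ((t0 - 1 - n) / 2) _ e'2.
exists (n + 1 + `|M|) => b T bM Tl Tu.
have b0 : 0 < b by move: bM n0 (normr_ge0 M); clear; lra.
have Tm : T < t0 + e by move: Tu e0; clear; lra.
have eb : - e < b by move: b0 e0; clear; lra.
have vc : continuous (fun w => b * v (sph_pt (x 0 j0) (x 0 j1) (x 0 j2) (T - b) b w)).
  apply: contT => w; apply: cont_mul; first exact: cont_cst.
  apply: (cont_comp (g := v)); last exact: Ck_continuous vC (dom T b w Tm eb).
  by apply: cont_sph_pt; repeat cont_step.
have vc' : continuous (fun w => v (sph_pt (x 0 j0) (x 0 j1) (x 0 j2) (T - b) b w)).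
  apply: contT => w.
  apply: (cont_comp (g := v)); last exact: Ck_continuous vC (dom T b w Tm eb).
  by apply: cont_sph_pt; repeat cont_step.
rewrite -(pos_funZ sph_avg_positive _ vc').
have -> : e' = sph_avg (fun=> e' : R).
  by rewrite (pos_fun_cst sph_avg_positive) sph_avg1 mulr1.
apply: (pos_fun_norm sph_avg_positive) => //.
  by apply: contT => w; exact: cont_cst.
move=> w _; rewrite sph_pt_event.
set y := x + b *: omv w; set r := euclidean_norm y.
have wn : euclidean_norm (omv w) = 1 by exact: omv_sphere.
have rb : r <= n + b.
  apply: le_trans (euclidean_norm_triangle _ _) _.
  by rewrite euclidean_normZ wn mulr1 gtr0_norm.
have br : b <= r + n.
  have -> : b = euclidean_norm (b *: omv w) by rewrite euclidean_normZ wn mulr1 gtr0_norm.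
  have -> : b *: omv w = y - x by rewrite /y addrC addKr.
  by apply: le_trans (euclidean_norm_triangle _ _) _; rewrite euclidean_normN.
have r0 : 0 < r by move: br bM n0 (normr_ge0 M); clear; lra.
have /(_ _ _ _) := HM ((T - b - r) / 2).
rewrite -(null_polar_eta _ r0) -/r.
set u := (T - b - r) / 2; set q := null_polar _ _ _ => H.
have uM : u < M.
  have := ler_norm (- M); rewrite normrN /u; move: br bM n0 Tu t1; clear; lra.
have ubP : (t0 - 1 - n) / 2 <= (T - b + r) / 2 <= delta.
  by apply/andP; split; move: br rb Tl Tu tn; clear; lra.
have := H uM _ _ ubP (sphere2_normalize r0); rewrite -/q subr0 normrM normr_id => {}H.
rewrite normrM (gtr0_norm b0).
have ub2 : b <= 2 * `|u|.
  have := ler_norm (- u); rewrite normrN /u; move: br Tu t1 bM (normr_ge0 M) n0; clear; lra.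
apply: (@le_trans _ _ (2 * `|u| * `|v q|)); first by rewrite ler_wpM2r.
by move: H; move: `|u| `|v q| => k l; clear; lra.
Qed.

(** Lowering [t] alone lowers both [ubar] and [t], so [g s] is interior for [s > 0] and tends to
    [p]. Continuity at [p] is known only for the local extensions [F] and [G], hence the one-sided
    limit of [F - G]. *)
Lemma classical_solution_closure Q (phi psi : 'rV[R]_(1 + 3) -> R) :
  classical_solution Q (region delta) phi -> classical_solution Q (region delta) psi ->
  (forall p, Omega p -> phi p = psi p) -> forall p, region delta p -> phi p = psi p.
Proof.
move=> phis psis eqO p Xp.
have [U [F [oU Up FC phiF _]]] := phis _ Xp.
have [V [G [oV Vp GC psiG _]]] := psis _ Xp.
pose g (s : R) := event (tcoord p - s) (xcoord p).
have g0 : g 0 = p by rewrite /g subr0 event_eta.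
have gc s : {for s, continuous g}.
  have tc : {for s, continuous (fun s : R => tcoord p - s)}.
    by apply: cont_sub; [exact: cont_cst|exact: cont_id].
  by apply: (event_continuous tc); exact: cst_continuous.
have gO s : 0 < s -> Omega (g s).
  case: Xp; rewrite /Omega/= /g ubar_event tcoord_event /ubar => H1 H2 s0.
  by split; move: H1 H2 s0; move: (euclidean_norm _) => n; clear; lra.
have OX q : Omega q -> region delta q by case=> a b; split; exact: ltW.
pose h s := F (g s) - G (g s).
have hc : {for 0, continuous h}.
  apply: cont_sub.
    by apply: (cont_comp (g := F)) => //; rewrite g0; exact: Ck_continuous FC Up.
  by apply: (cont_comp (g := G)) => //; rewrite g0; exact: Ck_continuous GC Vp.
rewrite (phiF _ Up Xp) (psiG _ Vp Xp); apply/eqP; rewrite -subr_eq0 -g0 -/(h 0); apply/eqP.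
have H1 : h s @[s --> 0^'+] --> h 0 by exact: cvg_at_right_filter hc.
have H2 : h s @[s --> 0^'+] --> (0 : R).
  have nW (W : set 'rV[R]_(1 + 3)) : open W -> W p -> \forall s \near 0^'+, W (g s).
    move=> oW Wp; have gr : g s @[s --> 0^'+] --> g 0 by exact: cvg_at_right_filter (gc 0).
    by apply: gr; rewrite g0; exact: open_nbhs_nbhs.
  apply: cvg_near_cst; near=> s.
  have s0 : 0 < s by near: s; exact: nbhs_right_gt.
  have Us : U (g s) by near: s; exact: nW.
  have Vs : V (g s) by near: s; exact: nW.
  have Os := gO _ s0.
  by rewrite /h -(phiF _ Us (OX _ Os)) -(psiG _ Vs (OX _ Os)) eqO// subrr.
exact: cvg_unique H1 H2.
Unshelve. all: by end_near.
Qed.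

End Uniqueness.

Theorem theorem2 (R : realType) (Q : 'M[R]_(1 + 3))
    (psi0 : R -> 'rV[R]_3 -> R)
    (hQ : null_form Q)
    (hsmooth : smooth_on cylinder (fun p => psi0 (tcoord p) (xcoord p)))
    (hsupp : compactly_supported_in cylinder
               (fun p => psi0 (tcoord p) (xcoord p))) :
  exists delta0 : R, 0 < delta0 /\
    forall delta : R, 0 < delta < delta0 ->
      exists phi : 'rV[R]_(1 + 3) -> R,
        [/\ classical_solution Q (region delta) phi,
            has_radiation_field delta phi (past_data psi0 delta) &
            forall phi' : 'rV[R]_(1 + 3) -> R,
              classical_solution Q (region delta) phi' ->
              has_radiation_field delta phi' (past_data psi0 delta) ->
              forall p, region delta p -> phi' p = phi p].
Proof.
have [c QE] := null_form_metric hQ.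
have fs := zero_ext_smooth hsmooth hsupp.
have [C C0 waveC] := wave_bound fs.
have [B B0 BP] := smooth_datum_bounded fs.
set f := zero_ext psi0 in fs waveC BP.
(* For [delta < k^-1 ^+ 2] one has [k * Num.sqrt delta < 1], hence [|c w| < 1] on [t <= -1]; the
   summand 1 keeps [k] positive when [c] or [C] is 0. *)
pose k := `|c| * C + 1.
have k0 : 0 < k by rewrite ltr_wpDl// mulr_ge0.
exists (k^-1 ^+ 2); split; first by rewrite exprn_gt0// invr_gt0.
move=> delta /andP[d0 dk].
have sk : Num.sqrt delta < k^-1.
  have k1 : 0 <= k^-1 by rewrite invr_ge0 ltW.
  by rewrite -[ltRHS](ger0_norm k1) -sqrtr_sqr ltr_sqrt// exprn_gt0// invr_gt0.
have cw p : tcoord p <= -1 -> c * wave f delta p < 1.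
  move=> pt; apply: le_lt_trans (ler_norm _) _; rewrite normrM.
  apply: (@le_lt_trans _ _ (`|c| * (C * Num.sqrt delta))).
    by rewrite ler_wpM2l// waveC.
  rewrite mulrA; apply: (@le_lt_trans _ _ (k * Num.sqrt delta)).
    by rewrite ler_wpM2r ?sqrtr_ge0// lerDl.
  by rewrite -ltr_pdivlMl// mulr1.
have dataE : past_data psi0 delta = fun ub w => Num.sqrt delta * f (ub / delta) w.
  by apply/funext => ub; apply/funext => w; exact: past_dataE.
have dataB ub w : ub <= delta -> sphere2 w ->
    `|past_data psi0 delta ub w| <= Num.sqrt delta * B.
  move=> _ sw; rewrite dataE normrM (ger0_norm (sqrtr_ge0 _)).
  by rewrite ler_wpM2l ?sqrtr_ge0// BP.
have waver : has_radiation_field delta (wave f delta) (past_data psi0 delta).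
  by rewrite dataE; exact: wave_radiation.
pose phi p := nirenberg_inv c (wave f delta p).
have phis : classical_solution Q (region delta) phi.
  apply: nirenberg_inv_solution => //.
  - exact: wave_Ck.
  - exact: wave_box.
  - by move=> p [_ pt]; exact: cw.
exists phi; split=> //.
  apply: (has_radiation_field_comp dataB _ _ waver); first exact: nirenberg_inv0.
  have c01 : c * 0 < 1 by rewrite mulr0.
  by have := nirenberg_inv_derive c01; rewrite mulr0 subr0 invr1.
move=> phi' phis' phir'.
(* It suffices to compare in the interior, where [phi'] is itself of class [C^2] and satisfies the
   equation without extensions. *)
apply: (classical_solution_closure phis' phis) => p Op.
set Omega := [set p : 'rV[R]_(1 + 3) | ubar p < delta /\ tcoord p < -1] in Op.
have oO : open Omega by exact: region_interior_open.
have OX : Omega `<=` region delta by move=> q [a b]; split; exact: ltW.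
have [phiC phiE] := classical_solution_open oO OX phis'.
have waveO : Ck 2 Omega (wave f delta) by apply: Ck_subset (wave_Ck fs 2 delta).
have TC : Ck 2 Omega (fun q => nirenberg c (phi' q)).
  apply: (comp_Ck2 (S1 := fun y => expR (- (c * y)))
    (S2 := fun y => - c * expR (- (c * y))) oO phiC).
  - by move=> q _; exact: nirenberg_derive.
  - by move=> q _; exact: nirenberg_derive1.
  move=> q _; apply: cont_mul; first exact: cont_cst.
  exact: der_continuous (nirenberg_derive1 c _).
have Tr : has_radiation_field delta (fun q => nirenberg c (phi' q)) (past_data psi0 delta).
  apply: (has_radiation_field_comp dataB _ _ phir'); first exact: nirenberg0.
  by have := nirenberg_derive c 0; rewrite mulr0 oppr0 expR0.
have vr := has_radiation_field_sub Tr waver.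
have v0 := radiation_field0_vanish (Ck_sub oO TC waveO) _ _ Op.
(* Substituting in both solutions turns [phi] back into the wave, so the claim becomes the vanishing
   of a solution of the wave equation whose radiation field is zero. *)
apply: (@nirenberg_inj _ c).
rewrite /phi nirenberg_invK; last by apply: cw; exact: ltW (proj2 Op).
apply/eqP; rewrite -subr_eq0; apply/eqP; apply: v0.
  move=> q Oq; rewrite (box_sub oO TC waveO Oq) wave_box// subr0.
  exact: nirenberg_box QE oO phiC (phiE _ Oq) Oq.
move=> a e e0; have [M [Mr HM]] := vr a e e0.
exists M; split=> // u uM ub w abd sw.
by have := HM u uM ub w abd sw; rewrite !subrr.
Qed.
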